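(* For all bipartite states $\rho$ (shared by Alice, $A$, and Charlie, $C$) and $\rho'$ (shared by Charlie, $C'$, and Bob, $B$), the one-way key swapping rate ${}^{\langle}R^{\rangle\,\to}_D(\rho,\rho')$ satisfies $${}^{\langle}R^{\rangle\,\to}_D(\rho,\rho')\ \le\ E_D^\to(\rho\otimes\rho'),$$ where $E_D^\to(\rho\otimes\rho')$ is the one-way distillable entanglement of $\rho\otimes\rho'$ between the sender Charlie, holding $CC'$, and a single receiver holding both $A$ and $B$.
   Context: All systems are finite-dimensional. $\varrho\approx_\varepsilon\varsigma$ means $\frac12\|\varrho-\varsigma\|_1\le\varepsilon$. Private states: $\gamma^m$ denotes any state of the form $T(\Phi^m\otimes\sigma)T^\dagger$ shared by two parties, each holding a key system of dimension $2^m$ and a shield system of arbitrary finite dimension; $\Phi^m$ is the maximally entangled state of the two key systems, $\sigma$ is an arbitrary state of the shield systems, and $T=\sum_{ij}|ij\rangle\langle ij|\otimes U_i$ with $U_i$ arbitrary unitaries on the joint shield. The key attacked state $\hat\gamma$ is obtained from $\gamma$ by measuring both key systems in the computational basis. A private state is strictly irreducible if $\hat\gamma$ is separable between the two parties; such states with key dimension $2^m$ are denoted $\gamma^{\langle m\rangle}$. One-way key swapping rate: $${}^{\langle}R^{\rangle\,\to}_D(\rho,\rho')=\lim_{\varepsilon,\epsilon,\epsilon'\to0}\ \lim_{n\to\infty}\ \sup_{\Gamma,\Gamma',\Lambda,\mathcal{M}}\ R,$$ where the supremum is over rates $R$ and maps such that, for some $r,r'$, some strictly irreducible private states $\gamma^{\langle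 nr\rangle}$ (between $A$ and $C$) and $\gamma^{\langle nr'\rangle}$ (between $C'$ and $B$), and some private state $\gamma^{nR}$ between Alice and Bob, $$\Gamma(\rho^{\otimes n})\approx_{\epsilon}\gamma^{\langle nr\rangle},\qquad \Gamma'(\rho'^{\otimes n})\approx_{\epsilon'}\gamma^{\langle nr'\rangle},\qquad \Lambda\circ\mathcal{M}(\gamma^{\langle nr\rangle}\otimes\gamma^{\langle nr'\rangle})\approx_\varepsilon\gamma^{nR}.$$ Here $\Gamma$ is a one-way LOCC protocol with communication from $C$ to $A$, $\Gamma'$ is a one-way LOCC protocol with communication from $C'$ to $B$, $\mathcal{M}$ is a measurement on Charlie's systems $CC'$ (jointly) whose classical outcome is made available to both Alice and Bob, and $\Lambda$ is a two-way LOCC protocol between Alice and Bob (which may use Charlie's outcome). One-way distillable entanglement: $E_D^\to(\tau)=\lim_{\varepsilon\to0}\lim_{n\to\infty}\sup_\Lambda\{E:\Lambda(\tau^{\otimes n})\approx_\varepsilon\Phi^{nE}\}$, where $\Lambda$ ranges over bipartite LOCC protocols with classical communication only from sender to receiver. *)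

(* Defs.v *)
From HB Require Import structures.
From mathcomp Require Import all_boot all_order all_algebra.
From mathcomp Require Import complex.
From mathcomp Require Import all_classical all_reals all_analysis.

Set Implicit Arguments.
Unset Strict Implicit.
Unset Printing Implicit Defensive.

Import Order.TTheory GRing.Theory Num.Theory.
Import numFieldNormedType.Exports.

Local Open Scope classical_set_scope.
Local Open Scope ring_scope.
Local Open Scope sesquilinear_scope.

(* A system is a finType labelling an orthonormal basis of its Hilbert space;
   composite systems are product types.  The notations below are the canonical
   finType structures on X * Y, 'I_d and {ffun 'I_n -> X}. *)
Notation "X ** Y" := (fintype.Datatypes_prod__canonical__fintype_Finite X Y)
  (at level 40, left associativity).
Notation key d := (fintype.fintype_ordinal__canonical__fintype_Finite d).
Notation copies n X :=
  (finfun.finfun_finfun_of__canonical__fintype_Finite (key n) X).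

Definition op (R : realType) (X : finType) : Type := 'M[complex R]_#|X|.
Notation superop R X Y := (op R X -> op R Y).

Section Operators.
Context {R : realType}.
Implicit Types X Y Z : finType.

Definition ent X (A : op R X) (x y : X) : complex R :=
  A (enum_rank x) (enum_rank y).

Definition mkop X (f : X -> X -> complex R) : op R X :=
  \matrix_(i, j) f (enum_val i) (enum_val j).

(* |x><y| *)
Definition outer X (x y : X) : op R X :=
  delta_mx (enum_rank x) (enum_rank y).

Definition tens X Y (A : op R X) (B : op R Y) : op R (X ** Y) :=
  mkop (fun p q => ent A p.1 q.1 * ent B p.2 q.2).

(* Reordering of tensor factors: for a bijection f : Y -> X this is the operator
   A rewritten in the basis labelled by Y. *)
Definition relabel X Y (f : Y -> X) (A : op R X) : op R Y :=
  mkop (fun p q => ent A (f p) (f q)).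

Definition psd X (A : op R X) : Prop :=
  forall v : 'cV[complex R]_#|X|, 0 <= (v^t* *m A *m v) 0 0.

Definition density X (rho : op R X) : Prop := psd rho /\ \tr rho = 1.

(* Square root of a positive semidefinite matrix: spectralmx H is unitary and
   H = invmx (spectralmx H) *m diag_mx (spectral_diag H) *m spectralmx H. *)
Definition sqrtmx k (H : 'M[complex R]_k) : 'M[complex R]_k :=
  invmx (spectralmx H) *m diag_mx (map_mx sqrtC (spectral_diag H))
    *m spectralmx H.

(* ||A||_1 = tr sqrt(A^* A), a nonnegative real *)
Definition trnorm X (A : op R X) : R :=
  complex.Re (\tr (sqrtmx (A^t* *m A))).

Definition trace_close X (eps : R) (rho sigma : op R X) : Prop :=
  2^-1 * trnorm (rho - sigma) <= eps.

(* E (x) F on a composite system, as the linear extension of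
   |x><x'| (x) |y><y'|  |->  E |x><x'| (x) F |y><y'|  (for linear E, F). *)
Definition tens_map X X' Y Y' (E : superop R X X') (F : superop R Y Y') :
    superop R (X ** Y) (X' ** Y') :=
  fun rho => \sum_(x : X) \sum_(x' : X) \sum_(y : Y) \sum_(y' : Y)
    ent rho (x, y) (x', y') *: tens (E (outer x x')) (F (outer y y')).

Definition cp X Y (E : superop R X Y) : Prop :=
  linear E /\
  forall (Z : finType) (rho : op R (Z ** X)), psd rho ->
    psd (tens_map (fun s : op R Z => s) E rho).

Definition channel X Y (E : superop R X Y) : Prop :=
  cp E /\ forall rho, \tr (E rho) = \tr rho.

Definition instrument X Y (I : finType) (E : I -> superop R X Y) : Prop :=
  (forall i, cp (E i)) /\ forall rho, \tr (\sum_i E i rho) = \tr rho.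

Definition povm X (I : finType) (M : I -> op R X) : Prop :=
  (forall i, psd (M i)) /\ \sum_i M i = 1%:M.

(* One-way LOCC from the first party to the second: the first party applies an
   instrument and the second a channel depending on the announced outcome. *)
Definition oneway_lr (A B A' B' : finType) (L : superop R (A ** B) (A' ** B')) :
    Prop :=
  exists (I : finType) (E : I -> superop R A A') (D : I -> superop R B B'),
    [/\ instrument E, (forall i, channel (D i)) &
        forall rho, L rho = \sum_i tens_map (E i) (D i) rho].

Definition oneway_rl (A B A' B' : finType) (L : superop R (A ** B) (A' ** B')) :
    Prop :=
  exists (I : finType) (D : I -> superop R A A') (E : I -> superop R B B'),
    [/\ (forall i, channel (D i)), instrument E &
        forall rho, L rho = \sum_i tens_map (D i) (E i) rho].

(* Two-way LOCC with finitely many rounds: in each round one party applies an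
   instrument, announces the outcome, and the rest of the protocol depends on
   it. *)
Inductive locc (A' B' : finType) :
    forall A B : finType, superop R (A ** B) (A' ** B') -> Prop :=
| locc_local (A B : finType) (E : superop R A A') (F : superop R B B') :
    channel E -> channel F -> @locc A' B' A B (tens_map E F)
| locc_left (A B A1 I : finType) (E : I -> superop R A A1)
    (L : I -> superop R (A1 ** B) (A' ** B')) :
    instrument E -> (forall i, @locc A' B' A1 B (L i)) ->
    @locc A' B' A B
      (fun rho => \sum_i L i (tens_map (E i) (fun s : op R B => s) rho))
| locc_right (A B B1 I : finType) (E : I -> superop R B B1)
    (L : I -> superop R (A ** B1) (A' ** B')) :
    instrument E -> (forall i, @locc A' B' A B1 (L i)) ->
    @locc A' B' A B
      (fun rho => \sum_i L i (tens_map (fun s : op R A => s) (E i) rho)).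

Definition separable (A B : finType) (rho : op R (A ** B)) : Prop :=
  exists (I : finType) (p : I -> R) (alpha : I -> op R A) (beta : I -> op R B),
    [/\ (forall i, 0 <= p i), \sum_i p i = 1,
        (forall i, density (alpha i)), (forall i, density (beta i)) &
        rho = \sum_i real_complex R (p i) *: tens (alpha i) (beta i)].

(* rho^{(x) n} for a bipartite state, grouped as A^n : B^n. *)
Definition tpow (A B : finType) (n : nat) (rho : op R (A ** B)) :
    op R (copies n A ** copies n B) :=
  mkop (fun p q : copies n A ** copies n B =>
    \prod_(k < n) ent rho (p.1 k, p.2 k) (q.1 k, q.2 k)).

Definition maxent (d : nat) : op R (key d ** key d) :=
  \sum_(i < d) \sum_(j < d) d%:R^-1 *: outer (i, i) (j, j).

(* d = 2^m; m is any real for which 2^m is an integer. *)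
Definition keydim (d : nat) (m : R) : Prop := d%:R = 2 `^ m.

Definition regroup (A B C D : Type) (p : (A * B) * (C * D)) :
    (A * C) * (B * D) :=
  ((p.1.1, p.2.1), (p.1.2, p.2.2)).

Definition twist d (S : finType) (U : 'I_d -> 'I_d -> op R S) :
    op R ((key d ** key d) ** S) :=
  \sum_(i < d) \sum_(j < d) tens (outer (i, j) (i, j)) (U i j).

(* Each party holds a key 'I_d and a shield (SA, resp. SB); regroup turns
   (keys) : (shields) into (first party) : (second party). *)
Definition private_state (d : nat) (SA SB : finType)
    (gamma : op R ((key d ** SA) ** (key d ** SB))) : Prop :=
  exists (sigma : op R (SA ** SB))
         (U : 'I_d -> 'I_d -> op R (SA ** SB)),
    [/\ density sigma, (forall i j, U i j \is unitarymx) &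
        gamma = relabel (@regroup _ _ _ _)
          (twist U *m tens (maxent d) sigma *m (twist U)^t*)].

Definition key_attacked (d : nat) (SA SB : finType)
    (gamma : op R ((key d ** SA) ** (key d ** SB))) :
    op R ((key d ** SA) ** (key d ** SB)) :=
  \sum_(i < d) \sum_(j < d)
    let P := tens (tens (outer i i) 1%:M) (tens (outer j j) 1%:M) in
    P *m gamma *m P.

Definition strictly_irreducible (d : nat) (SA SB : finType)
    (gamma : op R ((key d ** SA) ** (key d ** SB))) : Prop :=
  private_state gamma /\ separable (key_attacked gamma).

(* The measurement M on CC', its outcome k being given to both other parties as
   the classical register state |kk><kk|. *)
Definition broadcast X (I : finType) (M : I -> op R X) :
    superop R X (I ** I) :=
  fun rho => \sum_i \tr (M i *m rho) *: outer (i, i) (i, i).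

Definition gather_charlie (A B C C' : Type) (p : (A * B) * (C * C')) :
    (A * C) * (C' * B) :=
  ((p.1.1, p.2.1), (p.2.2, p.1.2)).

Definition charlie_measure (A B C C' I : finType)
    (M : I -> op R (C ** C')) :
    superop R ((A ** C) ** (C' ** B)) ((A ** I) ** (B ** I)) :=
  fun omega => relabel (@regroup _ _ _ _)
    (tens_map (fun s : op R (A ** B) => s) (broadcast M)
       (relabel (@gather_charlie _ _ _ _) omega)).

Definition key_swap_rates (A B C C' : finType) (rho : op R (A ** C))
    (rho' : op R (C' ** B)) (eps e e' : R) (n : nat) : set R :=
  [set rate | exists (r r' : R) (d1 d2 d : nat)
      (SA SC SC' SB TA TB I : finType)
      (gamma1 : op R ((key d1 ** SA) ** (key d1 ** SC)))
      (gamma2 : op R ((key d2 ** SC') ** (key d2 ** SB)))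
      (gamma : op R ((key d ** TA) ** (key d ** TB)))
      (G : superop R (copies n A ** copies n C)
                     ((key d1 ** SA) ** (key d1 ** SC)))
      (G' : superop R (copies n C' ** copies n B)
                      ((key d2 ** SC') ** (key d2 ** SB)))
      (M : I -> op R ((key d1 ** SC) ** (key d2 ** SC')))
      (L : superop R (((key d1 ** SA) ** I) ** ((key d2 ** SB) ** I))
                     ((key d ** TA) ** (key d ** TB))),
    [/\ [/\ keydim d1 (n%:R * r), keydim d2 (n%:R * r')
          & keydim d (n%:R * rate)],
        [/\ strictly_irreducible gamma1, strictly_irreducible gamma2
          & private_state gamma],
        [/\ oneway_rl G, oneway_lr G', povm M & locc L]
      & [/\ trace_close e (G (tpow n rho)) gamma1,
            trace_close e' (G' (tpow n rho')) gamma2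
          & trace_close eps (L (charlie_measure M (tens gamma1 gamma2))) gamma]]].

(* The limit in n is a limsup, so that it is always defined; the result is
   nondecreasing in each of the three errors, so the outer limit exists. *)
Definition key_swap_rate (A B C C' : finType) (rho : op R (A ** C))
    (rho' : op R (C' ** B)) : \bar R :=
  lim ((fun t : R * R * R =>
          limn_esup (fun n =>
            ereal_sup [set rate%:E |
              rate in key_swap_rates rho rho' t.1.1 t.1.2 t.2 n]))
       @ filter_prod (filter_prod (0 : R)^'+ (0 : R)^'+) (0 : R)^'+).

(* The sender is the first party of tau, the receiver the second. *)
Definition distill_rates (S T : finType) (tau : op R (S ** T)) (eps : R)
    (n : nat) : set R :=
  [set rate | exists (d : nat)
      (L : superop R (copies n S ** copies n T)
                     (key d ** key d)),
    [/\ keydim d (n%:R * rate), oneway_lr L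
      & trace_close eps (L (tpow n tau)) (maxent d)]].

Definition oneway_distillable (S T : finType) (tau : op R (S ** T)) : \bar R :=
  lim ((fun eps : R =>
          limn_esup (fun n =>
            ereal_sup [set rate%:E | rate in distill_rates tau eps n]))
       @ (0 : R)^'+).

(* rho (x) rho' as a bipartite state between Charlie (CC') and a joint AB. *)
Definition charlie_ab (A B C C' : Type) (p : (C * C') * (A * B)) :
    (A * C) * (C' * B) :=
  ((p.2.1, p.1.1), (p.1.2, p.2.2)).

Definition charlie_vs_ab (A B C C' : finType) (rho : op R (A ** C))
    (rho' : op R (C' ** B)) : op R ((C ** C') ** (A ** B)) :=
  relabel (@charlie_ab A B C C') (tens rho rho').

End Operators.

(* Main.v *)
Require Import Defs.
From mathcomp Require Import all_boot all_order all_algebra.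
From mathcomp Require Import complex.
From mathcomp Require Import all_classical all_reals all_analysis.
From mathcomp Require Import ring lra.

(** A private state is V sigma V^*/d with V = sum_a |aa> (x) U_a, and product
    states pass the test V V^*/d with probability at most 1/d.  Pulling the
    test for the final key back through Lambda gives, for each outcome k of
    Charlie's measurement, an effect T_k on AB which accepts gamma (x) gamma'
    almost surely, but accepts the key attacked pair, which is separable, with
    probability at most 1/d.  As the key attacked pair is the average of
    gamma (x) gamma' over random diagonal signs applied to the keys, the T_k
    tell such signs apart: about delta d messages, encoded in independent
    random signs, are decoded from the T_k with small error.

    On gamma (x) gamma' a sign on Charlie's keys acts as the same sign on the
    keys of AB.  So Charlie prepares a uniform superposition of N messages m,
    applies the m-th random sign to his keys coherently, measures, and
    announces the outcome and the code; AB decode m coherently and undo the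
    sign.  This leaves a state close to the maximally entangled state of
    dimension N = floor(delta d) + 1, and log N is at least log d up to a
    constant, which disappears in the rate. *)

Set Implicit Arguments.
Unset Strict Implicit.
Unset Printing Implicit Defensive.

Import Order.TTheory GRing.Theory Num.Theory.
Import numFieldNormedType.Exports.

Local Open Scope ring_scope.
Local Open Scope sesquilinear_scope.

(** * Positive matrices *)

Section Adjoint.
Variable C : numClosedFieldType.

(** Lambda is two-way and cannot be run when only Charlie speaks. It enters solely through the test
    it pulls back, as evidence that the signs are distinguishable; the decoding is a joint operation
    of the receiver, who holds A and B together. Separability of the attacked states matters because
    Charlie's measurement then leaves AB in a mixture of products, and LOCC maps products to
    mixtures of products.

    The decoder is coherent, so what counts is the amplitude with which m is recovered, not a
    probability. With S the sum of the signed tests T_m, the operators 2 T_m (1 + S)^-1 have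
    amplitude close to 1 where T_m accepts and S - T_m does not, and 4 x <= (1 + x)^2 makes them a
    subnormalised measurement.

    Outcome k is carried by an unnormalised state omega_k. All estimates are linear in it and are
    summed over k, so no outcome has to be good individually. To keep this linearity, Cauchy-Schwarz
    is used with a free weight t instead of square roots of errors. The ratio delta depends only on
    the target error, so log N falls short of log d by a constant independent of n. *)

Lemma adjmxM m n p (A : 'M[C]_(m, n)) (B : 'M[C]_(n, p)) :
  (A *m B)^t* = B^t* *m A^t*.
Proof. by rewrite trmx_mul map_mxM. Qed.

Lemma adjmxD m n (A B : 'M[C]_(m, n)) : (A + B)^t* = A^t* + B^t*.
Proof. by rewrite linearD map_mxD. Qed.

Lemma adjmxN m n (A : 'M[C]_(m, n)) : (- A)^t* = - A^t*.
Proof. by rewrite linearN map_mxN. Qed.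

Lemma adjmxB m n (A B : 'M[C]_(m, n)) : (A - B)^t* = A^t* - B^t*.
Proof. by rewrite adjmxD adjmxN. Qed.

Lemma adjmxZ m n a (A : 'M[C]_(m, n)) : (a *: A)^t* = a^* *: A^t*.
Proof. by rewrite linearZ map_mxZ. Qed.

Lemma adjmx1 n : (1%:M : 'M[C]_n)^t* = 1%:M.
Proof. by rewrite trmx1 map_mx1. Qed.

Lemma adjmx_sum m n (I : finType) (F : I -> 'M[C]_(m, n)) :
  (\sum_i F i)^t* = \sum_i (F i)^t*.
Proof.
rewrite (raddf_sum (@trmx C m n)).
by rewrite (raddf_sum (@map_mx C C Num.conj n m)).
Qed.

Lemma trace_adj n (A : 'M[C]_n) : \tr (A^t*) = (\tr A)^*.
Proof. by rewrite /mxtrace rmorph_sum; apply: eq_bigr => i _; rewrite !mxE. Qed.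

End Adjoint.

Section Positive.
Variable C : numClosedFieldType.

(** This is [psd] for an arbitrary matrix size; at size [#|X|] the two are convertible, and the
    lemmas below are applied to [psd] directly. *)
Definition psdmx n (A : 'M[C]_n) : Prop :=
  forall v : 'cV[C]_n, 0 <= (v^t* *m A *m v) 0 0.

Lemma gram_ge0 m (v : 'cV[C]_m) : 0 <= (v^t* *m v) 0 0.
Proof.
rewrite mxE sumr_ge0 // => i _; rewrite !mxE mulrC; exact: mul_conjC_ge0.
Qed.

Lemma psdmx_gram m n (B : 'M[C]_(m, n)) : psdmx (B^t* *m B).
Proof.
move=> v; have := gram_ge0 (B *m v); by rewrite adjmxM !mulmxA.
Qed.

Lemma psdmx_conj m n (B : 'M[C]_(m, n)) (A : 'M[C]_m) :
  psdmx A -> psdmx (B^t* *m A *m B).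
Proof. by move=> pA v; have := pA (B *m v); rewrite adjmxM !mulmxA. Qed.

Lemma psdmxD n (A B : 'M[C]_n) : psdmx A -> psdmx B -> psdmx (A + B).
Proof. by move=> pA pB v; rewrite mulmxDr mulmxDl mxE addr_ge0. Qed.

Lemma psdmx0 n : psdmx (0 : 'M[C]_n).
Proof. by move=> v; rewrite mulmx0 mul0mx mxE. Qed.

Lemma psdmx1 n : psdmx (1%:M : 'M[C]_n).
Proof. by rewrite -[1%:M]mulmx1 -{1}adjmx1; apply: psdmx_gram. Qed.

Lemma psdmxZ n a (A : 'M[C]_n) : 0 <= a -> psdmx A -> psdmx (a *: A).
Proof. by move=> a0 pA v; rewrite -scalemxAr -scalemxAl mxE mulr_ge0. Qed.

Lemma psdmx_sum n (I : finType) (F : I -> 'M[C]_n) :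
  (forall i, psdmx (F i)) -> psdmx (\sum_i F i).
Proof.
move=> pF; elim/big_ind: _ => //; [exact: psdmx0 | exact: psdmxD].
Qed.

Lemma form_delta n (A : 'M[C]_n) i j :
  ((delta_mx i 0 : 'cV_n)^t* *m A *m (delta_mx j 0 : 'cV_n)) 0 0 = A i j.
Proof.
rewrite -colE mxE mxE (bigD1 i) //= big1 ?addr0; last first.
  by move=> k ki; rewrite !mxE (negPf ki) /= conjC0 mul0r.
by rewrite !mxE eqxx /= conjC1 mul1r.
Qed.

(** Polarisation: the form is real at e_i + e_j and at e_i + 'i e_j, which fixes the sum and the
    difference of the conjugates of [A i j] and [A j i]. *)
Lemma psdmx_adj n (A : 'M[C]_n) : psdmx A -> A^t* = A.
Proof.
move=> pA; apply/matrixP => i j; rewrite !mxE.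
pose e k : 'cV[C]_n := delta_mx k 0.
have f k l : ((e k)^t* *m A *m e l) 0 0 = A k l by apply: form_delta.
have r k : (A k k)^* = A k k by apply: conj_Creal; rewrite ger0_real // -f.
have exp c : ((e i + c *: e j)^t* *m A *m (e i + c *: e j)) 0 0
    = A i i + c * A i j + c^* * A j i + c^* * c * A j j.
  have mD (X Y : 'M[C]_1) : (X + Y) 0 0 = X 0 0 + Y 0 0 by rewrite mxE.
  have mZ a (X : 'M[C]_1) : (a *: X) 0 0 = a * X 0 0 by rewrite mxE.
  rewrite adjmxD adjmxZ !mulmxDl !mulmxDr -!scalemxAl -!scalemxAr.
  rewrite !(mD, mZ) !f; ring.
have := pA (e i + 1 *: e j); rewrite exp => /ger0_real /conj_Creal.
have := pA (e i + 'i *: e j); rewrite exp => /ger0_real /conj_Creal.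
rewrite !rmorphD !rmorphM /= !conjCK conjCi !conjC1 !r.
rewrite !mul1r.
set x := A i j; set y := A j i => h1 h2.
have e2 : x^* + y^* = x + y.
  apply: (addrI (A i i)); apply: (addIr (A j j)); rewrite !addrA.
  by rewrite h2.
have e1 : - 'i * x^* + 'i * y^* = 'i * x - 'i * y.
  apply: (addrI (A i i)); apply: (addIr ('i * - 'i * A j j)).
  by rewrite !addrA h1; ring.
have e3 : y^* - x^* = x - y.
  by apply: (mulfI (neq0Ci C)); rewrite !mulrBr -e1; ring.
apply: (@mulfI _ 2%:R); first by rewrite pnatr_eq0.
have -> : 2%:R * y^* = (x^* + y^*) + (y^* - x^*) by ring.
by rewrite e2 e3; ring.
Qed.

Lemma psdmx_spectral n (A : 'M[C]_n) : psdmx A ->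
  exists (V : 'M[C]_n) (d : 'rV[C]_n),
    [/\ V \is unitarymx, forall i, 0 <= d 0 i & A = V^t* *m diag_mx d *m V].
Proof.
move=> pA; have hA := psdmx_adj pA.
have nA : A \is normalmx by apply/normalmxP; rewrite hA.
have uV := spectral_unitarymx A.
have eA : A = (spectralmx A)^t* *m diag_mx (spectral_diag A) *m spectralmx A.
  by rewrite -invmx_unitary //; apply/orthomx_spectralP.
exists (spectralmx A), (spectral_diag A); split=> // i.
have := psdmx_conj ((spectralmx A)^t* ) pA; rewrite trmxCK {2}eA.
rewrite !mulmxA (unitarymxP uV) mul1mx -mulmxA (unitarymxP uV) mulmx1.
by move/(_ (delta_mx i 0)); rewrite form_delta mxE eqxx mulr1n.
Qed.

Lemma psdmx_factor n (A : 'M[C]_n) : psdmx A ->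
  exists B : 'M[C]_n, A = B^t* *m B.
Proof.
case/psdmx_spectral=> V [d [uV d0 ->]].
exists (diag_mx (map_mx sqrtC d) *m V).
rewrite adjmxM -!mulmxA; congr (_ *m _); rewrite mulmxA; congr (_ *m _).
rewrite tr_diag_mx map_diag_mx mulmx_diag; congr diag_mx.
apply/rowP => i; rewrite !mxE.
have s0 : (sqrtC (d 0 i))^* = sqrtC (d 0 i).
  by rewrite conj_Creal ?ger0_real ?sqrtC_ge0.
by rewrite -[LHS]sqrtCK expr2 -{1}s0.
Qed.

Lemma psdmx_trM_ge0 n (A B : 'M[C]_n) :
  psdmx A -> psdmx B -> 0 <= \tr (A *m B).
Proof.
move=> pA /psdmx_factor [b ->]; rewrite mulmxA mxtrace_mulC mulmxA.
have := psdmx_conj (b^t* ) pA; rewrite trmxCK => p.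
by apply: sumr_ge0 => i _; rewrite -form_delta.
Qed.

Lemma psdmx_trM_le n (A B D : 'M[C]_n) :
  psdmx A -> psdmx (D - B) -> \tr (A *m B) <= \tr (A *m D).
Proof.
by move=> pA pD; rewrite -subr_ge0 -linearB -mulmxBr psdmx_trM_ge0.
Qed.

Lemma psdmx_le_trans n (A B D : 'M[C]_n) :
  psdmx (B - A) -> psdmx (D - B) -> psdmx (D - A).
Proof.
by move=> p q; have := psdmxD q p; rewrite addrA addrNK.
Qed.

(* Cauchy-Schwarz with a free weight t, so that no square root is needed and
   the bound can be summed over decompositions of rho. *)
Lemma tr_CauchySchwarz n m (rho : 'M[C]_n) (A : 'M[C]_(n, m)) (B : 'M[C]_(m, n))
    (t : C) : psdmx rho -> 0 < t ->
  'Re (\tr (rho *m (A *m B))) *+ 2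
    <= t * \tr (rho *m (A *m A^t*)) + t^-1 * \tr (rho *m (B^t* *m B)).
Proof.
move=> pr t0.
have tr : t^* = t by apply: conj_Creal; rewrite gtr0_real.
(* The inequality is the expansion of the Gram matrix of t A^* - B against rho, divided by t. *)
have := psdmx_trM_ge0 pr (psdmx_gram (t *: A^t* - B)).
move/(mulr_ge0 (ltW (_ : 0 < t^-1))); rewrite invr_gt0 => /(_ t0).
rewrite adjmxB adjmxZ trmxCK tr mulmxBl !mulmxBr -!scalemxAl -!scalemxAr.
rewrite -?scalemxAl -?scalemxAr scalerA.
have trB (U V : 'M[C]_n) : \tr (U - V) = \tr U - \tr V by rewrite linearB.
rewrite !(trB, mxtraceZ).
set a := \tr (rho *m (A *m A^t*)); set b := \tr (rho *m (B^t* *m B)).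
have -> : \tr (rho *m (B^t* *m A^t*)) = (\tr (rho *m (A *m B)))^*.
  by rewrite -trace_adj adjmxM adjmxM (psdmx_adj pr) mxtrace_mulC.
have -> : 'Re (\tr (rho *m (A *m B))) *+ 2
   = \tr (rho *m (A *m B)) + (\tr (rho *m (A *m B)))^*.
  by rewrite ReE -mulr_natr mulfVK ?pnatr_eq0.
set x := \tr _; move=> h; rewrite -subr_ge0; move: h.
congr (0 <= _); field; exact: lt0r_neq0.
Qed.


(** T - T^2 equals T (1 - T) T + (1 - T) T (1 - T), a sum of two positive conjugates. *)
Lemma effect_sqr_le n (T : 'M[C]_n) :
  psdmx T -> psdmx (1%:M - T) -> psdmx (T - T *m T).
Proof.
move=> pT p1; have hT := psdmx_adj pT.
have := psdmxD (psdmx_conj T p1) (psdmx_conj (1%:M - T) pT).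
rewrite adjmxB adjmx1 hT; congr psdmx.
rewrite !(mulmxBr, mulmxBl, mulmx1, mul1mx).
move: (T *m T *m T) => b; move: (T *m T) => a.
by apply/matrixP => i j; rewrite !mxE; ring.
Qed.

(** The shift by 1 makes the normalisation of the decoder invertible even where S is singular. *)
Lemma inv_1D_psd n (S : 'M[C]_n) : psdmx S ->
  exists G : 'M[C]_n, [/\ G^t* = G, G *m (1%:M + S) = 1%:M &
    (1%:M + S) *m G = 1%:M].
Proof.
case/psdmx_spectral=> V [d [uV d0 eS]].
have VV : V *m V^t* = 1%:M by apply/unitarymxP.
have VV' : V^t* *m V = 1%:M by rewrite (mulmx1C VV).
pose g : 'rV[C]_n := \row_i (1 + d 0 i)^-1.
have e1 : 1%:M + S = V^t* *m diag_mx (\row_i (1 + d 0 i)) *m V.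
  rewrite eS -{1}VV' -{1}[V^t*]mulmx1 -mulmxDl -mulmxDr; congr (_ *m _ *m _).
  apply/matrixP => i j; rewrite !mxE.
  by case: eqP => _; rewrite ?mulr1n ?mulr0n ?addr0.
have gd : diag_mx g *m diag_mx (\row_i (1 + d 0 i)) = 1%:M.
  rewrite mulmx_diag -diag_const_mx; congr diag_mx.
  apply/rowP => i; rewrite !mxE mulVf //.
  by rewrite lt0r_neq0 // ltr_pwDl.
exists (V^t* *m diag_mx g *m V); rewrite e1; split.
- rewrite !adjmxM trmxCK mulmxA tr_diag_mx map_diag_mx; congr (_ *m diag_mx _ *m _).
  apply/rowP => i; rewrite !mxE; apply: conj_Creal.
  by rewrite realV realD // ger0_real.
- by rewrite !mulmxA -[X in X *m _ *m _]mulmxA VV mulmx1 -[X in X *m _]mulmxA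
    gd mulmx1.
- rewrite !mulmxA -[X in X *m _ *m _]mulmxA VV mulmx1 -[X in X *m _]mulmxA.
  by rewrite (mulmx1C gd) mulmx1.
Qed.

(** * Simultaneous coherent decoding of N effects *)

Section PrettyGood.
Variables (n N : nat) (T : 'I_N -> 'M[C]_n).
Hypothesis T_ge0 : forall m, psdmx (T m).
Hypothesis T_le1 : forall m, psdmx (1%:M - T m).
Let S := \sum_m T m.
Variable G : 'M[C]_n.
Hypothesis G_adj : G^t* = G.
Hypothesis GH : G *m (1%:M + S) = 1%:M.
Hypothesis HG : (1%:M + S) *m G = 1%:M.

Let S_ge0 : psdmx S. Proof. exact: psdmx_sum. Qed.
Let S_adj : S^t* = S. Proof. exact: psdmx_adj. Qed.
Let H := 1%:M + S.

Let conjG_le1 (X : 'M[C]_n) :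
  psdmx (H *m H - X) -> psdmx (1%:M - G *m X *m G).
Proof.
move/(psdmx_conj G); rewrite G_adj mulmxBr mulmxBl !mulmxA GH mul1mx HG.
done.
Qed.

Let HH : H *m H = 1%:M + S + S + S *m S.
Proof. by rewrite /H mulmxDl !mulmxDr !mul1mx !mulmx1 !addrA. Qed.

(* 4 x / (1 + x)^2 <= 1 *)
Lemma kraus_pretty_good_le1 :
  psdmx (1%:M - \sum_m (2 *: (T m *m G))^t* *m (2 *: (T m *m G))).
Proof.
have -> : \sum_m (2 *: (T m *m G))^t* *m (2 *: (T m *m G))
    = G *m (4 *: \sum_m T m *m T m) *m G.
  rewrite -scalemxAr -scalemxAl mulmx_sumr mulmx_suml scaler_sumr.
  apply: eq_bigr => m _; rewrite adjmxZ adjmxM G_adj (psdmx_adj (T_ge0 m)).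
  rewrite -scalemxAl -scalemxAr scalerA conjC_nat -natrM.
  by rewrite !mulmxA.
apply: conjG_le1.
(* The sum of the T_m^2 is below S because each T_m is an effect, and (1 + S)^2 - 4 S is the square
   of 1 - S. *)
apply: (@psdmx_le_trans _ _ (4 *: S)).
  rewrite -scalerBr; apply: psdmxZ => //; rewrite /S -sumrB.
  by apply: psdmx_sum => m; apply: effect_sqr_le.
have := psdmx_gram (1%:M - S); rewrite adjmxB adjmx1 S_adj; congr psdmx.
rewrite HH !(mulmxBr, mulmxBl, mulmx1, mul1mx).
have -> : 4 *: S = S + S + S + S by rewrite scaler_nat !mulrS mulr0n addr0 !addrA.
move: (S *m S) S 1%:M => a b c.
by apply/matrixP => i j; rewrite !mxE; ring.
Qed.

(** Both [S - T m] and 1 lie below (1 + S)^2; these are the contraction bounds for the two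
    Cauchy-Schwarz estimates to come. *)
Let GXG_le1 m : psdmx (1%:M - G *m (S - T m) *m G) /\ psdmx (1%:M - G *m G).
Proof.
have pSS : psdmx (S *m S) by rewrite -{1}S_adj; apply: psdmx_gram.
split; last rewrite -[X in _ - X *m G]mulmx1; apply: conjG_le1; rewrite HH.
- have := psdmxD (psdmxD (@psdmx1 n) S_ge0) (psdmxD pSS (T_ge0 m)).
  congr psdmx; move: (S *m S) S (T m) 1%:M => a b c d.
  by apply/matrixP => i j; rewrite !mxE; ring.
- have := psdmxD (psdmxD S_ge0 S_ge0) pSS.
  congr psdmx; move: (S *m S) S 1%:M => a b d.
  by apply/matrixP => i j; rewrite !mxE; ring.
Qed.

Let TXT_le1 m (X : 'M[C]_n) : psdmx (1%:M - X) ->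
  psdmx (1%:M - T m *m X *m T m).
Proof.
move=> pX; have hT := psdmx_adj (T_ge0 m).
apply: (@psdmx_le_trans _ _ (T m *m T m)).
  have := psdmx_conj (T m) pX; rewrite hT; congr psdmx.
  by rewrite mulmxBr mulmxBl mulmx1.
by apply: psdmx_le_trans (T_le1 m); apply: effect_sqr_le.
Qed.

(* 2 T G = T + T G (1 - T) - T G (S - T), and Cauchy-Schwarz bounds the last two
   terms. *)
Lemma kraus_pretty_good_succ m (rho : 'M[C]_n) (t : C) : psdmx rho -> 0 < t ->
  'Re (\tr (2 *: (T m *m G) *m rho)) *+ 2 >=
    'Re (\tr (T m *m rho)) *+ 2 - (t * \tr rho + t^-1 * (\tr rho - \tr (T m *m rho)))
      - (t * \tr rho + t^-1 * \tr ((S - T m) *m rho)).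
Proof.
move=> pr t0.
set S' := S - T m.
have pS' : psdmx S'.
  rewrite /S' /S (bigD1 m) //= addrAC subrr add0r.
  by elim/big_ind: _ => //; [exact: psdmx0 | exact: psdmxD].
(* [S - T m] is split as b^* b, one factor on each side of Cauchy-Schwarz: the left one is
   controlled by G (S - T_m) G <= 1, the right one gives an error linear in [S - T m]. *)
have [b eb] := psdmx_factor pS'.
have hT := psdmx_adj (T_ge0 m).
have split : 2 *: (T m *m G)
    = T m + T m *m G *m (1%:M - T m) - T m *m G *m S'.
  rewrite -addrA -mulmxBr.
  have -> : 1%:M - T m - S' = 2 *: 1%:M - (1%:M + S).
    rewrite /S' scaler_nat; move: S (T m) 1%:M => x y z.
    by apply/matrixP => i j; rewrite !mxE; ring.
  rewrite mulmxBr -[X in _ - X]mulmxA GH -scalemxAr !mulmx1.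
  by rewrite addrCA subrr addr0.
have [g1 g2] := GXG_le1 m.
have cs1 := tr_CauchySchwarz (- (T m *m G)) (1%:M - T m) pr t0.
have cs2 := tr_CauchySchwarz (T m *m G *m b^t* ) b pr t0.
have tri : \tr rho = \tr (rho *m 1%:M) by rewrite mulmx1.
have c1 : \tr (rho *m (- (T m *m G) *m (- (T m *m G))^t* )) <= \tr rho.
  rewrite tri; apply: psdmx_trM_le => //.
  rewrite adjmxN mulNmx mulmxN opprK adjmxM hT G_adj -mulmxA (mulmxA G) mulmxA.
  exact: TXT_le1.
have c2 : \tr (rho *m ((1%:M - T m)^t* *m (1%:M - T m)))
    <= \tr rho - \tr (T m *m rho).
  rewrite [\tr (T m *m rho)]mxtrace_mulC tri -linearB -mulmxBr.
  apply: psdmx_trM_le => //; rewrite adjmxB adjmx1 hT.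
  apply: effect_sqr_le => //.
  by rewrite opprB addrCA subrr addr0.
have c3 : \tr (rho *m (T m *m G *m b^t* *m (T m *m G *m b^t* )^t* )) <= \tr rho.
  rewrite tri; apply: psdmx_trM_le => //.
  rewrite !adjmxM trmxCK hT G_adj !mulmxA -(mulmxA _ (b^t* )) -eb.
  by rewrite -!mulmxA (mulmxA G) (mulmxA (G *m _)) mulmxA; apply: TXT_le1.
have trc (X : 'M[C]_n) : \tr (X *m rho) = \tr (rho *m X) by exact: mxtrace_mulC.
have -> : 'Re (\tr (2 *: (T m *m G) *m rho)) = 'Re (\tr (T m *m rho))
   - 'Re (\tr (rho *m (- (T m *m G) *m (1%:M - T m))))
   - 'Re (\tr (rho *m (T m *m G *m b^t* *m b))).
  have ReB (x y : C) : 'Re x - 'Re y = 'Re (x - y) by rewrite raddfB.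
  have trB (X Y : 'M[C]_n) : \tr X - \tr Y = \tr (X - Y) by rewrite linearB.
  rewrite !trc !ReB !trB -!mulmxBr; congr ('Re (\tr (_ *m _))).
  by rewrite split mulNmx opprK -(mulmxA _ (b^t* )) -eb.
rewrite !mulrnBl !lerB //.
- apply: (le_trans cs1); apply: lerD; rewrite ler_pM2l ?invr_gt0 //.
- apply: (le_trans cs2); apply: lerD; rewrite ler_pM2l ?invr_gt0 //.
  by rewrite -eb (mxtrace_mulC S').
Qed.

End PrettyGood.

End Positive.

(** * The trace norm *)

Section TraceNorm.
Variable R : realType.
Local Notation C := (complex R).

Lemma psdmx_diag n (d : 'rV[C]_n) : (forall i, 0 <= d 0 i) -> psdmx (diag_mx d).
Proof.
move=> d0 v; rewrite mul_mx_diag mxE sumr_ge0 // => i _; rewrite !mxE.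
rewrite mulrAC; apply: mulr_ge0 => //; rewrite mulrC; exact: mul_conjC_ge0.
Qed.

(** A singular value decomposition in disguise: the columns of X V^* are orthogonal and their norms
    s are the singular values of X. *)
Lemma trace_sqrtmx_spectral n (X : 'M[C]_n) :
  exists (V : 'M[C]_n) (s : 'rV[C]_n),
    [/\ V \is unitarymx, forall i, 0 <= s 0 i,
        (X *m V^t* )^t* *m (X *m V^t* ) = diag_mx (\row_i (s 0 i ^+ 2))
      & \tr (sqrtmx (X^t* *m X)) = \sum_i s 0 i].
Proof.
set H := X^t* *m X.
have pH : psdmx H by exact: psdmx_gram.
have uV := spectral_unitarymx H.
have VV := unitarymxP uV.
have eH : H = (spectralmx H)^t* *m diag_mx (spectral_diag H) *m spectralmx H.
  rewrite -invmx_unitary //; apply/orthomx_spectralP/normalmxP.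
  by rewrite (psdmx_adj pH).
have eD : (X *m (spectralmx H)^t* )^t* *m (X *m (spectralmx H)^t* )
    = diag_mx (spectral_diag H).
  rewrite adjmxM trmxCK -mulmxA (mulmxA _ X) -/H {2}eH.
  by rewrite !mulmxA VV mul1mx -mulmxA VV mulmx1.
have d0 i : 0 <= spectral_diag H 0 i.
  have := psdmx_gram (X *m (spectralmx H)^t* ); rewrite eD.
  by move/(_ (delta_mx i 0)); rewrite form_delta mxE eqxx mulr1n.
exists (spectralmx H), (map_mx sqrtC (spectral_diag H)); split=> //.
- by move=> i; rewrite mxE sqrtC_ge0.
- by rewrite eD; congr diag_mx; apply/rowP => i; rewrite !mxE sqrtCK.
rewrite /sqrtmx invmx_unitary // mxtrace_mulC mulmxA VV mul1mx mxtrace_diag.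
by apply: eq_bigr => i _; rewrite !mxE.
Qed.

(** Writes a diagonal entry as a trace against a positive matrix, the form to which
    [tr_CauchySchwarz] applies. *)
Lemma diag_entry_functional n (i : 'I_n) : exists2 P : 'M[C]_n,
  psdmx P & forall A, \tr (P *m A) = A i i.
Proof.
pose P : 'M[C]_n := delta_mx i i.
have trP (A : 'M[C]_n) : \tr (P *m A) = A i i.
  rewrite /mxtrace (bigD1 i) //= big1 ?addr0.
    rewrite mxE (bigD1 i) //= big1 ?addr0 ?mxE ?eqxx ?mul1r // => l li.
    by rewrite mxE (negPf li) andbF mul0r.
  by move=> k ki; rewrite mxE big1 // => l _; rewrite mxE (negPf ki) mul0r.
have pP : psdmx P.
  have := psdmx_gram P; congr psdmx; rewrite /P.
  have -> : (delta_mx i i : 'M[C]_n)^t* = delta_mx i i.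
    apply/matrixP => k l; rewrite !mxE andbC; exact: conjC_nat.
  by rewrite mul_delta_mx.
by exists P.
Qed.

(** The upper half of the duality between trace norm and operator norm, checked on each singular
    vector of X. *)
Lemma contraction_tr_le n (X E : 'M[C]_n) : psdmx (1%:M - E *m E^t* ) ->
  'Re (\tr (E *m X)) <= \tr (sqrtmx (X^t* *m X)).
Proof.
move=> pE; have [V [s [uV s0 eD ->]]] := trace_sqrtmx_spectral X.
have VV := unitarymxP uV.
set Y := X *m V^t* in eD.
have -> : \tr (E *m X) = \tr (V *m E *m Y).
  by rewrite /Y mulmxA [RHS]mxtrace_mulC !mulmxA (mulmx1C VV) mul1mx.
clearbody Y.
rewrite raddf_sum; apply: ler_sum => i _.
have [P pP trP] := diag_entry_functional i.
have eDi : (Y^t* *m Y) i i = s 0 i ^+ 2 by rewrite eD !mxE eqxx mulr1n.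
have bnd (t : C) : 0 < t -> 'Re ((V *m E *m Y) i i) *+ 2 <= t + t^-1 * s 0 i ^+ 2.
  move=> t0; have := tr_CauchySchwarz (V *m E) Y pP t0.
  rewrite !trP eDi => h; apply: (le_trans h).
  rewrite lerD2r ler_piMr ?(ltW t0) //.
  have := psdmx_conj (V^t* ) pE => /(_ (delta_mx i 0)); rewrite form_delta.
  rewrite mulmxBr mulmxBl trmxCK mulmx1 VV adjmxM !mulmxA.
  by rewrite mxE [X in 0 <= _ + X]mxE [X in X - _]mxE eqxx subr_ge0 -?mulmxA.
have rx : 'Re ((V *m E *m Y) i i) \is Num.real by exact: Creal_Re.
have rs : s 0 i \is Num.real by rewrite ger0_real.
change ('Re ((V *m E *m Y) i i) <= s 0 i).
rewrite real_leNgt //; apply/negP => lt.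
set x := 'Re _ in bnd rx lt.
(* Taking the weight t to be x itself gives x <= s_i^2 / x, impossible when s_i < x. This covers s_i
   = 0 as well. *)
have x0 : 0 < x by exact: le_lt_trans lt.
have := bnd x x0; apply/negP; rewrite -real_ltNge ?realD ?realM ?realV ?realX //.
  rewrite mulr2n ltrD2l -[ltRHS](mulKf (lt0r_neq0 x0)) ltr_pM2l ?invr_gt0 //.
  by rewrite expr2 ltr_pM.
Qed.

Lemma unitary_conj_sub n (V W : 'M[C]_n) : V *m V^t* = 1%:M ->
  1%:M - V^t* *m W *m (V^t* *m W)^t* = V^t* *m (1%:M - W *m W^t* ) *m V.
Proof.
move=> /mulmx1C VV.
by rewrite mulmxBr mulmxBl mulmx1 VV adjmxM trmxCK !mulmxA.
Qed.

(** The lower half of the duality: the adjoint of the polar part of X attains the trace norm. *)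
Lemma trace_sqrtmx_polar n (X : 'M[C]_n) :
  exists2 A : 'M[C]_n, psdmx (1%:M - A *m A^t* )
    & \tr (A *m X) = \tr (sqrtmx (X^t* *m X)).
Proof.
have [V [s [uV s0 eD ->]]] := trace_sqrtmx_spectral X.
have VV := unitarymxP uV.
set Y := X *m V^t* in eD.
(* The inverse of a zero singular value is 0, so that W W^* is the diagonal projection onto the
   nonzero singular values. *)
pose r : 'rV[C]_n := \row_i (s 0 i)^-1.
have ar : (diag_mx r)^t* = diag_mx r.
  rewrite tr_diag_mx map_diag_mx; congr diag_mx; apply/rowP => i; rewrite !mxE.
  by apply: conj_Creal; rewrite realV ger0_real.
pose W := diag_mx r *m Y^t*.
exists (V^t* *m W); last first.
  rewrite -mulmxA mxtrace_mulC -mulmxA -/Y /W -mulmxA eD mulmx_diag mxtrace_diag.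
  apply: eq_bigr => i _; rewrite !mxE expr2.
  by have [->|nz] := eqVneq (s 0 i) 0; rewrite ?mulr0 // mulKf.
have -> : 1%:M - V^t* *m W *m (V^t* *m W)^t*
    = V^t* *m diag_mx (\row_i (1 - (s 0 i != 0)%:R)) *m V.
  have -> : diag_mx (\row_i (1 - (s 0 i != 0)%:R)) = 1%:M - W *m W^t*.
    rewrite /W (adjmxM (diag_mx r)) trmxCK ar mulmxA -(mulmxA _ _ Y) eD !mulmx_diag.
    rewrite -diag_const_mx -linearB /=; congr diag_mx; apply/rowP => i.
    rewrite !mxE expr2; have [->|nz] := eqVneq (s 0 i) 0.
      by rewrite !(mul0r, mulr0).
    by rewrite mulKf // mulfV.
  exact: unitary_conj_sub.
apply/psdmx_conj/psdmx_diag => i; rewrite mxE.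
by case: eqP; rewrite ?subr0 ?subrr.
Qed.

(** High fidelity with a pure state forces closeness in trace norm, as in the Fuchs-van de Graaf
    inequality, with a weight t in place of the square root of 1 - F. The contraction attaining the
    norm is cut into four blocks by Q and P = 1 - Q: the two diagonal blocks cost order 1 - F, the
    two mixed ones carry the weight. *)
Lemma trace_sqrtmx_sub_proj n (rho Q : 'M[C]_n) (F t : C) :
  psdmx rho -> \tr rho = 1 -> Q^t* = Q -> Q *m Q = Q -> \tr Q = 1 ->
  Q *m rho *m Q = F *: Q -> 0 < t ->
  'Re (\tr (sqrtmx ((rho - Q)^t* *m (rho - Q))))
    <= 2 * (1 - F) + t^-1 * (1 - F) + t.
Proof.
move=> pr tr1 aQ QQ trQ eF t0.
have [A pA <-] := trace_sqrtmx_polar (rho - Q).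
pose P : 'M[C]_n := 1%:M - Q.
have aP : P^t* = P by rewrite adjmxB adjmx1 aQ.
have PP : P *m P = P.
  by rewrite mulmxBr mulmx1 mulmxBl mul1mx QQ subrr subr0.
have pQ : psdmx Q by rewrite -QQ -{1}aQ; apply: psdmx_gram.
have pP : psdmx P by rewrite -PP -{1}aP; apply: psdmx_gram.
have PQ1 : P + Q = 1%:M by rewrite addrNK.
have FE : \tr (rho *m Q) = F.
  by rewrite -[RHS]mulr1 -trQ -mxtraceZ -eF [RHS]mxtrace_mulC mulmxA QQ mxtrace_mulC.
have FP : \tr (rho *m P) = 1 - F by rewrite mulmxBr mulmx1 linearB /= tr1 FE.
have F1 : 0 <= 1 - F by rewrite -FP; apply: psdmx_trM_ge0.
have F2 : F <= 1 by rewrite -subr_ge0.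
clearbody P.
have conjle B : B^t* = B -> B *m B = B ->
    \tr (rho *m (B *m A *m (B *m A)^t* )) <= \tr (rho *m B).
  move=> aB BB; apply: (psdmx_trM_le pr).
  have := psdmx_conj B pA; congr psdmx.
  by rewrite aB mulmxBr mulmxBl mulmx1 BB adjmxM aB !mulmxA.
(* The block Q A Q sees rho as F Q, so subtracting Q leaves -(1 - F) times the trace of Q A. *)
have eA : \tr (A *m (rho - Q)) = \tr (rho *m (P *m A *m P))
   + \tr (rho *m (P *m A *m Q)) + \tr (rho *m (Q *m A *m P))
   + (1 - F) * \tr (Q *m (- A *m 1%:M)).
  have -> : (1 - F) * \tr (Q *m (- A *m 1%:M))
      = \tr (rho *m (Q *m A *m Q)) - \tr (Q *m A).
    have -> : \tr (rho *m (Q *m A *m Q)) = \tr (F *: Q *m A).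
      by rewrite -eF mulmxA mxtrace_mulC !mulmxA.
    rewrite mulmx1 mulmxN linearN /= -scalemxAl mxtraceZ mulrBl mul1r mulrN.
    by rewrite opprK addrC.
  rewrite mulmxBr linearB /= addrA (mxtrace_mulC A Q); congr (_ - _).
  have dA : A = P *m A *m P + P *m A *m Q + Q *m A *m P + Q *m A *m Q.
    rewrite -mulmxDr PQ1 mulmx1 -addrA -mulmxDr PQ1 mulmx1 -mulmxDl PQ1.
    by rewrite mul1mx.
  by rewrite mxtrace_mulC {1}dA 3!mulmxDr 3!mxtraceD.
have cs1 := tr_CauchySchwarz (P *m A) P pr ltr01.
have cs2 := tr_CauchySchwarz (P *m A) Q pr (_ : 0 < t^-1).
have cs3 := tr_CauchySchwarz (Q *m A) P pr t0.
have cs4 := tr_CauchySchwarz (- A) (1%:M : 'M[C]_n) pQ ltr01.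
move: cs1 cs2 cs3 cs4; rewrite invr_gt0 => cs1 /(_ t0) cs2 cs3 cs4.
rewrite aP aQ PP QQ FP FE invr1 invrK in cs1 cs2 cs3.
have cP := conjle P aP PP; have cQ := conjle Q aQ QQ.
rewrite FP in cP; rewrite FE in cQ.
have cA : \tr (Q *m (- A *m (- A)^t* )) <= 1.
  rewrite -trQ -{2}[Q]mulmx1; apply: (psdmx_trM_le pQ).
  have -> : - A *m (- A)^t* = A *m A^t* by rewrite adjmxN mulNmx mulmxN opprK.
  exact: pA.
rewrite adjmx1 mulmx1 invr1 !mulmx1 trQ in cs4.
have {cs1} cs1 := le_trans cs1 (lerD (ler_wpM2l ler01 cP) (lexx _)).
have {cs4} cs4 := le_trans cs4 (lerD (ler_wpM2l ler01 cA) (lexx _)).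
have ti : 0 <= t^-1 by rewrite invr_ge0 ltW.
have {cs2} cs2 := le_trans cs2 (lerD (ler_wpM2l ti cP) (ler_wpM2l (ltW t0) F2)).
have {cs3} cs3 := le_trans cs3 (lerD (ler_wpM2l (ltW t0) (le_trans cQ F2)) (lexx _)).
have ReD (x y : C) : 'Re (x + y) = 'Re x + 'Re y by rewrite raddfD.
have eR : 'Re (\tr (A *m (rho - Q))) *+ 2 =
    'Re (\tr (rho *m (P *m A *m P))) *+ 2
    + 'Re (\tr (rho *m (P *m A *m Q))) *+ 2
    + 'Re (\tr (rho *m (Q *m A *m P))) *+ 2
    + (1 - F) * ('Re (\tr (Q *m (- A *m 1%:M))) *+ 2).
  rewrite eA !ReD !mulrnDl mulrnAr; congr (_ + _ *+ 2).
  by rewrite ReMl // ger0_real.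
set u := 'Re _ in eR *; set v := (_ + _ + t).
suff : u *+ 2 <= v *+ 2 by rewrite ler_pMn2r.
rewrite {}eR {}/v (mulmx1 (- A)).
have cs5 := ler_wpM2l F1 cs4.
apply: (le_trans (lerD (lerD (lerD cs1 cs2) cs3) cs5)).
by rewrite le_eqVlt; apply/orP; left; apply/eqP; ring.
Qed.

End TraceNorm.

(** * Operators on labelled systems and Kraus maps *)

Section Operators.
Variable R : realType.
Local Notation C := (complex R).
Implicit Types X Y Z : finType.

(* Rectangular operators X -> Y; on square ones [rent] is [ent], [mkrop] is
   [mkop] and [rtens] is [tens]. *)
Definition rop X Y : Type := 'M[C]_(#|Y|, #|X|).

Definition rent X Y (A : rop X Y) (y : Y) (x : X) : C :=
  A (enum_rank y) (enum_rank x).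

Definition mkrop X Y (f : Y -> X -> C) : rop X Y :=
  \matrix_(i, j) f (enum_val i) (enum_val j).

Definition rtens X X' Y Y' (A : rop X X') (B : rop Y Y') :
    rop (X ** Y) (X' ** Y') :=
  mkrop (fun p q => rent A p.1 q.1 * rent B p.2 q.2).

Lemma rent_mkrop X Y (f : Y -> X -> C) y x : rent (mkrop f) y x = f y x.
Proof. by rewrite /rent mxE !enum_rankK. Qed.

Lemma rop_ext X Y (A B : rop X Y) :
  (forall y x, rent A y x = rent B y x) -> A = B.
Proof.
by move=> e; apply/matrixP => i j; have := e (enum_val i) (enum_val j);
  rewrite /rent !enum_valK.
Qed.

Lemma big_enum_rank X (F : 'I_#|X| -> C) :
  \sum_i F i = \sum_(x : X) F (enum_rank x).
Proof. by rewrite (reindex enum_rank) //; apply: onW_bij; apply: enum_rank_bij. Qed.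

Lemma rentM X Y Z (A : rop Y Z) (B : rop X Y) z x :
  rent (A *m B) z x = \sum_(y : Y) rent A z y * rent B y x.
Proof. by rewrite /rent mxE big_enum_rank. Qed.

Lemma rent_adj X Y (A : rop X Y) x y : rent (A^t* ) x y = (rent A y x)^*.
Proof. by rewrite /rent !mxE. Qed.

Lemma rentD X Y (A B : rop X Y) y x : rent (A + B) y x = rent A y x + rent B y x.
Proof. by rewrite /rent mxE. Qed.

Lemma rentZ X Y a (A : rop X Y) y x : rent (a *: A) y x = a * rent A y x.
Proof. by rewrite /rent mxE. Qed.

Lemma rent_sum X Y (I : Type) (s : seq I) (P : pred I) (F : I -> rop X Y) y x :
  rent (\sum_(i <- s | P i) F i) y x = \sum_(i <- s | P i) rent (F i) y x.
Proof. by rewrite /rent summxE. Qed.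

Lemma rent1 X (x y : X) : rent (1%:M : rop X X) x y = (x == y)%:R.
Proof. by rewrite /rent mxE (inj_eq enum_rank_inj). Qed.

Lemma entE X (A : op R X) x y : ent A x y = rent (A : rop X X) x y.
Proof. by []. Qed.

Lemma tensE X Y (A : op R X) (B : op R Y) : tens A B = rtens A B.
Proof. by []. Qed.

Lemma relabelE X Y (f : Y -> X) (A : op R X) x y :
  rent (relabel f A : rop Y Y) x y = rent (A : rop X X) (f x) (f y).
Proof. exact: rent_mkrop. Qed.

Lemma rent_outer X (a b x y : X) :
  rent (outer a b : rop X X) x y = ((x == a) && (y == b))%:R :> C.
Proof. by rewrite /rent mxE !(inj_eq enum_rank_inj). Qed.

Lemma rent_rtens X X' Y Y' (A : rop X X') (B : rop Y Y') p q :
  rent (rtens A B) p q = rent A p.1 q.1 * rent B p.2 q.2.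
Proof. exact: rent_mkrop. Qed.

Lemma trE X (A : op R X) : \tr A = \sum_x rent (A : rop X X) x x.
Proof. exact: big_enum_rank. Qed.

Lemma sum_prod X Y (F : X ** Y -> C) : \sum_p F p = \sum_x \sum_y F (x, y).
Proof. by rewrite pair_bigA; apply: eq_bigr => -[]. Qed.

Lemma rtensM X X' X'' Y Y' Y'' (A : rop X' X'') (A' : rop X X')
    (B : rop Y' Y'') (B' : rop Y Y') :
  rtens A B *m rtens A' B' = rtens (A *m A') (B *m B').
Proof.
apply: rop_ext => p q; rewrite rentM rent_rtens !rentM sum_prod big_distrlr.
apply: eq_bigr => x _; apply: eq_bigr => y _.
by rewrite !rent_rtens /= mulrACA.
Qed.

Lemma rtens_adj X X' Y Y' (A : rop X X') (B : rop Y Y') :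
  (rtens A B)^t* = rtens (A^t* ) (B^t* ).
Proof.
apply: rop_ext => p q.
by rewrite rent_adj !rent_rtens rmorphM /= !rent_adj.
Qed.

Lemma tr_tens X Y (A : op R X) (B : op R Y) :
  \tr (tens A B) = \tr A * \tr B.
Proof.
rewrite !trE sum_prod big_distrlr.
by apply: eq_bigr => x _; apply: eq_bigr => y _; rewrite rent_rtens.
Qed.

Lemma psd_tens X Y (A : op R X) (B : op R Y) :
  psd A -> psd B -> psd (tens A B).
Proof.
move=> /psdmx_factor[a ->] /psdmx_factor[b ->].
rewrite tensE -(rtensM (a^t* : rop X X) a (b^t* : rop Y Y) b) -rtens_adj.
exact: psdmx_gram.
Qed.

Lemma outer_decomp X (A : op R X) :
  A = \sum_x \sum_y ent A x y *: outer x y.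
Proof.
apply: rop_ext => x y; rewrite rent_sum (bigD1 x) //= [X in _ + X]big1 ?addr0.
  rewrite rent_sum (bigD1 y) //= [X in _ + X]big1 ?addr0.
    by rewrite rentZ rent_outer !eqxx mulr1.
  by move=> z zy; rewrite rentZ rent_outer eqxx /= eq_sym (negPf zy) mulr0.
move=> z zx; rewrite rent_sum big1 // => w _.
by rewrite rentZ rent_outer eq_sym (negPf zx) mulr0.
Qed.

Section LinearMaps.
Variables (m n : nat) (E : 'M[C]_m -> 'M[C]_n).
Hypothesis linE : linear E.

Lemma linmap0 : E 0 = 0.
Proof.
by have := linE (-1) 0 0; rewrite scaler0 addr0 scaleN1r addNr => ->.
Qed.

Lemma linmapD A B : E (A + B) = E A + E B.
Proof. by have := linE 1 A B; rewrite !scale1r. Qed.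

Lemma linmapZ a A : E (a *: A) = a *: E A.
Proof. by have := linE a A 0; rewrite linmap0 !addr0. Qed.

Lemma linmap_sum (I : finType) (F : I -> 'M[C]_m) :
  E (\sum_i F i) = \sum_i E (F i).
Proof. by apply: (big_morph E linmapD linmap0). Qed.
End LinearMaps.

Lemma linmap_outer X n (E : op R X -> 'M[C]_n) (A : op R X) : linear E ->
  E A = \sum_x \sum_y ent A x y *: E (outer x y).
Proof.
move=> lE; rewrite {1}[A]outer_decomp linmap_sum //.
apply: eq_bigr => x _; rewrite linmap_sum //.
by apply: eq_bigr => y _; rewrite linmapZ.
Qed.

Lemma linmap_ext X n (E F : op R X -> 'M[C]_n) : linear E -> linear F ->
  (forall x y, E (outer x y) = F (outer x y)) -> E =1 F.
Proof.
move=> lE lF e A; rewrite (linmap_outer _ lE) (linmap_outer _ lF).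
by apply: eq_bigr => x _; apply: eq_bigr => y _; rewrite e.
Qed.

Lemma tens_linear_l X Y (B : op R Y) : linear (fun A : op R X => tens A B).
Proof.
move=> a A A'; apply: rop_ext => p q.
by rewrite rentD rentZ !rent_rtens rentD rentZ mulrDl mulrA.
Qed.

Lemma tens_linear_r X Y (A : op R X) : linear (fun B : op R Y => tens A B).
Proof.
move=> a B B'; apply: rop_ext => p q.
by rewrite rentD rentZ !rent_rtens rentD rentZ mulrDr mulrCA.
Qed.

Lemma relabel_linear X Y (f : Y -> X) : linear (relabel f : superop R X Y).
Proof.
by move=> a A A'; apply: rop_ext => p q; rewrite rentD rentZ !relabelE rentD rentZ.
Qed.

Lemma tens_map_linear X X' Y Y' (E : superop R X X') (F : superop R Y Y') :
  linear (tens_map E F).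
Proof.
move=> a A A'; rewrite /tens_map.
do 4 (rewrite scaler_sumr -big_split /=; apply: eq_bigr => ? _).
by rewrite entE rentD rentZ scalerDl scalerA.
Qed.

Lemma tens_map_outer X X' Y Y' (E : superop R X X') (F : superop R Y Y')
    x x' y y' :
  tens_map E F (outer (x, y) (x', y')) = tens (E (outer x x')) (F (outer y y')).
Proof.
rewrite /tens_map.
rewrite (bigD1 x) //= [X in _ + X]big1 ?addr0; last first.
  move=> z zx; do 3 (rewrite big1 // => ? _).
  by rewrite entE rent_outer xpair_eqE (negPf zx) scale0r.
rewrite (bigD1 x') //= [X in _ + X]big1 ?addr0; last first.
  move=> z zx; do 2 (rewrite big1 // => ? _).
  by rewrite entE rent_outer !xpair_eqE (negPf zx) /= andbF scale0r.
rewrite (bigD1 y) //= [X in _ + X]big1 ?addr0; last first.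
  move=> z zx; do 1 (rewrite big1 // => ? _).
  by rewrite entE rent_outer !xpair_eqE (negPf zx) /= andbF scale0r.
rewrite (bigD1 y') //= [X in _ + X]big1 ?addr0; last first.
  move=> z zx.
  by rewrite entE rent_outer !xpair_eqE (negPf zx) /= !andbF scale0r.
by rewrite entE rent_outer !eqxx scale1r.
Qed.

Lemma tens_outer X Y (x x' : X) (y y' : Y) :
  tens (outer x x') (outer y y') = outer (x, y) (x', y') :> op R (X ** Y).
Proof.
apply: rop_ext => -[a b] [c d]; rewrite rent_rtens !rent_outer /= !xpair_eqE.
by rewrite -natrM mulnb andbACA.
Qed.

Lemma tens_map_tens X X' Y Y' (E : superop R X X') (F : superop R Y Y') A B :
  linear E -> linear F -> tens_map E F (tens A B) = tens (E A) (F B).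
Proof.
move=> lE lF.
have lT := tens_map_linear E F.
have l1 : linear (fun A => tens_map E F (tens A B)).
  by move=> a A1 A2; rewrite tens_linear_l lT.
have l2 : linear (fun A => tens (E A) (F B)).
  by move=> a A1 A2; rewrite lE tens_linear_l.
apply: (linmap_ext l1 l2) => x x'.
have l3 : linear (fun B => tens_map E F (tens (outer x x') B)).
  by move=> a A1 A2; rewrite tens_linear_r lT.
have l4 : linear (fun B => tens (E (outer x x')) (F B)).
  by move=> a A1 A2; rewrite lF tens_linear_r.
apply: (linmap_ext l3 l4) => y y'.
by rewrite tens_outer tens_map_outer.
Qed.

Lemma op_tens_ext X Y n (E F : op R (X ** Y) -> 'M[C]_n) :
  linear E -> linear F ->
  (forall A B, E (tens A B) = F (tens A B)) -> E =1 F.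
Proof.
move=> lE lF e; apply: linmap_ext => // -[x y] [x' y'].
by rewrite -tens_outer e.
Qed.

(** The sum over i covers an instrument on the first factor together with channels depending on its
    outcome; a one-point index gives a product of two channels. *)
Lemma tr_tens_map X X' Y Y' (I : finType) (E : I -> superop R X X')
    (F : I -> superop R Y Y') (A : op R (X ** Y)) :
  (forall A, \sum_i \tr (E i A) = \tr A) -> (forall i A, \tr (F i A) = \tr A) ->
  \sum_i \tr (tens_map (E i) (F i) A) = \tr A.
Proof.
move=> tE tF; rewrite [in RHS](outer_decomp A) /tens_map.
have trs (J : finType) n (G : J -> 'M[C]_n) : \tr (\sum_j G j) = \sum_j \tr (G j).
  exact: raddf_sum.
rewrite trs.
under [RHS]eq_bigr do rewrite trs.
under [RHS]eq_bigr do under eq_bigr do rewrite mxtraceZ.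
rewrite sum_prod.
under [RHS]eq_bigr do under eq_bigr do rewrite sum_prod.
under [RHS]eq_bigr do rewrite exchange_big.
under [LHS]eq_bigr do rewrite trs; rewrite [LHS]exchange_big; apply: eq_bigr => x _.
under [LHS]eq_bigr do rewrite trs; rewrite [LHS]exchange_big; apply: eq_bigr => x' _.
under [LHS]eq_bigr do rewrite trs; rewrite [LHS]exchange_big; apply: eq_bigr => y _.
under [LHS]eq_bigr do rewrite trs; rewrite [LHS]exchange_big; apply: eq_bigr => y' _.
under [LHS]eq_bigr do rewrite mxtraceZ tr_tens tF.
by rewrite -big_distrr -big_distrl /= tE -tr_tens tens_outer.
Qed.

(** Stability under composition, sums and products is immediate for Kraus operators; [kraus_cp] and
    [cp_kraus] make this equivalent to [cp]. *)
Definition kraus X Y (E : superop R X Y) : Prop :=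
  exists (J : finType) (K : J -> rop X Y),
    forall A, E A = \sum_j K j *m A *m (K j)^t*.

Lemma kraus_linear X Y (E : superop R X Y) : kraus E -> linear E.
Proof.
move=> [J [K e]] a A B; rewrite !e scaler_sumr -big_split.
apply: eq_bigr => j _ /=.
by rewrite mulmxDr mulmxDl -scalemxAr -scalemxAl.
Qed.

Lemma kraus_psd X Y (E : superop R X Y) A : kraus E -> psd A -> psd (E A).
Proof.
move=> [J [K ->]] pA; apply: psdmx_sum => j.
by have := psdmx_conj ((K j)^t* ) pA; rewrite trmxCK.
Qed.

Lemma kraus_id X : kraus (fun A : op R X => A).
Proof.
exists unit, (fun _ => 1%:M) => A.
by rewrite (bigD1 tt) //= big1 ?addr0 ?adjmx1 ?mulmx1 ?mul1mx // => -[].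
Qed.

Lemma kraus_comp X Y Z (E : superop R X Y) (F : superop R Y Z) :
  kraus E -> kraus F -> kraus (fun A => F (E A)).
Proof.
move=> [J [K eE]] [J' [K' eF]].
exists (J' ** J), (fun p => K' p.1 *m K p.2) => A.
rewrite eF -(pair_bigA _ (fun i j => (K' i *m K j) *m A *m (K' i *m K j)^t* )).
apply: eq_bigr => i _ /=; rewrite eE mulmx_sumr mulmx_suml.
by apply: eq_bigr => j _; rewrite adjmxM !mulmxA.
Qed.

Lemma kraus_add X Y (E F : superop R X Y) :
  kraus E -> kraus F -> kraus (fun A => E A + F A).
Proof.
move=> [J [K eE]] [J' [K' eF]].
exists (J + J')%type, (fun s => match s with inl j => K j | inr j => K' j end) => A.
by rewrite eE eF big_sumType.
Qed.

Lemma kraus_relabel X Y (f : Y -> X) : injective f ->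
  kraus (relabel f : superop R X Y).
Proof.
move=> fi; exists unit, (fun _ => mkrop (fun y x => (x == f y)%:R)) => A.
rewrite (bigD1 tt) //= big1 ?addr0; last by case.
apply: rop_ext => p q; rewrite relabelE rentM (bigD1 (f q)) //= big1 ?addr0.
  rewrite rentM (bigD1 (f p)) //= big1 ?addr0.
    by rewrite rent_adj !rent_mkrop !eqxx conjC1 mul1r mulr1.
  by move=> z zp; rewrite rent_mkrop (negPf zp) mul0r.
by move=> z zq; rewrite rent_adj rent_mkrop (negPf zq) conjC0 mulr0.
Qed.

Lemma kraus_tens_map X X' Y Y' (E : superop R X X') (F : superop R Y Y') :
  kraus E -> kraus F -> kraus (tens_map E F).
Proof.
move=> kE kF; have lE := kraus_linear kE; have lF := kraus_linear kF.
case: kE => J [K eE]; case: kF => J' [K' eF].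
exists (J ** J'), (fun p => rtens (K p.1) (K' p.2)).
apply: op_tens_ext; first exact: tens_map_linear.
  move=> a A B; rewrite scaler_sumr -big_split.
  apply: eq_bigr => j _ /=.
  by rewrite mulmxDr mulmxDl -scalemxAr -scalemxAl.
move=> A B; rewrite tens_map_tens // eE eF.
rewrite (linmap_sum (tens_linear_l _)).
under eq_bigr do rewrite (linmap_sum (tens_linear_r _)).
rewrite pair_bigA; apply: eq_bigr => p _ /=.
by rewrite rtens_adj !tensE !rtensM.
Qed.

Lemma kraus_cp X Y (E : superop R X Y) : kraus E -> cp E.
Proof.
move=> kE; split; first exact: kraus_linear.
move=> Z A pA; apply: kraus_psd => //; apply: kraus_tens_map => //.
exact: kraus_id.
Qed.

(* The Kraus operators are read off a factorisation of the Choi matrix. *)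
Lemma cp_kraus X Y (E : superop R X Y) : cp E -> kraus E.
Proof.
move=> [lE /(_ X)].
(* The unnormalised maximally entangled vector; the Choi matrix is the image of v v^*. Written as
   b^* b it has the conjugate on its left index, hence the conjugation in [K]. *)
pose v : 'M[C]_(#|X ** X|, 1) := \col_i ((enum_val i).1 == (enum_val i).2)%:R.
have pB : psd (v *m v^t* : op R (X ** X)).
  by have := psdmx_gram (v^t* ); rewrite trmxCK.
move=> /(_ _ pB) /psdmx_factor[b eb].
pose K (j : 'I_#|X ** Y|) : rop X Y :=
  mkrop (fun y x => (b j (enum_rank ((x, y) : X ** Y)))^* ).
exists 'I_#|X ** Y|, K; apply: linmap_ext => //.
  move=> a A B; rewrite scaler_sumr -big_split.
  apply: eq_bigr => j _ /=.
  by rewrite mulmxDr mulmxDl -scalemxAr -scalemxAl.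
move=> x x'; apply: rop_ext => y y'.
have -> : rent (E (outer x x') : rop Y Y) y y' =
  rent (tens_map (fun s : op R X => s) E (v *m v^t* : op R (X ** X))
    : rop (X ** Y) (X ** Y)) (x, y) (x', y').
  have entv z w z' w' : rent (v *m v^t* : rop (X ** X) (X ** X)) (z, w) (z', w')
      = ((z == w) && (z' == w'))%:R.
    rewrite /rent mxE big_ord1 !mxE !enum_rankK /= rmorph_nat -natrM mulnb.
    by rewrite eq_sym.
  rewrite rent_sum (bigD1 x) //= [X in _ + X]big1 ?addr0; last first.
    move=> z zx; rewrite rent_sum big1 // => z' _; rewrite rent_sum big1 // => w _.
    rewrite rent_sum big1 // => w' _; rewrite rentZ rent_rtens rent_outer /=.
    by rewrite eq_sym (negPf zx) mul0r mulr0.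
  rewrite rent_sum (bigD1 x') //= [X in _ + X]big1 ?addr0; last first.
    move=> z' zx; rewrite rent_sum big1 // => w _.
    rewrite rent_sum big1 // => w' _; rewrite rentZ rent_rtens rent_outer /=.
    by rewrite [x' == z']eq_sym (negPf zx) andbF mul0r mulr0.
  rewrite rent_sum (bigD1 x) //= [X in _ + X]big1 ?addr0; last first.
    move=> w wx; rewrite rent_sum big1 // => w' _; rewrite rentZ entE entv.
    by rewrite eq_sym (negPf wx) mul0r.
  rewrite rent_sum (bigD1 x') //= [X in _ + X]big1 ?addr0; last first.
    move=> w wx; rewrite rentZ entE entv [x' == w]eq_sym (negPf wx) andbF.
    by rewrite mul0r.
  by rewrite rentZ entE entv rent_rtens rent_outer !eqxx !mul1r.
rewrite eb {1}/rent mxE rent_sum; apply: eq_bigr => j _.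
rewrite rentM (bigD1 x') //= big1 ?addr0; last first.
  move=> z zx; rewrite rentM big1 ?mul0r // => w _.
  by rewrite rent_outer (negPf zx) andbF mulr0.
rewrite rentM (bigD1 x) //= big1 ?addr0; last first.
  by move=> z zx; rewrite rent_outer (negPf zx) mulr0.
by rewrite rent_adj !rent_mkrop rent_outer !eqxx mulr1 conjCK !mxE.
Qed.

End Operators.

(** * Effects *)

Section Effects.
Variable R : realType.
Local Notation C := (complex R).
Implicit Types X Y Z : finType.

Definition linfunctional X (f : op R X -> C) : Prop :=
  forall a A B, f (a *: A + B) = a * f A + f B.

(** A test in the Heisenberg picture, kept as a functional so that a test performed after a protocol
    is again an effect, with no adjoint map to construct. *)
Definition effect X (f : op R X -> C) : Prop :=
  linfunctional f /\ (forall A, psd A -> 0 <= f A <= \tr A).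

Lemma linfunctional_tr X Y (E : superop R X Y) (T : op R Y) :
  linear E -> linfunctional (fun A => \tr (T *m E A)).
Proof.
by move=> lE a A B; rewrite lE mulmxDr -scalemxAr mxtraceD mxtraceZ.
Qed.

Lemma linfunctionalE X (f : op R X -> C) A : linfunctional f ->
  f A = \sum_x \sum_y ent A x y * f (outer x y).
Proof.
move=> lf; have l : linear (fun A => (f A)%:M : 'M[C]_1).
  by move=> a B D; rewrite lf raddfD /= -scale_scalar_mx.
have := linmap_outer A l => /matrixP/(_ 0 0).
rewrite mxE eqxx mulr1n => ->; rewrite summxE; apply: eq_bigr => x _.
by rewrite summxE; apply: eq_bigr => y _; rewrite !mxE eqxx mulr1n.
Qed.

Lemma linfunctional_sum X (f : op R X -> C) (I : finType) (F : I -> op R X) :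
  linfunctional f -> f (\sum_i F i) = \sum_i f (F i).
Proof.
move=> lf; apply: (big_morph f).
  by move=> A B; have := lf 1 A B; rewrite scale1r mul1r.
by have := lf (-1) 0 0; rewrite scaler0 addr0 mulN1r addNr.
Qed.

Lemma linfunctionalZ X (f : op R X -> C) a A : linfunctional f ->
  f (a *: A) = a * f A.
Proof.
move=> lf; have f0 : f 0 = 0.
  by have := lf (-1) 0 0; rewrite scaler0 addr0 mulN1r addNr.
by have := lf a A 0; rewrite f0 !addr0.
Qed.

Lemma linfunctional_matrix X (f : op R X -> C) : linfunctional f ->
  exists T : op R X, forall A, f A = \tr (T *m A).
Proof.
move=> lf; exists (mkop (fun x y => f (outer y x))) => A.
rewrite (linfunctionalE _ lf) exchange_big trE; apply: eq_bigr => y _.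
rewrite rentM; apply: eq_bigr => x _.
by rewrite mulrC -/(mkrop _) rent_mkrop.
Qed.

Lemma effect_matrix X (f : op R X -> C) : effect f ->
  exists T : op R X, [/\ psd T, psd (1%:M - T) & forall A, f A = \tr (T *m A)].
Proof.
case=> lf bf; have [T eT] := linfunctional_matrix lf.
have form (v : 'cV[C]_#|X|) (A : op R X) :
    (v^t* *m A *m v) 0 0 = \tr (A *m (v *m v^t* )).
  by rewrite mulmxA mxtrace_mulC mulmxA /mxtrace big_ord1.
have pv (v : 'cV[C]_#|X|) : psd (v *m v^t* : op R X).
  by have := psdmx_gram (v^t* ); rewrite trmxCK.
exists T; split=> // v; rewrite form ?mulmxBl ?mul1mx ?linearB /=.
  by rewrite -eT; case/andP: (bf _ (pv v)).
by rewrite -eT subr_ge0; case/andP: (bf _ (pv v)).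
Qed.

Lemma trnormE X (A : op R X) :
  (trnorm A)%:C%C = \tr (sqrtmx (A^t* *m A)).
Proof.
apply: RRe_real; have [V [s [_ s0 _ ->]]] := trace_sqrtmx_spectral A.
by apply: sum_real => i _; rewrite ger0_real.
Qed.

(** The matrix of an effect is a contraction, since T^2 <= T <= 1; duality is applied to -T. *)
Lemma effect_trnorm X (f : op R X -> C) A : effect f ->
  - (trnorm A)%:C%C <= 'Re (f A).
Proof.
move=> /effect_matrix [T [pT p1 ->]].
have := @contraction_tr_le _ _ A (- T).
rewrite adjmxN mulNmx mulmxN opprK (psdmx_adj pT) => h.
have := h (psdmx_le_trans (effect_sqr_le pT p1) p1).
by rewrite trnormE mulNmx linearN /= raddfN lerNl.
Qed.

(* Scalar form of || sum_a u_a ||^2 <= (sum_a p_a) (sum_a q_a) when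
   || u_a ||^2 = p_a q_a. *)
Lemma sum_family_norm (I : finType) Y (u : I -> Y -> C) (p q : I -> C) :
  (forall a, 0 <= p a) -> (forall a, 0 <= q a) ->
  (forall a, \sum_y `|u a y| ^+ 2 = p a * q a) ->
  \sum_y `|\sum_a u a y| ^+ 2 <= (\sum_a p a) * (\sum_a q a).
Proof.
move=> p0 q0 e.
have pair a b : \sum_y (u a y * (u b y)^* + u b y * (u a y)^* )
    <= p a * q b + p b * q a.
  have gen (t : C) : 0 < t -> \sum_y (u a y * (u b y)^* + u b y * (u a y)^* )
      <= t * (p a * q a) + t^-1 * (p b * q b).
    move=> t0; rewrite -!e !mulr_sumr -big_split /=; apply: ler_sum => y _.
    rewrite -subr_ge0.
    have tr : t^* = t by apply: conj_Creal; rewrite gtr0_real.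
    have -> : t * `|u a y| ^+ 2 + t^-1 * `|u b y| ^+ 2
        - (u a y * (u b y)^* + u b y * (u a y)^* )
        = t^-1 * `|t * u a y - u b y| ^+ 2.
      rewrite !normCK rmorphB rmorphM /= tr; field; exact: lt0r_neq0.
    by rewrite mulr_ge0 ?exprn_ge0 ?invr_ge0 // ltW.
  (* When [q a] or [q b] vanishes, the weight used below is not positive, but the corresponding
     vector is then zero. *)
  have zero c : p c * q c = 0 -> forall y, u c y = 0.
    move=> c0 y; have := e c; rewrite c0 => /eqP.
    have ge0 z : true -> 0 <= `|u c z| ^+ 2 by rewrite exprn_ge0.
    rewrite (psumr_eq0 _ ge0).
    by move/allP/(_ y); rewrite mem_index_enum expf_eq0 /= normr_eq0 => /(_ isT)/eqP.
  have rhs0 : 0 <= p a * q b + p b * q a by rewrite addr_ge0 ?mulr_ge0.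
  have [qa|qa] := eqVneq (q a) 0.
    rewrite big1 // => y _.
    by rewrite (zero a) ?qa ?mulr0 // mul0r conjC0 mulr0 addr0.
  have [qb|qb] := eqVneq (q b) 0.
    rewrite big1 // => y _.
    by rewrite (zero b) ?qb ?mulr0 // mul0r conjC0 mulr0 addr0.
  have ga : 0 < q a by rewrite lt0r qa q0.
  have gb : 0 < q b by rewrite lt0r qb q0.
  (* This weight turns the two terms into exactly [p a * q b] and [p b * q a]. *)
  apply: (le_trans (gen (q b / q a) _)); first by rewrite divr_gt0.
  rewrite le_eqVlt; apply/orP; left; apply/eqP; field.
  by rewrite qa qb.
rewrite -(ler_pMn2r (isT : (0 < 2)%N)) mulr2n.
have -> : \sum_y `|\sum_a u a y| ^+ 2
   = \sum_a \sum_b \sum_y u a y * (u b y)^*.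
  under [RHS]eq_bigr do rewrite exchange_big.
  rewrite [RHS]exchange_big; apply: eq_bigr => y _.
  by rewrite normCK rmorph_sum big_distrlr.
rewrite {2}exchange_big -big_split /=.
under eq_bigr do rewrite -big_split.
rewrite mulr2n [X in _ <= _ + X]mulrC !big_distrlr /= -big_split /=.
apply: ler_sum => a _; rewrite -big_split /=; apply: ler_sum => b _.
by rewrite -big_split [q a * p b]mulrC /=; apply: pair.
Qed.

End Effects.

(** * Private states *)

Section PrivateStates.
Variable R : realType.
Local Notation C := (complex R).
Implicit Types X Y Z : finType.

Lemma sum_delta X (F : X -> C) x : \sum_y (x == y)%:R * F y = F x.
Proof.
rewrite (bigD1 x) //= big1 ?addr0 ?eqxx ?mul1r // => y yx.
by rewrite eq_sym (negPf yx) mul0r.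
Qed.

Lemma sum_deltar X (F : X -> C) x : \sum_y F y * (x == y)%:R = F x.
Proof. by under eq_bigr do rewrite mulrC; exact: sum_delta. Qed.

Definition diagop X (g : X -> C) : op R X := mkrop (fun x y => (x == y)%:R * g x).

Lemma rent_diagopM X Y (g : Y -> C) (A : rop R X Y) y x :
  rent ((diagop g : rop R Y Y) *m A) y x = g y * rent A y x.
Proof.
rewrite rentM.
under eq_bigr do rewrite rent_mkrop -mulrA.
exact: sum_delta.
Qed.

Lemma rent_Mdiagop X Y (g : X -> C) (A : rop R X Y) y x :
  rent (A *m (diagop g : rop R X X)) y x = rent A y x * g x.
Proof.
rewrite rentM.
under eq_bigr do rewrite rent_mkrop eq_sym mulrCA.
exact: sum_delta.
Qed.

Lemma rent_twist d (S : finType) (U : 'I_d -> 'I_d -> op R S) p q :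
  rent (twist U : rop R _ _) p q
    = (p.1 == q.1)%:R * rent (U p.1.1 p.1.2 : rop R S S) p.2 q.2.
Proof.
case: p q => [[a b] s] [[c e] s'] /=; rewrite rent_sum.
under eq_bigr do rewrite rent_sum; rewrite pair_bigA /=.
under eq_bigr => i _.
  rewrite rent_rtens rent_outer /= !xpair_eqE -mulnb natrM.
  have -> : ((a == i.1) && (b == i.2)) = (((a, b) : _ * _) == i).
    by case: i => i j; rewrite xpair_eqE.
  rewrite -mulrA; over.
rewrite sum_delta /= !xpair_eqE.
by rewrite [c == a]eq_sym [e == b]eq_sym.
Qed.

Lemma rent_maxent d p q : rent (maxent d : op R _) p q
  = d%:R^-1 * ((p.1 == p.2)%:R * (q.1 == q.2)%:R) :> C.
Proof.
case: p q => [a b] [c e] /=; rewrite rent_sum.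
under eq_bigr do rewrite rent_sum.
have [<-|ab] := eqVneq a b; last first.
  rewrite mul0r mulr0 big1 // => i _; rewrite big1 // => j _.
  rewrite rentZ rent_outer !xpair_eqE.
  have [ai|] := eqVneq a i; last by rewrite mulr0.
  by rewrite -ai [b == a]eq_sym (negPf ab) /= mulr0.
have [<-|ce] := eqVneq c e; last first.
  rewrite !mulr0 big1 // => i _; rewrite big1 // => j _.
  rewrite rentZ rent_outer !xpair_eqE.
  have [ai|] := eqVneq c j; last by rewrite andbF mulr0.
  by rewrite -ai [e == c]eq_sym (negPf ce) !andbF /= mulr0.
rewrite !mulr1 (bigD1 a) //= [X in _ + X]big1 ?addr0; last first.
  move=> i ia; rewrite big1 // => j _.
  by rewrite rentZ rent_outer !xpair_eqE eq_sym (negPf ia) mulr0.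
rewrite (bigD1 c) //= big1 ?addr0; last first.
  move=> i ia.
  by rewrite rentZ rent_outer !xpair_eqE [c == i]eq_sym (negPf ia) !andbF mulr0.
by rewrite rentZ rent_outer !eqxx mulr1.
Qed.

Lemma tr_gram X Y (A : rop R X Y) :
  \tr (A^t* *m A) = \sum_x \sum_y `|rent A y x| ^+ 2.
Proof.
rewrite trE; apply: eq_bigr => x _; rewrite rentM; apply: eq_bigr => y _.
by rewrite rent_adj normCK mulrC.
Qed.

Lemma sum_unitary_norm X (v : X -> C) (U : op R X) : U \is unitarymx ->
  \sum_s `|\sum_t v t * rent (U : rop R X X) t s| ^+ 2 = \sum_t `|v t| ^+ 2.
Proof.
move/unitarymxP => uU.
under eq_bigr do rewrite normCK rmorph_sum big_distrlr /=.
rewrite exchange_big; apply: eq_bigr => t _ /=.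
rewrite exchange_big /=.
transitivity (\sum_t' v t * (v t')^* * rent (1%:M : rop R X X) t t' : C).
  apply: eq_bigr => t' _; rewrite -uU rentM mulr_sumr; apply: eq_bigr => s _.
  by rewrite rent_adj rmorphM mulrACA.
under eq_bigr do rewrite rent1; by rewrite sum_deltar normCK.
Qed.

Section Test.
Variables (d : nat) (SA SB : finType).
Local Notation S := (SA ** SB).
Local Notation HAB := ((key d ** SA) ** (key d ** SB)).

(* The isometry (up to sqrt d) sum_a |aa> (x) U_a, whose range carries the
   private state. *)
Definition twist_iso (U : 'I_d -> op R S) : rop R S HAB :=
  mkrop (fun p s => (p.1.1 == p.2.1)%:R * rent (U p.1.1 : rop R S S) (p.1.2, p.2.2) s).

(** The maximally entangled state reaches only equal keys, so of all [U i j] only [U i i] act, and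
    the private state is the image of sigma under a multiple of one isometry. *)
Lemma private_stateE (gamma : op R HAB) : private_state gamma ->
  exists (sigma : op R S) (U : 'I_d -> op R S),
    [/\ density sigma, forall i, U i \is unitarymx &
      gamma = d%:R^-1 *: (twist_iso U *m sigma *m (twist_iso U)^t* )].
Proof.
case=> sigma [U [ds uU ->]]; exists sigma, (fun i => U i i); split=> //.
pose J : rop R S ((key d ** key d) ** S) :=
  mkrop (fun p s => (p.1.1 == p.1.2)%:R * (p.2 == s)%:R).
have -> : tens (maxent d) sigma = d%:R^-1 *: (J *m (sigma : rop R S S) *m J^t* ).
  apply: rop_ext => p q; rewrite rentZ rent_rtens rent_maxent rentM.
  under [in RHS]eq_bigr do
    rewrite rent_adj rent_mkrop rmorphM /= !conjC_nat mulrCA [X in _ * X]mulrC.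
  under [in RHS]eq_bigr do rewrite mulrCA; rewrite sum_delta rentM.
  under [in RHS]eq_bigr do rewrite rent_mkrop -mulrA.
  rewrite -mulr_sumr sum_delta -!mulrA; congr (_ * _).
  by rewrite mulrCA.
pose A := twist U *m J.
have -> : twist U *m (d%:R^-1 *: (J *m (sigma : rop R S S) *m J^t* )) *m (twist U)^t*
    = d%:R^-1 *: (A *m (sigma : rop R S S) *m A^t* ).
  by rewrite -scalemxAr -scalemxAl /A adjmxM !mulmxA.
rewrite (linmapZ (relabel_linear _)); congr (_ *: _).
apply: rop_ext => p q; rewrite relabelE !rentM.
have eA p' s : rent A (regroup p') s = rent (twist_iso (fun i => U i i)) p' s.
  rewrite rentM rent_mkrop.
  under eq_bigr do rewrite rent_twist rent_mkrop -mulrA.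
  rewrite sum_prod exchange_big /=.
  under eq_bigr do rewrite sum_delta /= mulrCA.
  rewrite -mulr_sumr; under eq_bigr do rewrite eq_sym.
  rewrite sum_deltar; case: eqP => [->|]; rewrite ?mul0r //.
apply: eq_bigr => s _; rewrite !rentM !rent_adj eA; congr (_ * _).
by apply: eq_bigr => s' _; rewrite eA.
Qed.

Lemma twist_iso_gram U : (forall i, U i \is unitarymx) ->
  (twist_iso U)^t* *m twist_iso U = d%:R%:M :> op R S.
Proof.
move=> uU; apply: rop_ext => s s'.
rewrite rentM sum_prod.
transitivity (\sum_(a : 'I_d) \sum_(t : S) (rent (U a) t s)^* * rent (U a) t s' : C).
  rewrite sum_prod; apply: eq_bigr => a _.
  under eq_bigr do rewrite sum_prod.
  rewrite sum_prod; apply: eq_bigr => x _.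
  rewrite exchange_big /=; apply: eq_bigr => y _.
  under eq_bigr do rewrite rent_adj !rent_mkrop /= rmorphM /= conjC_nat -mulrA.
  by rewrite sum_delta eqxx mul1r.
have uu a : (U a)^t* *m U a = 1%:M by apply: mulmx1C; apply/unitarymxP.
under eq_bigr => a _.
  have -> : \sum_(t : S) (rent (U a) t s)^* * rent (U a) t s'
      = rent ((U a)^t* *m U a : op R S) s s'.
    by rewrite rentM; apply: eq_bigr => t _; rewrite rent_adj.
  rewrite uu rent1; over.
rewrite sumr_const card_ord /rent mxE (inj_eq enum_rank_inj).
by case: eqP => _; rewrite ?mulr1n ?mulr0n ?mul0rn.
Qed.

Lemma private_gram_le1 U : (0 < d)%N -> (forall i, U i \is unitarymx) ->
  psd (1%:M - d%:R^-1 *: (twist_iso U *m (twist_iso U)^t* ) : op R HAB).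
Proof.
move=> d0 uU; set Q := _ *: _.
have nd : d%:R != 0 :> C by rewrite pnatr_eq0 -lt0n.
have aQ : Q^t* = Q by rewrite adjmxZ adjmxM trmxCK rmorphV ?unitfE //= conjC_nat.
have QQ : Q *m Q = Q.
  rewrite /Q -scalemxAr -scalemxAl scalerA mulmxA -(mulmxA (twist_iso U)).
  rewrite (twist_iso_gram uU) mul_mx_scalar -scalemxAl scalerA.
  by rewrite mulfVK.
have := psdmx_gram (1%:M - Q); congr psdmx.
rewrite adjmxB adjmx1 aQ mulmxBr mulmx1 mulmxBl mul1mx QQ.
by rewrite subrr subr0.
Qed.

(** The effect is the projection V V^* / d. On a product of two vectors, the part of V^* at key
    value a has norm |alpha_a| |beta_a| because U_a is unitary; by Cauchy-Schwarz over a the sum is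
    at most the product of the norms, and 1/d is left over from the normalisation. *)
Lemma private_test (gamma : op R HAB) : (0 < d)%N -> private_state gamma ->
  exists T : op R HAB, [/\ psd T, psd (1%:M - T), \tr (T *m gamma) = 1 &
    forall alpha beta, psd alpha -> psd beta ->
      \tr (T *m tens alpha beta) <= d%:R^-1 * (\tr alpha * \tr beta)].
Proof.
move=> d0 /private_stateE[sigma [U [[_ tr1] uU ->]]].
have nd : d%:R != 0 :> C by rewrite pnatr_eq0 -lt0n.
have d0' : 0 <= d%:R^-1 :> C by rewrite invr_ge0 ler0n.
exists (d%:R^-1 *: (twist_iso U *m (twist_iso U)^t* )); split.
- apply: psdmxZ => //; have := psdmx_gram ((twist_iso U)^t* ).
  by rewrite trmxCK.
- exact: private_gram_le1.
- rewrite -scalemxAr -scalemxAl !mxtraceZ !mulmxA mxtrace_mulC !mulmxA.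
  rewrite -(mulmxA (_^t* *m _)) !twist_iso_gram //.
  by rewrite mul_scalar_mx -scalemxAl mul_scalar_mx !mxtraceZ tr1 mulr1 mulKf // mulVf.
move=> _ _ /psdmx_factor[a ->] /psdmx_factor[b ->].
rewrite -scalemxAl mxtraceZ; apply: ler_wpM2l => //.
pose W := rtens (a : rop R _ _) (b : rop R _ _) *m twist_iso U.
have -> : \tr (twist_iso U *m (twist_iso U)^t* *m tens (a^t* *m a) (b^t* *m b))
    = \tr (W^t* *m W).
  rewrite tensE -(rtensM (a^t* : rop R _ _) (a : rop R _ _)
    (b^t* : rop R _ _) (b : rop R _ _)) -rtens_adj.
  by rewrite -mulmxA mxtrace_mulC /W adjmxM !mulmxA.
rewrite !tr_gram exchange_big /= sum_prod [X in _ <= X * _]exchange_big.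
rewrite [X in _ <= _ * X]exchange_big big_distrlr /=.
(* Rows l and l' of the factors are pure components of alpha and beta; the bound holds for each pair
   of rows. *)
apply: ler_sum => l _; apply: ler_sum => l' _.
rewrite [X in _ <= X * _]sum_prod [X in _ <= _ * X]sum_prod.
pose u (k : 'I_d) (s : S) : C := \sum_(t : S)
  (rent (a : rop R _ _) l (k, t.1) * rent (b : rop R _ _) l' (k, t.2))
    * rent (U k : rop R _ _) t s.
have eW s : rent W (l, l') s = \sum_k u k s.
  rewrite rentM sum_prod sum_prod; apply: eq_bigr => k _.
  rewrite /u sum_prod; apply: eq_bigr => x _.
  rewrite sum_prod exchange_big /=; apply: eq_bigr => y _.
  under eq_bigr do rewrite rent_rtens rent_mkrop /= mulrCA.
  by rewrite sum_delta.
under eq_bigr do rewrite eW.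
apply: sum_family_norm => k; try by apply: sumr_ge0 => ? _; rewrite exprn_ge0.
rewrite (sum_unitary_norm _ (uU k)) sum_prod big_distrlr /=.
by apply: eq_bigr => x _; apply: eq_bigr => y _; rewrite normrM exprMn.
Qed.
End Test.

End PrivateStates.

(** * Coherent decoding of a random code *)

Section RandomCode.
Variable C : numClosedFieldType.

Section Update.
Variables (N : nat) (Cd : finType).

Definition update (s : {ffun 'I_N -> Cd}) m c : {ffun 'I_N -> Cd} :=
  [ffun i => if i == m then c else s i].

(** Resampling one letter of a uniform code leaves it uniform: exchanging the old letter with the
    fresh one is an involution. *)
Lemma sum_update (V : nmodType) (F : {ffun 'I_N -> Cd} -> V) m :
  \sum_s \sum_c F (update s m c) = (\sum_s F s) *+ #|Cd|.
Proof.
pose sw (p : {ffun 'I_N -> Cd} * Cd) := (update p.1 m p.2, p.1 m).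
have swK : involutive sw.
  case=> s c; rewrite /sw /=; congr pair; last by rewrite ffunE eqxx.
  by apply/ffunP => i; rewrite !ffunE; case: eqP => // ->.
rewrite pair_bigA (reindex_inj (inv_inj swK)) /=.
rewrite -(pair_bigA _ (fun s c => F (update (update s m c) m (s m)))) /=.
rewrite -sumrMnl; apply: eq_bigr => s _.
rewrite -sumr_const; apply: eq_bigr => c _; congr F.
by apply/ffunP => i; rewrite !ffunE; case: eqP => // ->.
Qed.
End Update.

Variables (n : nat) (Cd : finType) (Z : Cd -> 'M[C]_n) (T omega omega' : 'M[C]_n).
Hypothesis Cd_gt0 : (0 < #|Cd|)%N.
Hypothesis Z_adj : forall c, (Z c)^t* = Z c.
Hypothesis Z_sqr : forall c, Z c *m Z c = 1%:M.
Hypothesis T_ge0 : psdmx T.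
Hypothesis T_le1 : psdmx (1%:M - T).
Hypothesis omega_ge0 : psdmx omega.
(** Whatever sign c the sender used, averaging over an independent sign of the decoder leaves
    omega'. This is how a wrong message looks to a test. *)
Hypothesis twirl : forall c,
  \sum_c' Z c' *m (Z c *m omega *m Z c) *m Z c' = #|Cd|%:R *: omega'.
Variables (N' : nat) (t : C).
Hypothesis t_gt0 : 0 < t.
Local Notation N := N'.+1.
Local Notation code := {ffun 'I_N -> Cd}.

Let conjZ_ge0 c (A : 'M[C]_n) : psdmx A -> psdmx (Z c *m A *m Z c).
Proof. by move=> pA; have := psdmx_conj (Z c) pA; rewrite Z_adj. Qed.

Let trZ c (A : 'M[C]_n) : \tr (Z c *m A *m Z c) = \tr A.
Proof. by rewrite mxtrace_mulC mulmxA Z_sqr mul1mx. Qed.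

Let T_ (s : code) m := Z (s m) *m T *m Z (s m).

Lemma twirl_tr (s : code) m c :
  \sum_c' \tr (T_ (update s m c') m *m (Z c *m omega *m Z c))
    = (\tr (T *m omega')) *+ #|Cd|.
Proof.
transitivity (\tr (T *m (#|Cd|%:R *: omega'))); last first.
  by rewrite -scalemxAr mxtraceZ mulr_natl.
rewrite -(twirl c) mulmx_sumr raddf_sum /=; apply: eq_bigr => c' _.
rewrite /T_ ffunE eqxx -!mulmxA mxtrace_mulC !mulmxA.
done.
Qed.

(** B averages over m the amplitude of decoding message m and undoing its sign; its squared norm on
    omega is the overlap with the maximally entangled state. The right test accepts with weight \tr
    (T omega), each of the N' wrong ones on average with \tr (T omega'). The state omega may be
    unnormalised, so its trace appears in the bound. *)
Lemma code_fidelity : exists K : code -> 'I_N -> 'M[C]_n,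
  (forall s, psdmx (1%:M - \sum_m (K s m)^t* *m K s m)) /\
  (let B (s : code) := N%:R^-1 *: \sum_m Z (s m) *m K s m *m Z (s m) in
   2 * \tr (T *m omega) - 2 * t * \tr omega
     - t^-1 * (\tr omega - \tr (T *m omega))
     - t^-1 * (N'%:R * \tr (T *m omega')) - \tr omega
   <= #|{: code}|%:R^-1 * \sum_s \tr ((B s)^t* *m B s *m omega)).
Proof.
have T0 s m : psdmx (T_ s m) by apply: conjZ_ge0.
have T1 s m : psdmx (1%:M - T_ s m).
  have := conjZ_ge0 (s m) T_le1; congr psdmx.
  by rewrite mulmxBr mulmxBl mulmx1 Z_sqr.
have S0 s : psdmx (\sum_m T_ s m) by apply: psdmx_sum.
have [G GP] := choice (fun s : code => inv_1D_psd (S0 s)).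
pose K (s : code) m := 2 *: (T_ s m *m G s).
exists K; split.
  by move=> s; have [aG GH HG] := GP s; apply: kraus_pretty_good_le1.
move=> B.
have n0 : #|{: code}|%:R != 0 :> C.
  by rewrite pnatr_eq0 -lt0n card_ffun expn_gt0 Cd_gt0.
have step s m : 2 * \tr (T *m omega) - (t * \tr omega
      + t^-1 * (\tr omega - \tr (T *m omega)))
    - (t * \tr omega + t^-1 * \sum_(m' | m' != m)
        \tr (T_ s m' *m (Z (s m) *m omega *m Z (s m))))
    <= 'Re (\tr (K s m *m (Z (s m) *m omega *m Z (s m)))) *+ 2.
  have [aG GH HG] := GP s.
  have := kraus_pretty_good_succ (T0 s) (T1 s) aG GH HG m
    (conjZ_ge0 (s m) omega_ge0) t_gt0.
  have -> : \tr (T_ s m *m (Z (s m) *m omega *m Z (s m))) = \tr (T *m omega).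
    rewrite /T_ -!mulmxA (mulmxA (Z _) (Z _)) Z_sqr mul1mx mxtrace_mulC.
    by rewrite -!mulmxA Z_sqr mulmx1.
  rewrite trZ (Creal_ReP _ _) ?ger0_real ?psdmx_trM_ge0 // [2 * _]mulr_natl.
  have -> : \sum_m' T_ s m' - T_ s m = \sum_(m' | m' != m) T_ s m'.
    by rewrite (bigD1 m) //= addrAC subrr add0r.
  by rewrite mulmx_suml (raddf_sum (@mxtrace C n)).
have trB (U V : 'M[C]_n) : \tr (U - V) = \tr U - \tr V by rewrite linearB.
(* Positivity of the Gram matrix of B - 1 makes the bound linear in B, so that the average over
   codes involves first moments only. *)
have lowB s : 'Re (\tr (B s *m omega)) *+ 2 - \tr omega
    <= \tr ((B s)^t* *m B s *m omega).
  have := psdmx_trM_ge0 (psdmx_gram (B s - 1%:M)) omega_ge0.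
  rewrite adjmxB adjmx1 mulmxBr mulmx1 !mulmxBl mul1mx !trB.
  have -> : \tr ((B s)^t* *m omega) = (\tr (B s *m omega))^*.
    by rewrite -trace_adj adjmxM (psdmx_adj omega_ge0) mxtrace_mulC.
  have -> : 'Re (\tr (B s *m omega)) *+ 2
     = \tr (B s *m omega) + (\tr (B s *m omega))^*.
    by rewrite ReE -mulr_natr mulfVK ?pnatr_eq0.
  move=> h; rewrite -subr_ge0; move: h; rewrite !mul1mx; congr (0 <= _); ring.
have ReS (F : 'I_N -> C) : 'Re (\sum_i F i) = \sum_i 'Re (F i) by exact: raddf_sum.
have reB s : 'Re (\tr (B s *m omega)) *+ 2 = N%:R^-1 *
    \sum_m 'Re (\tr (K s m *m (Z (s m) *m omega *m Z (s m)))) *+ 2.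
  rewrite /B -scalemxAl mxtraceZ ReMl ?realV ?realn // -mulrnAr; congr (_ * _).
  rewrite mulmx_suml (raddf_sum (@mxtrace C n)) ReS sumrMnl; congr (_ *+ _).
  by apply: eq_bigr => m _ /=; rewrite -!mulmxA (mxtrace_mulC (Z _)) !mulmxA.
(* Resampling the letter m' leaves the sign applied for m untouched and twirls the test for m'. *)
have avg m m' : m' != m -> \sum_(s : code)
    \tr (T_ s m' *m (Z (s m) *m omega *m Z (s m)))
    = \tr (T *m omega') *+ #|{: code}|.
  move=> mm; apply: (pmulrnI Cd_gt0); rewrite /= -(sum_update _ m').
  rewrite -mulrnA mulnC mulrnA.
  transitivity (\sum_(s : code) (\tr (T *m omega') *+ #|Cd|)); last first.
    by rewrite sumr_const.
  apply: eq_bigr => s _.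
  rewrite -[RHS](twirl_tr s m' (s m)); apply: eq_bigr => c _.
  by rewrite [update s m' c m]ffunE eq_sym (negPf mm).
set w := \tr omega in lowB step *; set p := \tr (T *m omega) in step *.
set x := \tr (T *m omega') in avg *.
pose tau (s : code) m m' := \tr (T_ s m' *m (Z (s m) *m omega *m Z (s m))).
pose c0 := 2 * p - (t * w + t^-1 * (w - p)) - t * w.
have N0 : 0 <= N%:R^-1 :> C by rewrite invr_ge0 ler0n.
have low s : N%:R^-1 * (\sum_m (c0 - t^-1 * \sum_(m' | m' != m) tau s m m')) - w
    <= \tr ((B s)^t* *m B s *m omega).
  apply: le_trans (lowB s); rewrite lerD2r reB; apply: ler_wpM2l => //.
  apply: ler_sum => m _; apply: le_trans (step s m).
  by rewrite le_eqVlt; apply/orP; left; apply/eqP; rewrite /c0 /tau; ring.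
have sums : \sum_s (N%:R^-1 * (\sum_m (c0 - t^-1 * \sum_(m' | m' != m) tau s m m')) - w)
   = #|{: code}|%:R * (c0 - t^-1 * (N'%:R * x) - w).
  rewrite sumrB sumr_const mulrBr; congr (_ - _); last by rewrite mulr_natl.
  rewrite -mulr_sumr exchange_big /=.
  under eq_bigr => m _.
    rewrite sumrB sumr_const -mulr_sumr exchange_big /=.
    under eq_bigr => m' mm do rewrite avg //.
    have -> : \sum_(m' | m' != m) x *+ #|{: code}| = (x *+ #|{: code}|) *+ N'.
      by rewrite sumr_const cardC1 card_ord.
    over.
  rewrite sumr_const card_ord -[X in _ * X]mulr_natl mulKf ?pnatr_eq0 //.
  rewrite -[c0 *+ _]mulr_natl -[x *+ _]mulr_natl -[_ *+ N']mulr_natl; ring.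
have n1 : 0 < #|{: code}|%:R :> C by rewrite lt0r n0 ler0n.
rewrite ler_pdivlMl //; apply: le_trans (ler_sum _ (fun s _ => low s)).
rewrite sums le_eqVlt; apply/orP; left; apply/eqP; rewrite /c0; ring.
Qed.
End RandomCode.

(** * Two-way LOCC *)

Section Swap.
Variable R : realType.
Local Notation C := (complex R).
Implicit Types X Y Z : finType.

Lemma channel_kraus X Y (E : superop R X Y) : channel E -> kraus E.
Proof. by case=> /cp_kraus. Qed.

Lemma instrument_tr X Y (I : finType) (E : I -> superop R X Y) A :
  instrument E -> \sum_i \tr (E i A) = \tr A.
Proof. by case=> _ /(_ A) <-; rewrite raddf_sum. Qed.

Lemma tens_map_swap X X' Y Y' (E : superop R X X') (F : superop R Y Y') A :
  tens_map E F A = relabel (fun p : X' ** Y' => (p.2, p.1) : Y' ** X')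
    (tens_map F E (relabel (fun p : Y ** X => (p.2, p.1) : X ** Y) A)).
Proof.
have lT := tens_map_linear E F.
have lT' := tens_map_linear F E.
move: A; apply: linmap_ext => //.
  by move=> a A B; rewrite relabel_linear lT' relabel_linear.
move=> [x y] [x' y']; rewrite tens_map_outer.
have -> : relabel (fun p : Y ** X => (p.2, p.1) : X ** Y) (outer (x, y) (x', y'))
    = outer (y, x) (y', x') :> op R (Y ** X).
  apply: rop_ext => -[u v] [u' v']; rewrite relabelE !rent_outer !xpair_eqE /=.
  by congr ((_ && _)%:R); exact: andbC.
rewrite tens_map_outer; apply: rop_ext => p q.
by rewrite relabelE !rent_rtens mulrC.
Qed.

Lemma tr_relabel X Y (f : Finite.sort Y -> Finite.sort X) (A : op R X) : bijective f ->
  \tr (relabel f A) = \tr A.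
Proof.
move=> bf; rewrite !trE; under eq_bigr do rewrite relabelE.
by rewrite [RHS](reindex f) //; apply: onW_bij.
Qed.

Lemma swap_bij X Y : bijective (fun p : Y ** X => (p.2, p.1) : X ** Y).
Proof. by exists (fun p => (p.2, p.1)) => -[]. Qed.

Lemma tr_tens_map_r X X' Y Y' (I : finType) (E : I -> superop R X X')
    (F : I -> superop R Y Y') (A : op R (X ** Y)) :
  (forall i A, \tr (E i A) = \tr A) -> (forall A, \sum_i \tr (F i A) = \tr A) ->
  \sum_i \tr (tens_map (E i) (F i) A) = \tr A.
Proof.
move=> tE tF.
transitivity (\sum_i \tr (tens_map (F i) (E i)
    (relabel (fun p : Y ** X => (p.2, p.1) : X ** Y) A))).
  apply: eq_bigr => i _; rewrite tens_map_swap.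
  exact: (tr_relabel _ (swap_bij _ _)).
by rewrite tr_tens_map //; exact: (tr_relabel _ (swap_bij _ _)).
Qed.

(** Each round turns a product into a sum of products whose traces add up to the original one, so
    the bound on products survives. The other clauses, proved by the same induction, ensure that the
    pulled back test is an effect. *)
Lemma locc_product_bound (A' B' : finType) (T : op R (A' ** B')) (c : C) :
  (forall a b, psd a -> psd b -> \tr (T *m tens a b) <= c * (\tr a * \tr b)) ->
  forall A B (L : superop R (A ** B) (A' ** B')), locc L ->
  [/\ linear L, forall r, psd r -> psd (L r), forall r, \tr (L r) = \tr r
    & forall a b, psd a -> psd b -> \tr (T *m L (tens a b)) <= c * (\tr a * \tr b)].
Proof.
move=> hT A B L; elim=> {A B L}
  [A B E F hE hF|A B A1 I E L hE _ IH|A B B1 I E L hE _ IH].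
- have kE := channel_kraus hE; have kF := channel_kraus hF.
  case: hE hF => _ tE [_ tF]; split.
  + exact: tens_map_linear.
  + by move=> r; apply/kraus_psd/kraus_tens_map.
  + move=> r; have := @tr_tens_map R _ _ _ _ unit (fun _ => E) (fun _ => F) r.
    rewrite big_const card_unit /= addr0; apply=> // x.
    by rewrite big_const card_unit /= addr0.
  + move=> a b pa pb; rewrite tens_map_tens; try exact: kraus_linear.
    by rewrite -(tE a) -(tF b); apply: hT; apply: kraus_psd.
- have kE i : kraus (E i) by case: hE => /(_ i) /cp_kraus.
  have kEi i : kraus (tens_map (E i) (fun s : op R B => s)).
    by apply: kraus_tens_map => //; apply: kraus_id.
  split.
  + move=> a r r'; rewrite scaler_sumr -big_split; apply: eq_bigr => i _ /=.
    by case: (IH i) => lL _ _ _; rewrite tens_map_linear lL.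
  + move=> r pr; apply: psdmx_sum => i; case: (IH i) => _ pL _ _.
    by apply/pL/kraus_psd.
  + move=> r; rewrite raddf_sum /=.
    rewrite -(@tr_tens_map R _ _ _ _ I E (fun _ s => s) r) //; last first.
      by move=> x; apply: instrument_tr.
    by apply: eq_bigr => i _; case: (IH i).
  + move=> a b pa pb; rewrite mulmx_sumr raddf_sum /=.
    rewrite -(instrument_tr a hE) big_distrl /= mulr_sumr; apply: ler_sum => i _.
    rewrite tens_map_tens //; last exact: kraus_linear.
    by case: (IH i) => _ _ _; apply=> //; apply: kraus_psd.
- have kE i : kraus (E i) by case: hE => /(_ i) /cp_kraus.
  have kEi i : kraus (tens_map (fun s : op R A => s) (E i)).
    by apply: kraus_tens_map => //; apply: kraus_id.
  split.
  + move=> a r r'; rewrite scaler_sumr -big_split; apply: eq_bigr => i _ /=.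
    by case: (IH i) => lL _ _ _; rewrite tens_map_linear lL.
  + move=> r pr; apply: psdmx_sum => i; case: (IH i) => _ pL _ _.
    by apply/pL/kraus_psd.
  + move=> r; rewrite raddf_sum /=.
    rewrite -(@tr_tens_map_r _ _ _ _ I (fun _ s => s) E r) //; last first.
      by move=> x; apply: instrument_tr.
    by apply: eq_bigr => i _; case: (IH i).
  + move=> a b pa pb; rewrite mulmx_sumr raddf_sum /=.
    rewrite -(instrument_tr b hE) big_distrr /= mulr_sumr; apply: ler_sum => i _.
    rewrite tens_map_tens //; last exact: kraus_linear.
    by case: (IH i) => _ _ _; apply=> //; apply: kraus_psd.
Qed.

End Swap.

(** * Conditioning on measurement outcomes *)

Section Outcomes.
Variable R : realType.
Local Notation C := (complex R).
Implicit Types X Y Z : finType.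

(** The unnormalised state of X conditioned on the effect M on Y; its trace against a normalised A
    is the probability of M. *)
Definition marg X Y (M : op R Y) (A : op R (X ** Y)) : op R X :=
  mkop (fun x x' => \sum_y \sum_y' ent A (x, y) (x', y') * ent M y' y).

Lemma rent_marg X Y (M : op R Y) (A : op R (X ** Y)) x x' :
  rent (marg M A : rop R X X) x x' = \sum_y \sum_y'
    rent (A : rop R _ _) (x, y) (x', y') * rent (M : rop R _ _) y' y.
Proof. exact: rent_mkrop. Qed.

Lemma marg_linear X Y (M : op R Y) : linear (@marg X Y M).
Proof.
move=> a A B; apply: rop_ext => p q; rewrite rentD rentZ !rent_marg mulr_sumr.
rewrite -big_split; apply: eq_bigr => y _ /=; rewrite mulr_sumr -big_split.
by apply: eq_bigr => y' _ /=; rewrite rentD rentZ mulrDl mulrA.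
Qed.

Lemma tr_mulE X (A B : op R X) :
  \tr (A *m B) = \sum_x \sum_y rent (A : rop R X X) x y * rent (B : rop R X X) y x.
Proof. by rewrite trE; apply: eq_bigr => x _; rewrite rentM. Qed.

Lemma marg_tens X Y (M : op R Y) (a : op R X) (b : op R Y) :
  marg M (tens a b) = \tr (M *m b) *: a.
Proof.
apply: rop_ext => p q; rewrite rentZ rent_marg mxtrace_mulC tr_mulE mulr_suml.
apply: eq_bigr => y _; rewrite mulr_suml; apply: eq_bigr => y' _.
by rewrite rent_rtens /= -mulrA mulrC.
Qed.

Lemma kraus_marg X Y (M : op R Y) : psd M -> kraus (@marg X Y M).
Proof.
move=> /psdmx_factor[b eb].
pose K (j : 'I_#|Y|) : rop R (X ** Y) X :=
  mkrop (fun x p => (x == p.1)%:R * b j (enum_rank p.2)).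
have eK n (A : 'M[C]_(_, n)) j x i : (K j *m A) (enum_rank x) i
    = \sum_y b j (enum_rank y) * A (enum_rank ((x, y) : X ** Y)) i.
  rewrite mxE big_enum_rank sum_prod (bigD1 x) //= [X in _ + X]big1 ?addr0.
    by apply: eq_bigr => y _; rewrite mxE !enum_rankK eqxx mul1r.
  move=> z zx; rewrite big1 // => y _.
  by rewrite mxE !enum_rankK /= eq_sym (negPf zx) !mul0r.
exists 'I_#|Y|, K => A; apply: rop_ext => x x'.
rewrite rent_sum rent_marg.
have e j : rent (K j *m A *m (K j)^t* : rop R X X) x x' = \sum_y \sum_y'
    rent (A : rop R _ _) (x, y) (x', y')
    * ((b j (enum_rank y'))^* * b j (enum_rank y)).
  transitivity (((K j *m (K j *m A)^t* )^t* ) (enum_rank x) (enum_rank x')).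
    by rewrite adjmxM trmxCK.
  rewrite 2!mxE eK exchange_big rmorph_sum; apply: eq_bigr => y' _ /=.
  rewrite rmorphM /= 2!mxE conjCK eK mulr_sumr; apply: eq_bigr => y _.
  by rewrite mulrC -mulrA mulrC -mulrA [_ * b j _]mulrC /rent; ring.
under [in RHS]eq_bigr do rewrite e.
rewrite [in RHS]exchange_big; apply: eq_bigr => y _.
rewrite [in RHS]exchange_big; apply: eq_bigr => y' _ /=.
rewrite -mulr_sumr; congr (_ * _); rewrite eb /rent mxE.
by apply: eq_bigr => j _; rewrite !mxE.
Qed.

Lemma tr_marg X Y (M : op R Y) (A : op R (X ** Y)) (T : op R X) :
  \tr (T *m marg M A) = \tr (tens T M *m A).
Proof.
have l1 : linfunctional (fun A => \tr (T *m marg M A)).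
  exact: linfunctional_tr (@marg_linear _ _ _).
have l2 : linfunctional (fun A : op R (X ** Y) => \tr (tens T M *m A)).
  by apply: (@linfunctional_tr R _ _ (fun x => x)) => a B D.
rewrite (linfunctionalE A l1) (linfunctionalE A l2).
apply: eq_bigr => -[x y] _; apply: eq_bigr => -[x' y'] _; congr (_ * _).
rewrite -tens_outer marg_tens -scalemxAr mxtraceZ !tensE rtensM -tensE tr_tens.
exact: mulrC.
Qed.

Lemma sum_tr_marg X Y (I : finType) (M : I -> op R Y) (A : op R (X ** Y)) :
  \sum_i M i = 1%:M -> \sum_i \tr (marg (M i) A) = \tr A.
Proof.
move=> M1; under eq_bigr do rewrite -[marg _ _]mul1mx tr_marg.
rewrite -raddf_sum -mulmx_suml -(linmap_sum (tens_linear_r _)) M1.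
have -> : tens (1%:M : op R X) (1%:M : op R Y) = 1%:M.
  apply: rop_ext => -[x y] [x' y'].
  by rewrite rent_rtens !rent1 /= -natrM mulnb xpair_eqE.
by rewrite mul1mx.
Qed.

Lemma tens_map_broadcast X Y (I : finType) (M : I -> op R Y) (A : op R (X ** Y)) :
  tens_map (fun s : op R X => s) (broadcast M) A
    = \sum_k tens (marg (M k) A) (outer (k, k) (k, k)).
Proof.
have lB : linear (broadcast M).
  move=> a B D; rewrite /broadcast scaler_sumr -big_split; apply: eq_bigr => i _.
  by rewrite mulmxDr -scalemxAr mxtraceD mxtraceZ scalerDl scalerA.
move: A; apply: op_tens_ext; first exact: tens_map_linear.
  move=> a A B; rewrite scaler_sumr -big_split; apply: eq_bigr => i _ /=.
  by rewrite marg_linear tens_linear_l.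
move=> a b; rewrite tens_map_tens // /broadcast (linmap_sum (tens_linear_r _)).
apply: eq_bigr => k _; rewrite marg_tens (linmapZ (tens_linear_r _)).
by rewrite (linmapZ (tens_linear_l _)).
Qed.

Lemma psd_outer X (x : X) : psd (outer x x : op R X).
Proof.
have -> : outer x x = (outer x x)^t* *m outer x x :> op R X.
  apply: rop_ext => y z; rewrite rentM (bigD1 x) //= big1 ?addr0.
    by rewrite rent_adj !rent_outer eqxx /= conjC_nat -natrM mulnb.
  by move=> w wx; rewrite [X in _ * X]rent_outer (negPf wx) mulr0.
exact: psdmx_gram.
Qed.

Lemma tr_outer X (x : X) : \tr (outer x x : op R X) = 1.
Proof.
rewrite trE (bigD1 x) //= big1 ?addr0 ?rent_outer ?eqxx // => y yx.
by rewrite rent_outer (negPf yx).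
Qed.

Lemma regroup_bij X Y Z W : bijective (@regroup X Y Z W).
Proof. by exists (@regroup _ _ _ _) => -[[? ?] [? ?]]. Qed.

(** Both registers hold the classical value k, so adding them to a product of A and B gives a
    product of the enlarged systems, to which the LOCC bound applies for each outcome separately. *)
Lemma outcome_effects (A B K A' B' I : finType) (M : I -> op R K)
    (L : superop R ((A ** I) ** (B ** I)) (A' ** B')) (T : op R (A' ** B')) c :
  locc L -> psd T -> psd (1%:M - T) ->
  (forall a b, psd a -> psd b -> \tr (T *m tens a b) <= c * (\tr a * \tr b)) ->
  exists F : I -> op R (A ** B),
    [/\ forall k, psd (F k), forall k, psd (1%:M - F k),
      (forall r : op R ((A ** B) ** K), \sum_k \tr (F k *m marg (M k) r)
        = \tr (T *m L (relabel (@regroup _ _ _ _)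
            (tens_map (fun s : op R (A ** B) => s) (broadcast M) r)))) &
      forall k a b, psd a -> psd b ->
        \tr (F k *m tens a b) <= c * (\tr a * \tr b)].
Proof.
move=> hL pT T1 hT; have [lL pL tL bL] := locc_product_bound hT hL.
pose emb k (r : op R (A ** B)) : op R ((A ** I) ** (B ** I)) :=
  relabel (@regroup _ _ _ _) (tens r (outer (k, k) (k, k))).
have lemb k : linear (emb k).
  by move=> a r r'; rewrite /emb tens_linear_l relabel_linear.
have ef k : effect (fun r => \tr (T *m L (emb k r))).
  split.
    apply: (@linfunctional_tr R _ _ (fun r => L (emb k r))) => a r r'.
    by rewrite lemb lL.
  move=> r pr; have pE : psd (L (emb k r)).
    apply: pL; apply: (@kraus_psd R _ _ (relabel (@regroup _ _ _ _))).
      by apply: kraus_relabel; apply: bij_inj; apply: regroup_bij.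
    by apply: psd_tens => //; apply: psd_outer.
  apply/andP; split; first exact: (psdmx_trM_ge0 pT pE).
  have := psdmx_trM_le pE T1; rewrite mulmx1 tL mxtrace_mulC.
  by rewrite (tr_relabel _ (@regroup_bij _ _ _ _)) tr_tens tr_outer mulr1.
have [F FP] := choice (fun k => effect_matrix (ef k)).
exists F; split=> [k|k|r|k a b pa pb]; try by case: (FP k).
- rewrite tens_map_broadcast (linmap_sum (@relabel_linear _ _ _ _)).
  rewrite (linmap_sum lL) mulmx_sumr raddf_sum; apply: eq_bigr => k _ /=.
  by case: (FP k) => _ _ ->.
case: (FP k) => _ _ <-.
have -> : emb k (tens a b) = tens (tens a (outer k k)) (tens b (outer k k)).
  apply: rop_ext => -[[x i] [y j]] [[x' i'] [y' j']].
  rewrite relabelE !rent_rtens /= !rent_outer !xpair_eqE -!mulnb !natrM; ring.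
apply: (le_trans (bL _ _ _ _)); try by apply: psd_tens => //; apply: psd_outer.
by rewrite !tr_tens !tr_outer !mulr1.
Qed.

End Outcomes.

(** * Key attack as random signs *)

Section Dephasing.
Variable R : realType.
Local Notation C := (complex R).
Implicit Types X Y Z : finType.

(** Flipping the sign at i is an involution of the sign functions that negates every term when i and
    j differ. *)
Lemma sum_signs (d : nat) (i j : 'I_d) :
  \sum_(f : {ffun 'I_d -> bool}) (-1) ^+ f i * (-1) ^+ f j
    = #|{ffun 'I_d -> bool}|%:R * (i == j)%:R :> C.
Proof.
have [<-|ij] := eqVneq i j.
  under eq_bigr do rewrite -expr2 sqrr_sign.
  by rewrite sumr_const mulr1.
rewrite mulr0.
pose flip (f : {ffun 'I_d -> bool}) := [ffun k => f k (+) (k == i)].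
have flipK : involutive flip.
  by move=> f; apply/ffunP => k; rewrite !ffunE -addbA addbb addbF.
set s := \sum_f _; have : s = - s.
  rewrite {1}/s (reindex_inj (inv_inj flipK)) -sumrN; apply: eq_bigr => f _ /=.
  by rewrite !ffunE eqxx eq_sym (negPf ij) addbF addbT signrN mulNr.
move/eqP; rewrite -addr_eq0 -mulr2n mulrn_eq0 /= => /eqP; exact.
Qed.

Section Signs.
Variables (d1 d2 : nat).
Definition signs : finType := ({ffun 'I_d1 -> bool} * {ffun 'I_d2 -> bool})%type.

Lemma signs_gt0 : (0 < #|signs|)%N.
Proof. by rewrite card_prod !card_ffun muln_gt0 !expn_gt0 card_bool. Qed.

Variables (S1 S2 : finType).
Local Notation H := ((key d1 ** S1) ** (key d2 ** S2)).

Definition sgn (c : signs) (p : H) : C :=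
  (-1) ^+ c.1 p.1.1 * (-1) ^+ c.2 p.2.1.

(** Signs in place of general phases make this operator Hermitian and its own inverse, so a sign is
    undone by applying it again. *)
Definition signop (c : signs) : op R H := diagop (sgn c).

Lemma sgn_sqr c p : sgn c p * sgn c p = 1.
Proof. by rewrite /sgn mulrACA -!expr2 !sqrr_sign mulr1. Qed.

Lemma sgn_conj c p : (sgn c p)^* = sgn c p.
Proof.
by apply: conj_Creal; rewrite realM // rpredX // realN real1.
Qed.

Lemma signop_adj c : (signop c)^t* = signop c.
Proof.
apply: rop_ext => p q; rewrite rent_adj !rent_mkrop rmorphM /= conjC_nat sgn_conj.
by rewrite eq_sym; case: eqP => [->|]; rewrite ?mul0r.
Qed.

Lemma signop_sqr c : signop c *m signop c = 1%:M.
Proof.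
apply: rop_ext => p q; rewrite rent_diagopM rent_mkrop rent1 mulrCA.
by rewrite sgn_sqr mulr1.
Qed.

Lemma rent_conj_signop c (A : op R H) p q :
  rent (signop c *m A *m signop c : rop R H H) p q
    = sgn c p * rent (A : rop R H H) p q * sgn c q.
Proof. by rewrite rent_Mdiagop rent_diagopM. Qed.

Definition same_keys (p q : H) : bool :=
  (p.1.1 == q.1.1) && (p.2.1 == q.2.1).

Lemma sum_sgn p q :
  \sum_c sgn c p * sgn c q = #|signs|%:R * (same_keys p q)%:R.
Proof.
under eq_bigr do rewrite mulrACA.
rewrite -(pair_bigA _ (fun f g : {ffun _ -> bool} =>
  ((-1) ^+ f p.1.1 * (-1) ^+ f q.1.1) * ((-1) ^+ g p.2.1 * (-1) ^+ g q.2.1) : C)) /=.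
rewrite -big_distrlr /= !sum_signs mulrACA -!natrM mulnb.
by rewrite card_prod.
Qed.

(** Averaging kills the entries between different keys; where the keys agree, the fixed sign c takes
    the same value on both sides and cancels. *)
Lemma signop_twirl (A A' : op R H) c :
  (forall p q, rent (A' : rop R H H) p q
     = (same_keys p q)%:R * rent (A : rop R H H) p q) ->
  \sum_c' signop c' *m (signop c *m A *m signop c) *m signop c'
    = #|signs|%:R *: A'.
Proof.
move=> eA'; apply: rop_ext => p q; rewrite rent_sum rentZ eA'.
transitivity (\sum_c' (sgn c' p * sgn c' q)
    * (sgn c p * rent (A : rop R H H) p q * sgn c q) : C).
  by apply: eq_bigr => c' _; rewrite !rent_conj_signop; ring.
rewrite -mulr_suml sum_sgn -mulrA; congr (_ * _).
have [e|] := boolP (same_keys p q); last by rewrite !mul0r.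
have -> : sgn c q = sgn c p by case/andP: e => /eqP e1 /eqP e2; rewrite /sgn e1 e2.
by congr (_ * _); rewrite mulrAC sgn_sqr mul1r.
Qed.

End Signs.

Section Attacked.
Variables (d : nat) (SA SB : finType).
Local Notation HAB := ((key d ** SA) ** (key d ** SB)).
Variable gamma : op R HAB.

Lemma private_support p q : private_state gamma ->
  (p.1.1 != p.2.1) || (q.1.1 != q.2.1) -> rent (gamma : rop R HAB HAB) p q = 0.
Proof.
move=> /private_stateE[sigma [U [_ _ ->]]] /orP h; rewrite rentZ.
set V := twist_iso U.
have V0 r s : r.1.1 != r.2.1 -> rent V r s = 0.
  by move=> /negPf rr; rewrite rent_mkrop rr mul0r.
rewrite rentM big1 ?mulr0 // => s _.
case: h => h; last by rewrite rent_adj V0 // conjC0 mulr0.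
by rewrite rentM big1 ?mul0r // => s' _; rewrite V0 // mul0r.
Qed.

(** In this form, a mask on matrix entries, the key attack can be compared with an average over
    signs. *)
Lemma rent_key_attacked p q : rent (key_attacked gamma : rop R HAB HAB) p q
  = (same_keys p q)%:R * rent (gamma : rop R HAB HAB) p q.
Proof.
pose g i j (p : HAB) : C := ((p.1.1 == i) && (p.2.1 == j))%:R.
have eP i j : tens (tens (outer i i) 1%:M) (tens (outer j j) 1%:M)
    = diagop (g i j) :> op R HAB.
  apply: rop_ext => -[[a x] [b y]] [[a' x'] [b' y']].
  rewrite !rent_rtens /= !rent1 !rent_outer rent_mkrop /g /= !xpair_eqE.
  rewrite -!natrM !mulnb; congr (_ %:R).
  case: (a =P i) => [->|]; last by rewrite ?andbF.
  case: (b =P j) => [->|]; last by rewrite ?andbF.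
  rewrite !andbT /= [a' == _]eq_sym [b' == _]eq_sym.
  done.
rewrite rent_sum.
under eq_bigr => i _.
  rewrite rent_sum.
  under eq_bigr do rewrite eP rent_Mdiagop rent_diagopM.
  over.
rewrite (bigD1 p.1.1) //= [X in _ + X]big1 ?addr0; last first.
  move=> i ia; rewrite big1 // => j _.
  by rewrite /g eq_sym (negPf ia) !mul0r.
rewrite (bigD1 p.2.1) //= big1 ?addr0; last first.
  move=> i ia.
  by rewrite /g [p.2.1 == _]eq_sym (negPf ia) andbF !mul0r.
rewrite /g !eqxx mul1r mulrC; congr (_%:R * _).
by rewrite /same_keys eq_sym [q.2.1 == _]eq_sym.
Qed.
End Attacked.

(** * Charlie's signs and measurement on two private states *)

Section Swapped.
Variables (d1 d2 : nat) (SA SC SC' SB : finType).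
Local Notation H1 := ((key d1 ** SA) ** (key d1 ** SC)).
Local Notation H2 := ((key d2 ** SC') ** (key d2 ** SB)).
Local Notation HAB := ((key d1 ** SA) ** (key d2 ** SB)).
Local Notation HC := ((key d1 ** SC) ** (key d2 ** SC')).
Variables (gamma1 : op R H1) (gamma2 : op R H2).
Hypothesis private1 : private_state gamma1.
Hypothesis private2 : private_state gamma2.

Definition gathered (g1 : op R H1) (g2 : op R H2) : op R (HAB ** HC) :=
  relabel (@gather_charlie _ _ _ _) (tens g1 g2).

Lemma rent_gathered g1 g2 p q : rent (gathered g1 g2 : rop R _ _) p q
  = rent (g1 : rop R _ _) (p.1.1, p.2.1) (q.1.1, q.2.1)
    * rent (g2 : rop R _ _) (p.2.2, p.1.2) (q.2.2, q.1.2).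
Proof. by rewrite relabelE rent_rtens. Qed.

Lemma gathered_sgn c p q :
  sgn c p.1 * rent (gathered gamma1 gamma2 : rop R _ _) p q
    = sgn c p.2 * rent (gathered gamma1 gamma2 : rop R _ _) p q
  /\ rent (gathered gamma1 gamma2 : rop R _ _) p q * sgn c q.1
    = rent (gathered gamma1 gamma2 : rop R _ _) p q * sgn c q.2.
Proof.
rewrite rent_gathered.
have h1 := private_support (p := (p.1.1, p.2.1)) (q := (q.1.1, q.2.1)) private1.
have h2 := private_support (p := (p.2.2, p.1.2)) (q := (q.2.2, q.1.2)) private2.
move: h1 h2 => /=.
case: eqP => [e1|_] /=; last by move=> -> //; rewrite !(mul0r, mulr0).
case: eqP => [e2|_] /=; last by move=> -> //; rewrite !(mul0r, mulr0).
move=> _.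
case: eqP => [e3|_] /=; last by move=> -> //; rewrite !(mul0r, mulr0).
case: eqP => [e4|_] /=; last by move=> -> //; rewrite !(mul0r, mulr0).
by move=> _; rewrite /sgn e1 e2 e3 e4.
Qed.

(** On the support of the private states Charlie's keys copy those of A and B, so attacking all four
    keys amounts to dephasing the keys of AB, which commutes with anything Charlie measures. *)
Lemma marg_attacked (M : op R HC) p q :
  rent (marg M (gathered (key_attacked gamma1) (key_attacked gamma2)) : rop R _ _) p q
   = (same_keys p q)%:R * rent (marg M (gathered gamma1 gamma2) : rop R _ _) p q.
Proof.
rewrite !rent_marg mulr_sumr; apply: eq_bigr => y _.
rewrite mulr_sumr; apply: eq_bigr => y' _; rewrite mulrA; congr (_ * _).
rewrite !rent_gathered !rent_key_attacked /same_keys /=.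
have h1 := private_support (p := (p.1, y.1)) (q := (q.1, y'.1)) private1.
have h2 := private_support (p := (y.2, p.2)) (q := (y'.2, q.2)) private2.
move: h1 h2 => /=.
case: eqP => [e1|_] /=; last by move=> -> //; rewrite !(mul0r, mulr0).
case: eqP => [e2|_] /=; last by move=> -> //; rewrite !(mul0r, mulr0).
move=> _.
case: eqP => [e3|_] /=; last by move=> -> //; rewrite !(mul0r, mulr0).
case: eqP => [e4|_] /=; last by move=> -> //; rewrite !(mul0r, mulr0).
move=> _; rewrite -e1 -e2 e3 e4 !andbb -mulnb natrM; ring.
Qed.

(** For product inputs, Charlie's measurement acts on his two factors alone: it leaves the product
    of [a1 i] and [b2 j] on AB, weighted by probabilities that add up to 1. Convexity extends the
    bound to separable states. *)
Lemma separable_swap_bound (I : finType) (M : I -> op R HC)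
    (F : I -> op R HAB) (c : C) (g1 : op R H1) (g2 : op R H2) : 0 <= c ->
  povm M -> separable g1 -> separable g2 ->
  (forall k a b, psd a -> psd b -> \tr (F k *m tens a b) <= c * (\tr a * \tr b)) ->
  \sum_k \tr (F k *m marg (M k) (gathered g1 g2)) <= c.
Proof.
move=> c0 [pM M1] [I1 [p1 [a1 [b1 [p10 s1 da1 db1 ->]]]]].
case=> [I2 [p2 [a2 [b2 [p20 s2 da2 db2 ->]]]]] hF.
pose f (g1 : op R H1) (g2 : op R H2) : C := \sum_k \tr (F k *m marg (M k) (gathered g1 g2)).
have lf1 g : linfunctional (fun x => f x g).
  move=> a x y; rewrite /f mulr_sumr -big_split; apply: eq_bigr => k _ /=.
  by rewrite /gathered tens_linear_l relabel_linear marg_linear mulmxDr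
    -scalemxAr mxtraceD mxtraceZ.
have lf2 g : linfunctional (f g).
  move=> a x y; rewrite /f mulr_sumr -big_split; apply: eq_bigr => k _ /=.
  by rewrite /gathered tens_linear_r relabel_linear marg_linear mulmxDr
    -scalemxAr mxtraceD mxtraceZ.
rewrite -/(f _ _) (linfunctional_sum _ (lf1 _)).
have prod i j : f (tens (a1 i) (b1 i)) (tens (a2 j) (b2 j)) <= c.
  case: (da1 i) (db1 i) (da2 j) (db2 j) => pa1 ta1 [pb1 tb1] [pa2 ta2] [pb2 tb2].
  have -> : c = \sum_k \tr (M k *m tens (b1 i) (a2 j)) * c.
    rewrite -mulr_suml -raddf_sum -mulmx_suml M1 mul1mx /= tr_tens tb1 ta2.
    by rewrite !mul1r.
  apply: ler_sum => k _.
  have -> : gathered (tens (a1 i) (b1 i)) (tens (a2 j) (b2 j))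
      = tens (tens (a1 i) (b2 j)) (tens (b1 i) (a2 j)).
    apply: rop_ext => p q; rewrite rent_gathered !rent_rtens /=; ring.
  rewrite marg_tens -scalemxAr mxtraceZ; apply: ler_wpM2l.
    by apply: psdmx_trM_ge0; [exact: pM | exact: psd_tens].
  apply: (le_trans (hF _ _ _ _ _)) => //.
  by rewrite ta1 tb2 !mulr1.
have -> : c = \sum_i (p1 i)%:C%C * \sum_j (p2 j)%:C%C * c.
  have -> : \sum_j (p2 j)%:C%C * c = c.
    by rewrite -mulr_suml -(raddf_sum (real_complex R)) s2 mul1r.
  by rewrite -mulr_suml -(raddf_sum (real_complex R)) s1 mul1r.
apply: ler_sum => i _; rewrite (linfunctionalZ _ _ (lf1 _)).
apply: ler_wpM2l; first by rewrite ler0c.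
rewrite (linfunctional_sum _ (lf2 _)); apply: ler_sum => j _.
rewrite (linfunctionalZ _ _ (lf2 _)); apply: ler_wpM2l; first by rewrite ler0c.
exact: prod.
Qed.
End Swapped.

End Dephasing.

Arguments sgn {R d1 d2 S1 S2} c p.
Arguments signop {R d1 d2 S1 S2} c.

(** * Maximally entangled states *)

Section MaximallyEntangled.
Variable R : realType.
Local Notation C := (complex R).
Implicit Types X Y Z : finType.

Lemma private_density d (SA SB : finType)
    (gamma : op R ((key d ** SA) ** (key d ** SB))) : (0 < d)%N ->
  private_state gamma -> density gamma.
Proof.
move=> d0 /private_stateE[sigma [U [[ps tr1] uU ->]]].
have nd : d%:R != 0 :> C by rewrite pnatr_eq0 -lt0n.
split.
  apply: psdmxZ; first by rewrite invr_ge0 ler0n.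
  by have := psdmx_conj ((twist_iso U)^t* ) ps; rewrite trmxCK.
rewrite mxtraceZ mxtrace_mulC mulmxA twist_iso_gram // mul_scalar_mx mxtraceZ tr1.
by rewrite mulr1 mulVf.
Qed.

Definition diag_vec N : 'cV[C]_#|key N ** key N| :=
  \col_i ((enum_val i).1 == (enum_val i).2)%:R.

Lemma maxentE N : maxent N = N%:R^-1 *: (diag_vec N *m (diag_vec N)^t* ) :> op R _.
Proof.
apply: rop_ext => p q; rewrite rentZ rent_maxent; congr (_ * _).
by rewrite /rent mxE big_ord1 !mxE !enum_rankK conjC_nat.
Qed.

Lemma diag_vec_gram N : (diag_vec N)^t* *m diag_vec N = N%:R%:M.
Proof.
apply/matrixP => i j; rewrite !ord1 mxE big_enum_rank sum_prod [RHS]mxE eqxx mulr1n.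
rewrite -[in RHS](card_ord N) -[in RHS]sum1_card natr_sum; apply: eq_bigr => a _.
under eq_bigr do rewrite !mxE !enum_rankK conjC_nat -natrM mulnb andbb /=.
by rewrite (bigD1 a) //= big1 ?addr0 ?eqxx // => b ba; rewrite eq_sym (negPf ba).
Qed.

Lemma maxent_psd N : psd (maxent N : op R _).
Proof.
rewrite maxentE; apply: psdmxZ; first by rewrite invr_ge0 ler0n.
by have := psdmx_gram ((diag_vec N)^t* ); rewrite trmxCK.
Qed.

Section Maxent.
Variable N' : nat.
Local Notation N := N'.+1.
Let nN : N%:R != 0 :> C. Proof. by rewrite pnatr_eq0. Qed.

Lemma tr_maxent : \tr (maxent N : op R _) = 1.
Proof.
rewrite maxentE mxtraceZ mxtrace_mulC diag_vec_gram /mxtrace big_ord1 mxE.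
by rewrite eqxx mulr1n mulVf.
Qed.

Lemma maxent_compress (rho : op R (key N ** key N)) :
  maxent N *m rho *m maxent N = \tr (maxent N *m rho) *: maxent N.
Proof.
rewrite maxentE; set v := diag_vec N.
rewrite -!scalemxAl -!scalemxAr mxtraceZ.
have e : v^t* *m rho *m v = (\tr (v *m v^t* *m rho))%:M.
  have -> : \tr (v *m v^t* *m rho) = \tr (v^t* *m rho *m v).
    by rewrite -mulmxA mxtrace_mulC.
  by apply/matrixP => i j; rewrite !ord1 [RHS]mxE eqxx mulr1n /mxtrace big_ord1.
have -> : v *m v^t* *m rho *m (v *m v^t* ) = \tr (v *m v^t* *m rho) *: (v *m v^t* ).
  rewrite !mulmxA -(mulmxA v) -(mulmxA v) e.
  by rewrite mul_mx_scalar -scalemxAl !mulmxA.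
by rewrite !scalerA; congr (_ *: _); ring.
Qed.
End Maxent.


(** The map r -> tr_Y W r W^* with W the sum of |m> (x) W_m: the label m is written into a key
    register in superposition and the system Y is discarded. Charlie's encoding and the decoder both
    have this shape. *)
Definition coherent N X Y (W : 'I_N -> rop R X Y) : superop R X (key N) :=
  fun r => mkop (fun m m' => \tr (W m *m r *m (W m')^t* )).

Lemma kraus_coherent N X Y (W : 'I_N -> rop R X Y) : kraus (coherent W).
Proof.
exists 'I_#|Y|, (fun j => mkrop (fun m x => W m j (enum_rank x))) => r.
apply: rop_ext => m m'; rewrite rent_mkrop rent_sum /mxtrace.
apply: eq_bigr => j _; rewrite mxE big_enum_rank rentM; apply: eq_bigr => x _.
rewrite rent_adj rent_mkrop !mxE rentM big_enum_rank; congr (_ * _).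
by apply: eq_bigr => y _; rewrite rent_mkrop.
Qed.

Lemma tr_coherent N X Y (W : 'I_N -> rop R X Y) r :
  \tr (coherent W r) = \tr ((\sum_m (W m)^t* *m W m) *m r).
Proof.
rewrite trE mulmx_suml raddf_sum; apply: eq_bigr => m _ /=.
by rewrite rent_mkrop mxtrace_mulC mulmxA.
Qed.

Lemma tr_maxent_tens N (A B : op R (key N)) : \tr (maxent N *m tens A B)
  = N%:R^-1 * \sum_(m : 'I_N) \sum_(m' : 'I_N)
      rent (A : rop R _ _) m m' * rent (B : rop R _ _) m m'.
Proof.
rewrite tr_mulE exchange_big mulr_sumr sum_prod; apply: eq_bigr => m _ /=.
transitivity (\sum_m' (m == m')%:R * (N%:R^-1 * \sum_(i : 'I_N)
   rent (A : rop R _ _) m i * rent (B : rop R _ _) m' i) : C).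
  apply: eq_bigr => m' _; rewrite mulr_sumr mulr_sumr sum_prod.
  apply: eq_bigr => i _.
  under eq_bigr do rewrite rent_maxent rent_rtens /= (mulrCA N%:R^-1) -!mulrA.
  by rewrite sum_delta; ring.
by rewrite sum_delta.
Qed.

(** With A the sum of the operators [rtens (V m) (W m)], the overlap is the trace of A X A^* divided
    by N, written out over pairs of messages; the interference terms are what measures coherence. *)
Lemma tr_maxent_coherent N P P1 Q Q1 (V : 'I_N -> rop R P P1)
    (W : 'I_N -> rop R Q Q1) (X : op R (P ** Q)) :
  \tr (maxent N *m tens_map (coherent V) (coherent W) X)
  = N%:R^-1 * \sum_m \sum_m'
     \tr (rtens (V m) (W m) *m X *m (rtens (V m') (W m'))^t* ).
Proof.
have lV := kraus_linear (kraus_coherent V).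
have lW := kraus_linear (kraus_coherent W).
have l1 := linfunctional_tr (maxent N)
  (tens_map_linear (coherent V) (coherent W)).
pose f (X : op R (P ** Q)) : C := N%:R^-1 * \sum_m \sum_m'
     \tr (rtens (V m) (W m) *m X *m (rtens (V m') (W m'))^t* ).
have l2 : linfunctional f.
  move=> a A B; rewrite /f mulrCA -mulrDr; congr (_ * _).
  rewrite mulr_sumr -big_split; apply: eq_bigr => m _ /=; rewrite mulr_sumr -big_split; apply: eq_bigr => m' _ /=.
  by rewrite mulmxDr mulmxDl mxtraceD -scalemxAr -scalemxAl mxtraceZ.
rewrite -/(f X) (linfunctionalE X l1) (linfunctionalE X l2).
apply: eq_bigr => -[x y] _; apply: eq_bigr => -[x' y'] _; congr (_ * _).
rewrite -tens_outer tens_map_tens // tr_maxent_tens; congr (_ * _).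
apply: eq_bigr => m _; apply: eq_bigr => m' _.
by rewrite !rent_mkrop rtens_adj !tensE !rtensM -tensE tr_tens.
Qed.

End MaximallyEntangled.

(** * The one-shot protocol *)

Section Protocol.
Variable R : realType.
Local Notation C := (complex R).
Implicit Types X Y Z : finType.

Lemma tens_mapDr X X' Y Y' (E : superop R X X') (F G : superop R Y Y') A :
  tens_map E (fun r => F r + G r) A = tens_map E F A + tens_map E G A.
Proof.
rewrite /tens_map; do 4 (rewrite -big_split; apply: eq_bigr => ? _ /=).
by rewrite (linmapD (tens_linear_r _)) scalerDr.
Qed.

Lemma tr_tens_swap X Y (M : op R X) (E : op R Y) (A : op R (Y ** X)) :
  \tr (tens M E *m relabel (fun p : X ** Y => (p.2, p.1) : Y ** X) A)
    = \tr (tens E M *m A).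
Proof.
rewrite -(tr_relabel (tens E M *m A) (swap_bij Y X)); congr (\tr _).
apply: rop_ext => p q; rewrite relabelE !rentM sum_prod exchange_big sum_prod /=.
apply: eq_bigr => y _; apply: eq_bigr => x _.
by rewrite relabelE !rent_rtens /= [rent M _ _ * _]mulrC.
Qed.

Lemma tensM X Y (A A' : op R X) (B B' : op R Y) :
  tens A B *m tens A' B' = tens (A *m A') (B *m B').
Proof. by rewrite !tensE rtensM. Qed.

Lemma tr_rot n (A B D : 'M[C]_n) : \tr (A *m (B *m D)) = \tr (D *m A *m B).
Proof. by rewrite mulmxA mxtrace_mulC mulmxA. Qed.

Section OneShot.
Variables (d1 d2 : nat) (SA SC SC' SB : finType).
Local Notation H1 := ((key d1 ** SA) ** (key d1 ** SC)).
Local Notation H2 := ((key d2 ** SC') ** (key d2 ** SB)).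
Local Notation HAB := ((key d1 ** SA) ** (key d2 ** SB)).
Local Notation HC := ((key d1 ** SC) ** (key d2 ** SC')).
Variables (gamma1 : op R H1) (gamma2 : op R H2).
Hypothesis d1_gt0 : (0 < d1)%N.
Hypothesis d2_gt0 : (0 < d2)%N.
Hypothesis irr1 : strictly_irreducible gamma1.
Hypothesis irr2 : strictly_irreducible gamma2.
Variables (I : finType) (M : I -> op R HC).
Hypothesis povmM : povm M.

Let G := gathered gamma1 gamma2.
Let X : op R (HC ** HAB) := relabel (@charlie_ab _ _ _ _) (tens gamma1 gamma2).

Let XE : X = relabel (fun p : HC ** HAB => (p.2, p.1) : HAB ** HC) G.
Proof. by apply: rop_ext => p q; rewrite !relabelE. Qed.

Let X_ge0 : psd X.
Proof.
apply: (@kraus_psd R _ _ (relabel (@charlie_ab _ _ _ _))).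
  apply: kraus_relabel => -[[a b] [c e]] [[a' b'] [c' e']].
  by rewrite /charlie_ab /= => -[-> -> -> ->].
by apply: psd_tens; [case: (private_density d1_gt0 irr1.1) |
  case: (private_density d2_gt0 irr2.1)].
Qed.

Let G_ge0 : psd G.
Proof.
have -> : G = relabel (fun p : HAB ** HC => (p.2, p.1) : HC ** HAB) X.
  by apply: rop_ext => -[x y] [x' y']; rewrite XE !relabelE.
apply: (@kraus_psd R _ _ (relabel (fun p : HAB ** HC => (p.2, p.1) : HC ** HAB))) => //.
by apply: kraus_relabel; apply: bij_inj; apply: swap_bij.
Qed.

Let tr_G : \tr G = 1.
Proof.
rewrite /G /gathered (tr_relabel (tens gamma1 gamma2)); last first.
  by exists (fun p => ((p.1.1, p.2.2), (p.1.2, p.2.1))) => -[[? ?] [? ?]].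
rewrite tr_tens; case: (private_density d1_gt0 irr1.1) => _ ->.
by case: (private_density d2_gt0 irr2.1) => _ ->; rewrite mulr1.
Qed.

Local Notation ZC c := (signop c : op R HC).
Local Notation ZA c := (signop c : op R HAB).

Lemma sign_transfer c :
  tens (ZC c) (1%:M : op R HAB) *m X = tens (1%:M : op R HC) (ZA c) *m X.
Proof.
have dl : tens (ZC c) (1%:M : op R HAB) = diagop (fun p => sgn c p.1).
  apply: rop_ext => -[x y] [x' y']; rewrite rent_rtens !rent_mkrop rent1 /=.
  by rewrite xpair_eqE -mulnb natrM; ring.
have dr : tens (1%:M : op R HC) (ZA c) = diagop (fun p => sgn c p.2).
  apply: rop_ext => -[x y] [x' y']; rewrite rent_rtens !rent_mkrop rent1 /=.
  by rewrite xpair_eqE -mulnb natrM; ring.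
rewrite dl dr; apply: rop_ext => p q.
apply: etrans (rent_diagopM _ X p q) _.
apply: etrans _ (esym (rent_diagopM _ X p q)); rewrite XE relabelE.
by case: (gathered_sgn irr1.1 irr2.1 c (p.2, p.1) (q.2, q.1)).
Qed.

(** Moving Charlie's sign to AB leaves the same b for every message on his side and completes the
    decoder to [ZA (s m) *m K m *m ZA (s m)]. All messages thus interfere in the single average B,
    and b^* b restores [M k]. *)
Lemma fidelity_outcome N' (k : I) (b : op R HC) (s : 'I_N'.+1 -> signs d1 d2)
    (K : 'I_N'.+1 -> op R HAB) (w : C) : 0 <= w -> M k = b^t* *m b ->
  let B := N'.+1%:R^-1 *: \sum_m ZA (s m) *m K m *m ZA (s m) in
  \tr (maxent N'.+1 *m tens_map (coherent (fun m => sqrtC w *: (b *m ZC (s m))))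
     (coherent (fun m => ZA (s m) *m K m)) X)
  = w * N'.+1%:R * \tr (B^t* *m B *m marg (M k) G).
Proof.
move=> w0 eM B.
have sw : sqrtC w * (sqrtC w)^* = w.
  by rewrite conj_Creal ?ger0_real ?sqrtC_ge0 // -expr2 sqrtCK.
pose Bm m := ZA (s m) *m K m *m ZA (s m).
have left m : rtens (sqrtC w *: (b *m ZC (s m)) : rop R _ _) (ZA (s m) *m K m : rop R _ _) *m X
    = sqrtC w *: (tens b (Bm m) *m X).
  rewrite -tensE (linmapZ (tens_linear_l _)) -scalemxAl; congr (_ *: _).
  have -> : tens (b *m ZC (s m)) (ZA (s m) *m K m)
     = tens b (ZA (s m) *m K m) *m tens (ZC (s m)) 1%:M.
    by rewrite tensM mulmx1.
  by rewrite -mulmxA sign_transfer mulmxA tensM mulmx1.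
have right m : X *m (rtens (sqrtC w *: (b *m ZC (s m)) : rop R _ _)
     (ZA (s m) *m K m : rop R _ _))^t* = (sqrtC w)^* *: (X *m (tens b (Bm m))^t* ).
  have := congr1 (fun A : op R _ => A^t*) (left m).
  by rewrite adjmxM adjmxZ adjmxM (psdmx_adj X_ge0).
rewrite tr_maxent_coherent.
have e m m' : \tr (rtens (sqrtC w *: (b *m ZC (s m)) : rop R _ _) (ZA (s m) *m K m : rop R _ _)
    *m X *m (rtens (sqrtC w *: (b *m ZC (s m')) : rop R _ _) (ZA (s m') *m K m' : rop R _ _))^t* )
   = w * \tr ((Bm m')^t* *m Bm m *m marg (M k) G).
  rewrite left -scalemxAl -(mulmxA _ X) right -!scalemxAr !mxtraceZ mulrA sw.
  congr (_ * _); rewrite (tr_rot _ X).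
  have -> : (tens b (Bm m'))^t* *m tens b (Bm m) = tens (M k) ((Bm m')^t* *m Bm m).
    rewrite eM -tensM; congr (_ *m _).
    exact: rtens_adj.
  rewrite XE (tr_tens_swap (M k) _ G).
  exact: esym (tr_marg _ _ _).
under eq_bigr do under eq_bigr do rewrite e.
have eB : B = N'.+1%:R^-1 *: \sum_m Bm m by [].
have -> : \tr (B^t* *m B *m marg (M k) G) = N'.+1%:R^-1 * N'.+1%:R^-1 *
    \sum_m \sum_m' \tr ((Bm m')^t* *m Bm m *m marg (M k) G).
  rewrite eB adjmxZ rmorphV ?unitfE ?pnatr_eq0 //= conjC_nat adjmx_sum.
  rewrite -!scalemxAl -!scalemxAr -!scalemxAl !mxtraceZ -mulrA; congr (_ * (_ * _)).
  rewrite exchange_big mulmx_suml mulmx_suml raddf_sum /=; apply: eq_bigr => m _.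
  rewrite mulmx_sumr mulmx_suml raddf_sum /=; apply: eq_bigr => m' _.
  done.
under eq_bigr do rewrite -mulr_sumr.
rewrite -mulr_sumr; have : N'.+1%:R != 0 :> C by rewrite pnatr_eq0.
by move: (_%:R) => u nu; field.
Qed.

(** An announcement pairs Charlie's outcome with the code, and the bound concerns the sum over both,
    so no single code has to suit every outcome. The weight t and the number of messages stay free
    until the target error is known. *)
Lemma swap_to_distill (d : nat) (TA TB : finType)
    (gamma : op R ((key d ** TA) ** (key d ** TB)))
    (L : superop R (((key d1 ** SA) ** I) ** ((key d2 ** SB) ** I))
                   ((key d ** TA) ** (key d ** TB))) (N' : nat) (t : C) :
  (0 < d)%N -> private_state gamma -> locc L -> 0 < t ->
  let e := (trnorm (L (charlie_measure M (tens gamma1 gamma2)) - gamma))%:C%C in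
  exists (J : finType) (E : J -> superop R HC (key N'.+1))
    (D : J -> superop R HAB (key N'.+1)),
    [/\ instrument E, forall j, channel (D j) &
      1 - 2 * e - 2 * t - t^-1 * e - t^-1 * (N'%:R / d%:R)
        <= \sum_j \tr (maxent N'.+1 *m tens_map (E j) (D j) X)].
Proof.
move=> d0 pg hL t0 e; set N := N'.+1.
have [pM M1] := povmM.
have [T [pT T1 Tg Tprod]] := private_test d0 pg.
have [F [F0 F1 FL Fprod]] := outcome_effects M hL pT T1 Tprod.
pose omega k := marg (M k) G.
pose omega' k := marg (M k) (gathered (key_attacked gamma1) (key_attacked gamma2)).
have om0 k : psd (omega k) by exact: (kraus_psd (kraus_marg _ (pM k)) G_ge0).
pose Z := fun c : signs d1 d2 => ZA c.
have tw k c : \sum_c' Z c' *m (Z c *m omega k *m Z c) *m Z c'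
    = #|signs d1 d2|%:R *: omega' k.
  by apply: signop_twirl => p q; apply: (marg_attacked irr1.1 irr2.1).
have CF k := code_fidelity (signs_gt0 d1 d2) (@signop_adj _ _ _ _ _)
  (@signop_sqr _ _ _ _ _) (F0 k) (F1 k) (om0 k) (tw k) N' t0.
have [K KP] := choice CF.
have [b bP] := choice (fun k => psdmx_factor (pM k)).
(* A square root of what the decoder's Kraus operators lack to sum to 1. *)
have [q qP] := choice (fun ks : I * {ffun 'I_N -> signs d1 d2} =>
  psdmx_factor ((KP ks.1).1 ks.2)).
pose ns : C := #|{: {ffun 'I_N -> signs d1 d2}}|%:R.
have ns0 : ns != 0.
  by rewrite pnatr_eq0 -lt0n card_ffun expn_gt0 signs_gt0.
(* One over the number of codes, times 1/N for the uniform superposition of messages. *)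
pose w : C := (ns * N%:R)^-1.
have w0 : 0 <= w by rewrite invr_ge0 mulr_ge0 ?ler0n.
have sw : (sqrtC w)^* * sqrtC w = w.
  by rewrite conj_Creal ?ger0_real ?sqrtC_ge0 // -expr2 sqrtCK.
pose J : finType := (I * {ffun 'I_N -> signs d1 d2})%type.
pose E (j : J) := coherent (fun m : 'I_N => sqrtC w *: (b j.1 *m ZC (j.2 m)) : rop R HC HC).
pose D0 (j : J) := coherent (fun m : 'I_N => ZA (j.2 m) *m K j.1 j.2 m : rop R HAB HAB).
(* D1 only completes D0 to a channel: it adds a nonnegative amount to the
   fidelity. *)
pose D1 (j : J) := coherent (fun m : 'I_N => (m == ord0)%:R *: q j : rop R HAB HAB).
pose D (j : J) := fun r => D0 j r + D1 j r.
have kD j : kraus (D j) by apply: kraus_add; apply: kraus_coherent.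
exists J, E, D; split.
- split; first by move=> j; apply/kraus_cp/kraus_coherent.
  move=> r; rewrite raddf_sum /=.
  under eq_bigr do rewrite tr_coherent.
  have eE (j : J) : \sum_m (sqrtC w *: (b j.1 *m ZC (j.2 m)))^t* *m (sqrtC w *: (b j.1 *m ZC (j.2 m)))
     = w *: \sum_(m < N) ZC (j.2 m) *m M j.1 *m ZC (j.2 m).
    rewrite scaler_sumr; apply: eq_bigr => m _.
    rewrite adjmxZ -scalemxAl -scalemxAr scalerA sw adjmxM signop_adj.
    by rewrite bP !mulmxA.
  under eq_bigr do rewrite eE.
  rewrite -raddf_sum -mulmx_suml -scaler_sumr.
  rewrite -(pair_bigA _ (fun k (s : {ffun 'I_N -> signs d1 d2}) =>
    \sum_(m < N) ZC (s m) *m M k *m ZC (s m))) /=.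
  rewrite exchange_big /=.
  under eq_bigr => s _.
    rewrite exchange_big /=.
    under eq_bigr do rewrite -mulmx_suml -mulmx_sumr M1 mulmx1 signop_sqr.
    over.
  rewrite !sumr_const card_ord -scaler_nat -[_ *+ N]scaler_nat !scalerA.
  have -> : w * #|{: {ffun 'I_N -> signs d1 d2}}|%:R * N%:R = 1.
    by rewrite -mulrA mulVf // mulf_neq0 // pnatr_eq0.
  by rewrite scale1r mul1mx.
- move=> j; split; first exact: kraus_cp.
  move=> r; rewrite /D linearD /= !tr_coherent -mxtraceD -mulmxDl.
  have -> : \sum_m (ZA (j.2 m) *m K j.1 j.2 m)^t* *m (ZA (j.2 m) *m K j.1 j.2 m)
      = \sum_m (K j.1 j.2 m)^t* *m K j.1 j.2 m.
    apply: eq_bigr => m _; rewrite adjmxM signop_adj -!mulmxA (mulmxA (ZA _)).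
    by rewrite signop_sqr mul1mx.
  have -> : \sum_(m < N) ((m == ord0)%:R *: q j)^t* *m ((m == ord0)%:R *: q j)
      = (q j)^t* *m q j.
    rewrite (bigD1 ord0) //= big1 ?addr0 ?eqxx ?scale1r // => m /negPf ->.
    by rewrite scale0r mulmx0.
  by rewrite -qP addrC subrK mul1mx.
pose B k (s : {ffun 'I_N -> signs d1 d2}) :=
  N%:R^-1 *: \sum_m ZA (s m) *m K k s m *m ZA (s m).
have split_le (u v y : C) : u = y -> 0 <= v -> y <= u + v.
  by move=> ->; rewrite lerDl.
have lowF : \sum_k (ns^-1 * \sum_s \tr ((B k s)^t* *m B k s *m omega k))
    <= \sum_(j : J) \tr (maxent N *m tens_map (E j) (D j) X).
  under eq_bigr do rewrite mulr_sumr.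
  rewrite pair_bigA /=; apply: ler_sum => j _.
  have -> : tens_map (E j) (D j) X = tens_map (E j) (D0 j) X + tens_map (E j) (D1 j) X.
    exact: tens_mapDr.
  rewrite mulmxDr mxtraceD.
  have fid : \tr (maxent N *m tens_map (E j) (D0 j) X)
      = w * N%:R * \tr ((B j.1 j.2)^t* *m B j.1 j.2 *m omega j.1).
    exact: (fidelity_outcome _ _ w0 (bP j.1)).
  have wN : w * N%:R = ns^-1 by rewrite /w invfM mulfVK // pnatr_eq0.
  rewrite wN in fid; apply: (split_le _ _ _ fid).
  apply: (psdmx_trM_ge0 (@maxent_psd R N)).
  apply: (kraus_psd _ X_ge0).
  exact: kraus_tens_map (kraus_coherent _) (kraus_coherent _).
apply: le_trans lowF.
(* The bound of each outcome is linear in its unnormalised state, so only the total acceptance p of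
   the true pair and x of the attacked pair remain. *)
apply: (le_trans _ (ler_sum _ (fun k _ => (KP k).2))).
pose p := \sum_k \tr (F k *m omega k).
pose x := \sum_k \tr (F k *m omega' k).
have tom : \sum_k \tr (omega k) = 1 by rewrite sum_tr_marg // tr_G.
have -> : \sum_k (2 * \tr (F k *m omega k) - 2 * t * \tr (omega k)
     - t^-1 * (\tr (omega k) - \tr (F k *m omega k))
     - t^-1 * (N'%:R * \tr (F k *m omega' k)) - \tr (omega k))
   = 2 * p - 2 * t - t^-1 * (1 - p) - t^-1 * (N'%:R * x) - 1.
  by rewrite !sumrB -!mulr_sumr sumrB tom mulr1.
have xd : x <= d%:R^-1.
  apply: (separable_swap_bound _ povmM irr1.2 irr2.2 Fprod).
  by rewrite invr_ge0 ler0n.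
(* The test accepts gamma with certainty, and the protocol's output differs from gamma by e in trace
   norm. *)
have pe : 1 - e <= p.
  have ef : effect (fun r => \tr (T *m r)).
    split; first by apply: (@linfunctional_tr R _ _ (fun r => r)) => a r r'.
    move=> r pr; apply/andP; split; first exact: (psdmx_trM_ge0 pT pr).
    by have := psdmx_trM_le pr T1; rewrite mulmx1 mxtrace_mulC.
  have := effect_trnorm (L (charlie_measure M (tens gamma1 gamma2)) - gamma) ef.
  rewrite -/e mulmxBr linearB /= Tg.
  have -> : \tr (T *m L (charlie_measure M (tens gamma1 gamma2))) = p.
    by rewrite /p FL.
  have pr : p - 1 \is Num.real.
    rewrite realB ?real1 // ger0_real //; apply: sumr_ge0 => k _.
    exact: (psdmx_trM_ge0 (F0 k) (om0 k)).
  by rewrite (Creal_ReP _ pr) lerBrDr addrC.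
have t1 : 0 <= t^-1 by rewrite invr_ge0 ltW.
have a1 : t^-1 * (N'%:R * x) <= t^-1 * (N'%:R / d%:R).
  by apply: ler_wpM2l => //; apply: ler_wpM2l => //; apply: ler0n.
have a2 : t^-1 * (1 - p) <= t^-1 * e.
  by apply: ler_wpM2l => //; rewrite lerBlDr -lerBlDl.
have a3 : 2 * (1 - e) <= 2 * p by apply: ler_wpM2l.
have := lerB (lerB (lerB a3 (lexx (2 * t))) a2) a1.
rewrite -(lerD2r (- 1)); congr (_ <= _); ring.
Qed.

End OneShot.
End Protocol.

(** * Composing with the initial distillation *)

Section Composition.
Variable R : realType.
Local Notation C := (complex R).
Implicit Types X Y Z : finType.

Lemma maxent_le1 N' : psd (1%:M - maxent N'.+1 : op R _).
Proof.
have QQ : maxent N'.+1 *m maxent N'.+1 = maxent N'.+1 :> op R _.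
  by have := maxent_compress (1%:M : op R (key N'.+1 ** key N'.+1));
    rewrite !mulmx1 tr_maxent scale1r.
have aQ := psdmx_adj (@maxent_psd R N'.+1).
have := psdmx_gram (1%:M - maxent N'.+1 : op R _); congr psdmx.
rewrite adjmxB adjmx1 aQ mulmxBr mulmx1 mulmxBl mul1mx QQ.
by rewrite subrr subr0.
Qed.

(** Here F bounds the infidelity, so it takes the place of 1 - F in [trace_sqrtmx_sub_proj]. *)
Lemma trnorm_sub_maxent N' (r : op R (key N'.+1 ** key N'.+1)) (F t : R) :
  psd r -> \tr r = 1 -> 0 < t -> (1 - F)%:C%C <= \tr (maxent N'.+1 *m r) ->
  trnorm (r - maxent N'.+1) <= 2 * F + t^-1 * F + t.
Proof.
move=> pr tr1 t0 hF.
have pQ := @maxent_psd R N'.+1.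
have QQ : maxent N'.+1 *m maxent N'.+1 = maxent N'.+1 :> op R _.
  by have := maxent_compress (1%:M : op R (key N'.+1 ** key N'.+1));
    rewrite !mulmx1 tr_maxent scale1r.
have t0c : 0 < t%:C%C by rewrite ltcR.
have h := trace_sqrtmx_sub_proj pr tr1 (psdmx_adj pQ) QQ (tr_maxent _ _)
  (maxent_compress r) t0c.
rewrite -lecR -[X in X <= _](Creal_ReP _ _) ?complex_real ?eqxx // trnormE.
apply: (le_trans h).
have F1 : 1 - \tr (maxent N'.+1 *m r) <= F%:C%C.
  by move: hF; rewrite rmorphB rmorph1 lerBlDr addrC -lerBlDr.
rewrite !rmorphD !rmorphM /= rmorph_nat fmorphV.
rewrite lerD2r; apply: lerD; apply: ler_wpM2l => //.
by rewrite invr_ge0 ltW.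
Qed.

Lemma tens_map_comp X X1 X2 Y Y1 Y2 (E1 : superop R X X1) (E2 : superop R X1 X2)
    (F1 : superop R Y Y1) (F2 : superop R Y1 Y2) A :
  linear E2 -> linear F2 ->
  tens_map (fun r => E2 (E1 r)) (fun r => F2 (F1 r)) A
    = tens_map E2 F2 (tens_map E1 F1 A).
Proof.
move=> lE lF; move: A; apply: linmap_ext; first exact: tens_map_linear.
  by move=> a A B; rewrite !tens_map_linear.
by move=> [x y] [x' y']; rewrite !tens_map_outer tens_map_tens.
Qed.

Lemma tens_map_relabel X X' Y Y' (f : X' -> X) (g : Y' -> Y) (A : op R (X ** Y)) :
  tens_map (relabel f) (relabel g) A
    = relabel (fun p : X' ** Y' => (f p.1, g p.2) : X ** Y) A.
Proof.
move: A; apply: op_tens_ext; [exact: tens_map_linear|exact: relabel_linear|].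
move=> a b; rewrite tens_map_tens; [|exact: relabel_linear|exact: relabel_linear].
by apply: rop_ext => p q; rewrite relabelE !rent_rtens !relabelE.
Qed.

Lemma tens_map_charlie_ab (A A1 B B1 K K1 K' K1' : finType)
    (DA : superop R A A1) (EK : superop R K K1)
    (EK' : superop R K' K1') (DB : superop R B B1)
    (a : op R (A ** K)) (b : op R (K' ** B)) :
  linear DA -> linear EK -> linear EK' -> linear DB ->
  tens_map (tens_map EK EK') (tens_map DA DB) (relabel (@charlie_ab _ _ _ _) (tens a b))
    = relabel (@charlie_ab _ _ _ _) (tens (tens_map DA EK a) (tens_map EK' DB b)).
Proof.
move=> lA lK lK' lB.
have shuffle A0 B0 K0 K0' (x : op R A0) (y : op R K0) (z : op R K0') (w : op R B0) :
    relabel (@charlie_ab _ _ _ _) (tens (tens x y) (tens z w))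
    = tens (tens y z) (tens x w).
  by apply: rop_ext => p q; rewrite relabelE !rent_rtens /=; ring.
have l1 c : linear (fun a => tens_map (tens_map EK EK') (tens_map DA DB)
    (relabel (@charlie_ab _ _ _ _) (tens a c))).
  by move=> s u v; rewrite tens_linear_l relabel_linear tens_map_linear.
have l2 c : linear (fun b => tens_map (tens_map EK EK') (tens_map DA DB)
    (relabel (@charlie_ab _ _ _ _) (tens c b))).
  by move=> s u v; rewrite tens_linear_r relabel_linear tens_map_linear.
have l3 c : linear (fun a => relabel (@charlie_ab _ _ _ _)
    (tens (tens_map DA EK a) (tens_map EK' DB c))).
  by move=> s u v; rewrite tens_map_linear tens_linear_l relabel_linear.
have l4 c : linear (fun b => relabel (@charlie_ab _ _ _ _)
    (tens (tens_map DA EK c) (tens_map EK' DB b))).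
  by move=> s u v; rewrite tens_map_linear tens_linear_r relabel_linear.
apply: (op_tens_ext (l1 b) (l3 b)) => x y.
apply: (op_tens_ext (l2 (tens x y)) (l4 (tens x y))) => z w.
by rewrite shuffle !tens_map_tens ?shuffle //; apply: tens_map_linear.
Qed.

(** Distillation receives n copies of a pair, while the two initial protocols each expect n copies
    of one member. *)
Definition zip_copies n X Y (p : copies n X ** copies n Y) : copies n (X ** Y) :=
  [ffun k => (p.1 k, p.2 k)].

Lemma zip_copies_bij n X Y : bijective (@zip_copies n X Y).
Proof.
exists (fun f : copies n (X ** Y) => ([ffun k => (f k).1], [ffun k => (f k).2])).
  by move=> [f g]; rewrite /zip_copies; congr pair; apply/ffunP => k; rewrite !ffunE.
by move=> f; apply/ffunP => k; rewrite !ffunE /=; case: (f k).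
Qed.

Lemma tpow_charlie n (A B K K' : finType) (rho : op R (A ** K)) (rho' : op R (K' ** B)) :
  relabel (fun p : (copies n K ** copies n K') ** (copies n A ** copies n B) =>
      (zip_copies p.1, zip_copies p.2) : copies n (K ** K') ** copies n (A ** B))
    (tpow n (charlie_vs_ab rho rho'))
  = relabel (@charlie_ab _ _ _ _) (tens (tpow n rho) (tpow n rho')).
Proof.
apply: rop_ext => p q; rewrite !relabelE rent_rtens !rent_mkrop -big_split.
apply: eq_bigr => k _ /=; rewrite !ffunE /=.
by rewrite entE relabelE rent_rtens.
Qed.

Lemma tpow_density n (A B : finType) (rho : op R (A ** B)) :
  density rho -> density (tpow n rho).
Proof.
move=> [/psdmx_factor[b eb] tr1]; split.
  (* The n-fold tensor power of the factor b of rho. *)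
  pose c : 'M[C]_(#|{ffun 'I_n -> 'I_#|A ** B|}|, #|copies n A ** copies n B|) :=
    \matrix_(i, j) \prod_k b ((enum_val i : {ffun 'I_n -> 'I_#|A ** B|}) k) (enum_rank
      (((enum_val j : copies n A ** copies n B).1 k,
        (enum_val j : copies n A ** copies n B).2 k) : A ** B)).
  have -> : tpow n rho = c^t* *m c; last exact: psdmx_gram.
  apply: rop_ext => p q; rewrite rent_mkrop [RHS]/rent mxE.
  rewrite (big_enum_rank (X := {ffun 'I_n -> 'I_#|A ** B|})).
  under [RHS]eq_bigr do rewrite !mxE !enum_rankK rmorph_prod -big_split /=.
  rewrite -(bigA_distr_bigA (fun k i =>
    (b i (enum_rank ((p.1 k, p.2 k) : A ** B)))^* *
    b i (enum_rank ((q.1 k, q.2 k) : A ** B)))) /=.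
  apply: eq_bigr => k _; rewrite entE eb /rent mxE.
  by apply: eq_bigr => j _; rewrite !mxE.
rewrite trE sum_prod.
under eq_bigr do under eq_bigr do rewrite rent_mkrop /=.
under eq_bigr do rewrite -(bigA_distr_bigA (fun k y => ent rho (_ k, y) (_ k, y))).
rewrite -(bigA_distr_bigA (fun k x => \sum_y ent rho (x, y) (x, y))) /=.
rewrite big1 // => k _.
by rewrite -tr1 trE sum_prod.
Qed.

End Composition.

(** * Fidelity of a one-way protocol as a function of its inputs *)

Section Distillation.
Variable R : realType.
Local Notation C := (complex R).
Implicit Types X Y Z : finType.

Lemma charlie_ab_bij (X Y Z W : Type) : bijective (@charlie_ab X Y Z W).
Proof.
by exists (fun p => ((p.1.2, p.2.1), (p.1.1, p.2.2))) => -[[? ?] [? ?]].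
Qed.

Lemma psd_charlie_ab (A B K K' : finType) (a : op R (A ** K)) (b : op R (K' ** B)) :
  psd a -> psd b -> psd (relabel (@charlie_ab A B K K') (tens a b)).
Proof.
move=> pa pb; apply: (@kraus_psd R _ _ (relabel (@charlie_ab A B K K'))).
  by apply: kraus_relabel; apply: bij_inj; apply: charlie_ab_bij.
exact: psd_tens.
Qed.

Lemma tr_charlie_ab (A B K K' : finType) (a : op R (A ** K)) (b : op R (K' ** B)) :
  \tr (relabel (@charlie_ab A B K K') (tens a b)) = \tr a * \tr b.
Proof. by rewrite (tr_relabel _ (@charlie_ab_bij _ _ _ _)) tr_tens. Qed.

Section Fidelity.
Variables (A B K K' : finType) (N' : nat) (J : finType).
Variables (E : J -> superop R (K ** K') (key N'.+1)).
Variables (D : J -> superop R (A ** B) (key N'.+1)).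
Hypothesis instrE : instrument E.
Hypothesis chanD : forall j, channel (D j).

Definition fidelity (a : op R (A ** K)) (b : op R (K' ** B)) : C :=
  \sum_j \tr (maxent N'.+1 *m
    tens_map (E j) (D j) (relabel (@charlie_ab _ _ _ _) (tens a b))).

Lemma oneway_psd_tr (X : op R ((K ** K') ** (A ** B))) : psd X ->
  psd (\sum_j tens_map (E j) (D j) X) /\
  \tr (\sum_j tens_map (E j) (D j) X) = \tr X.
Proof.
move=> pX; split.
  apply: psdmx_sum => j; apply: (kraus_psd _ pX); apply: kraus_tens_map.
    by apply: cp_kraus; apply: instrE.1.
  exact: channel_kraus.
rewrite raddf_sum /= tr_tens_map // => [r|j r]; first exact: instrument_tr.
by case: (chanD j).
Qed.

Lemma fidelity_bounds a b : psd a -> psd b ->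
  0 <= fidelity a b <= \tr a * \tr b.
Proof.
move=> pa pb; have [pX tX] := oneway_psd_tr (psd_charlie_ab pa pb).
rewrite -tr_charlie_ab -tX /fidelity -raddf_sum -mulmx_sumr /=.
apply/andP; split; first exact: (psdmx_trM_ge0 (@maxent_psd R _) pX).
by have := psdmx_trM_le pX (@maxent_le1 R N'); rewrite mulmx1 mxtrace_mulC.
Qed.

Lemma fidelity_effect_l b : density b -> effect (fun a => fidelity a b).
Proof.
move=> [pb tb]; split.
  move=> s u v; rewrite /fidelity mulr_sumr -big_split; apply: eq_bigr => j _ /=.
  by rewrite tens_linear_l relabel_linear tens_map_linear mulmxDr -scalemxAr
    mxtraceD mxtraceZ.
by move=> a pa; have := fidelity_bounds pa pb; rewrite tb mulr1.
Qed.

Lemma fidelity_effect_r a : density a -> effect (fidelity a).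
Proof.
move=> [pa ta]; split.
  move=> s u v; rewrite /fidelity mulr_sumr -big_split; apply: eq_bigr => j _ /=.
  by rewrite tens_linear_r relabel_linear tens_map_linear mulmxDr -scalemxAr
    mxtraceD mxtraceZ.
by move=> b pb; have := fidelity_bounds pa pb; rewrite ta mul1r.
Qed.

(** With one argument a state, the fidelity is an effect in the other, so the two approximate
    private states are replaced one at a time, each at the cost of its trace norm error. *)
Lemma fidelity_continuity a a' b b' : density a -> density a' ->
  density b -> density b' ->
  fidelity a' b' - (trnorm (a - a'))%:C%C - (trnorm (b - b'))%:C%C <= fidelity a b.
Proof.
move=> da da' db db'.
have r u v : density u -> density v -> fidelity u v \is Num.real.
  move=> du dv; apply: ger0_real.
  by have /andP[] := fidelity_bounds du.1 dv.1.
have sub (X : finType) (f : op R X -> C) u v : effect f ->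
    f u \is Num.real -> f v \is Num.real -> f v - (trnorm (u - v))%:C%C <= f u.
  move=> ef ru rv; have := effect_trnorm (u - v) ef.
  have -> : f (u - v) = f u - f v.
    by rewrite addrC -scaleN1r ef.1 mulN1r addrC.
  rewrite (Creal_ReP _ _) ?realB // => h.
  by rewrite lerBlDr -lerBlDl -lerN2 opprB.
have h1 := sub _ _ b b' (fidelity_effect_r da') (r _ _ da' db) (r _ _ da' db').
have h2 := sub _ _ a a' (fidelity_effect_l db) (r _ _ da db) (r _ _ da' db).
apply: le_trans h2; rewrite addrAC lerD2r; exact: h1.
Qed.

End Fidelity.

Lemma channel_comp X Y Z (E : superop R X Y) (F : superop R Y Z) :
  channel E -> channel F -> channel (fun r => F (E r)).
Proof.
move=> [cE tE] [cF tF]; split=> [|r]; last by rewrite tF tE.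
by apply: kraus_cp; apply: kraus_comp; apply: cp_kraus.
Qed.

Lemma channel_tens X X' Y Y' (E : superop R X X') (F : superop R Y Y') :
  channel E -> channel F -> channel (tens_map E F).
Proof.
move=> [cE tE] [cF tF]; split.
  by apply: kraus_cp; apply: kraus_tens_map; apply: cp_kraus.
move=> r; have := @tr_tens_map R _ _ _ _ unit (fun _ => E) (fun _ => F) r.
rewrite big_const card_unit /= addr0; apply=> // x.
by rewrite big_const card_unit /= addr0.
Qed.

Lemma channel_relabel X Y (f : Finite.sort Y -> Finite.sort X) : bijective f ->
  channel (relabel f : superop R X Y).
Proof.
move=> bf; split=> [|r]; last exact: tr_relabel.
by apply/kraus_cp/kraus_relabel/bij_inj.
Qed.

Lemma instrument_tens X X' Y Y' (I I' : finType) (E : I -> superop R X X')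
    (F : I' -> superop R Y Y') : instrument E -> instrument F ->
  instrument (fun p : I * I' => tens_map (E p.1) (F p.2)).
Proof.
move=> hE hF; split.
  by move=> [i i']; apply/kraus_cp/kraus_tens_map; apply: cp_kraus;
    [apply: hE.1 | apply: hF.1].
move=> r; rewrite raddf_sum /= -(pair_bigA _ (fun i i' => \tr (tens_map (E i) (F i') r))).
have l1 : linfunctional (fun r => \sum_i \sum_i' \tr (tens_map (E i) (F i') r)).
  move=> a u v; rewrite mulr_sumr -big_split; apply: eq_bigr => i _ /=.
  rewrite mulr_sumr -big_split; apply: eq_bigr => i' _ /=.
  by rewrite tens_map_linear mxtraceD mxtraceZ.
have l2 : linfunctional (fun r : op R (X ** Y) => \tr r).
  by move=> a u v; rewrite mxtraceD mxtraceZ.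
rewrite (linfunctionalE r l1) (linfunctionalE r l2).
apply: eq_bigr => -[x y] _; apply: eq_bigr => -[x' y'] _; congr (_ * _).
under eq_bigr do under eq_bigr do rewrite tens_map_outer tr_tens.
rewrite -big_distrlr /= !instrument_tr // -tr_tens.
by rewrite tens_outer.
Qed.

Lemma instrument_comp X Y Z (I J : finType) (E : I -> superop R X Y)
    (F : J -> superop R Y Z) : instrument E -> instrument F ->
  instrument (fun p : I * J => fun r => F p.2 (E p.1 r)).
Proof.
move=> hE hF; split.
  by move=> [i j]; apply/kraus_cp/kraus_comp; apply: cp_kraus;
    [apply: hE.1 | apply: hF.1].
move=> r; rewrite raddf_sum /= -(pair_bigA _ (fun i j => \tr (F j (E i r)))) /=.
by under eq_bigr do rewrite instrument_tr //; rewrite instrument_tr.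
Qed.

Lemma instrument_precomp X Y Z (J : finType) (E : superop R X Y)
    (F : J -> superop R Y Z) : channel E -> instrument F ->
  instrument (fun j r => F j (E r)).
Proof.
move=> [cE tE] hF; split.
  by move=> j; apply/kraus_cp/kraus_comp; apply: cp_kraus => //; apply: hF.1.
by move=> r; rewrite raddf_sum /= instrument_tr.
Qed.

End Distillation.

(** * The complete one-way protocol *)

Section Assembly.
Variable R : realType.
Local Notation C := (complex R).
Implicit Types X Y Z : finType.

Section Compose.
Variables (A A1 B B1 K K1 K' K1' : finType) (N n : nat) (J : finType).
Variables (rho : op R (A ** K)) (rho' : op R (K' ** B)).
Variables (G : superop R (copies n A ** copies n K) (A1 ** K1)).
Variables (G' : superop R (copies n K' ** copies n B) (K1' ** B1)).
Variables (E : J -> superop R (K1 ** K1') (key N)).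
Variables (D : J -> superop R (A1 ** B1) (key N)).
Hypothesis oneG : oneway_rl G.
Hypothesis oneG' : oneway_lr G'.
Hypothesis instrE : instrument E.
Hypothesis chanD : forall j, channel (D j).

(** In [G] and in [G'] it is Charlie's side that announces. The labels of both, followed by j, are
    therefore a single announcement by Charlie, and the receiver reacts with the channels of A and B
    and then with [D j]. *)
Lemma oneway_compose : exists L : superop R
    (copies n (K ** K') ** copies n (A ** B)) (key N ** key N),
  oneway_lr L /\
  L (tpow n (charlie_vs_ab rho rho'))
    = \sum_j tens_map (E j) (D j)
        (relabel (@charlie_ab _ _ _ _) (tens (G (tpow n rho)) (G' (tpow n rho')))).
Proof.
case: oneG => I1 [DA [EK [chA insK eG]]].
case: oneG' => I2 [EK' [DB [insK' chB eG']]].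
pose I : finType := ((I1 * I2) * J)%type.
pose Et (i : I) : superop R (copies n (K ** K')) (key N) :=
  fun r => E i.2 (tens_map (EK i.1.1) (EK' i.1.2) (relabel (@zip_copies n K K') r)).
pose Dt (i : I) : superop R (copies n (A ** B)) (key N) :=
  fun r => D i.2 (tens_map (DA i.1.1) (DB i.1.2) (relabel (@zip_copies n A B) r)).
exists (fun r => \sum_i tens_map (Et i) (Dt i) r); split.
  exists I, Et, Dt; split=> //.
    apply: (instrument_precomp (channel_relabel R (@zip_copies_bij n K K'))
      (instrument_comp (instrument_tens insK insK') instrE)).
  move=> i; exact: (channel_comp (channel_relabel R (@zip_copies_bij n A B))
    (channel_comp (channel_tens (chA i.1.1) (chB i.1.2)) (chanD i.2))).
have linE j : linear (E j) by apply: (instrE.1 j).1.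
have linD j : linear (D j) by apply: (chanD j).1.1.
have linK i : linear (EK i) by apply: (insK.1 i).1.
have linK' i : linear (EK' i) by apply: (insK'.1 i).1.
have linA i : linear (DA i) by apply: (chA i).1.1.
have linB i : linear (DB i) by apply: (chB i).1.1.
pose f (a : op R (A1 ** K1)) (b : op R (K1' ** B1)) :=
  \sum_j tens_map (E j) (D j) (relabel (@charlie_ab _ _ _ _) (tens a b)).
have lf1 b : linear (fun a => f a b).
  move=> s u v; rewrite /f scaler_sumr -big_split; apply: eq_bigr => j _ /=.
  by rewrite tens_linear_l relabel_linear tens_map_linear.
have lf2 a : linear (f a).
  move=> s u v; rewrite /f scaler_sumr -big_split; apply: eq_bigr => j _ /=.
  by rewrite tens_linear_r relabel_linear tens_map_linear.
rewrite -/(f _ _) eG eG' (linmap_sum (lf1 _)).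
under [RHS]eq_bigr do rewrite (linmap_sum (lf2 _)).
pose g p j := tens_map (Et (p, j)) (Dt (p, j)) (tpow n (charlie_vs_ab rho rho')).
transitivity (\sum_p \sum_j g p j).
  by rewrite (pair_bigA _ g) /g; apply: eq_bigr => -[p j].
transitivity (\sum_i \sum_i' \sum_j g (i, i') j).
  rewrite (pair_bigA _ (fun i i' => \sum_j g (i, i') j)).
  by apply: eq_bigr => -[i i'].
apply: eq_bigr => i _; apply: eq_bigr => i' _; rewrite /f; apply: eq_bigr => j _.
rewrite /g.
have lEj : linear (fun r => E j (tens_map (EK i) (EK' i') r)).
  by move=> s u v; rewrite tens_map_linear linE.
have lDj : linear (fun r => D j (tens_map (DA i) (DB i') r)).
  by move=> s u v; rewrite tens_map_linear linD.
apply: etrans (tens_map_comp (relabel (@zip_copies n K K'))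
  (relabel (@zip_copies n A B)) _ lEj lDj) _.
rewrite tens_map_relabel tpow_charlie (tens_map_comp (tens_map (EK i) (EK' i'))
  (tens_map (DA i) (DB i')) _ (linE j) (linD j)).
by rewrite tens_map_charlie_ab.
Qed.
End Compose.

Lemma oneway_rl_density (A A1 B B1 : finType) (G : superop R (A ** B) (A1 ** B1)) r :
  oneway_rl G -> density r -> density (G r).
Proof.
move=> [I [D [E [chD insE eG]]]] [pr tr1]; rewrite eG; split.
  apply: psdmx_sum => i; apply: (kraus_psd _ pr); apply: kraus_tens_map.
    exact: channel_kraus.
  by apply: cp_kraus; apply: insE.1.
rewrite raddf_sum /= tr_tens_map_r // => [i u|u]; first by case: (chD i).
exact: instrument_tr.
Qed.

Lemma oneway_lr_density (A A1 B B1 : finType) (G : superop R (A ** B) (A1 ** B1)) r :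
  oneway_lr G -> density r -> density (G r).
Proof.
move=> [I [E [D [insE chD eG]]]] [pr tr1]; rewrite eG; split.
  apply: psdmx_sum => i; apply: (kraus_psd _ pr); apply: kraus_tens_map.
    by apply: cp_kraus; apply: insE.1.
  exact: channel_kraus.
rewrite raddf_sum /= tr_tens_map // => [u|i u]; last by case: (chD i).
exact: instrument_tr.
Qed.

(** F is the total infidelity: the terms of the one-shot bound, with weight t, and the errors of the
    two initial protocols. The weight u belongs to the passage from infidelity to trace norm. *)
Lemma key_swap_distills (A B K K' : finType) (rho : op R (A ** K))
    (rho' : op R (K' ** B)) (n d1 d2 d : nat) (SA SC SC' SB TA TB I : finType)
    (gamma1 : op R ((key d1 ** SA) ** (key d1 ** SC)))
    (gamma2 : op R ((key d2 ** SC') ** (key d2 ** SB)))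
    (gamma : op R ((key d ** TA) ** (key d ** TB)))
    (G : superop R (copies n A ** copies n K) ((key d1 ** SA) ** (key d1 ** SC)))
    (G' : superop R (copies n K' ** copies n B) ((key d2 ** SC') ** (key d2 ** SB)))
    (M : I -> op R ((key d1 ** SC) ** (key d2 ** SC')))
    (L : superop R (((key d1 ** SA) ** I) ** ((key d2 ** SB) ** I))
                   ((key d ** TA) ** (key d ** TB)))
    (N' : nat) (t u x1 x2 x : R) :
  density rho -> density rho' ->
  (0 < d1)%N -> (0 < d2)%N -> (0 < d)%N ->
  strictly_irreducible gamma1 -> strictly_irreducible gamma2 ->
  private_state gamma -> oneway_rl G -> oneway_lr G' -> povm M -> locc L ->
  trnorm (G (tpow n rho) - gamma1) <= x1 ->
  trnorm (G' (tpow n rho') - gamma2) <= x2 ->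
  trnorm (L (charlie_measure M (tens gamma1 gamma2)) - gamma) <= x ->
  0 < t -> 0 < u ->
  let F := 2 * x + 2 * t + t^-1 * x + t^-1 * (N'%:R / d%:R) + x1 + x2 in
  exists L' : superop R (copies n (K ** K') ** copies n (A ** B))
                        (key N'.+1 ** key N'.+1),
    oneway_lr L' /\
    trnorm (L' (tpow n (charlie_vs_ab rho rho')) - maxent N'.+1)
      <= 2 * F + u^-1 * F + u.
Proof.
move=> dr dr' d10 d20 d0 irr1 irr2 pg oG oG' pM lL h1 h2 h t0 u0 F.
have t0c : 0 < t%:C%C by rewrite ltcR.
have [J [E [D [insE chD hF]]]] :=
  swap_to_distill d10 d20 irr1 irr2 pM N' d0 pg lL t0c.
have [L' [oL' eL']] := oneway_compose rho rho' oG oG' insE chD.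
exists L'; split=> //.
have da := oneway_rl_density oG (tpow_density n dr).
have db := oneway_lr_density oG' (tpow_density n dr').
have dg1 := private_density d10 irr1.1.
have dg2 := private_density d20 irr2.1.
have [pX tX] := oneway_psd_tr insE chD (psd_charlie_ab da.1 db.1).
rewrite eL'; apply: trnorm_sub_maxent => //.
  by rewrite tX tr_charlie_ab da.2 db.2 mulr1.
have := fidelity_continuity insE chD da dg1 db dg2.
rewrite [X in _ <= X -> _]/fidelity -raddf_sum -mulmx_sumr; apply: le_trans.
have := lerB (lerB hF (lexx (x1%:C%C))) (lexx (x2%:C%C)).
move=> hlow; apply: le_trans (_ : _ <= fidelity E D gamma1 gamma2 - x1%:C%C - x2%:C%C) _.
  apply: le_trans hlow.
  set e := trnorm _ in h *.
  have -> : 1 - 2 * e%:C%C - 2 * t%:C%C - (t%:C%C)^-1 * e%:C%C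
     - (t%:C%C)^-1 * (N'%:R / d%:R) - x1%:C%C - x2%:C%C
    = (1 - 2 * e - 2 * t - t^-1 * e - t^-1 * (N'%:R / d%:R) - x1 - x2)%:C%C.
    rewrite !rmorphB !rmorphM /= !fmorphV rmorph1 !rmorph_nat; ring.
  rewrite lecR /F.
  have : t^-1 * e <= t^-1 * x by apply: ler_wpM2l => //; rewrite invr_ge0 ltW.
  move: (t^-1 * e) (t^-1 * x) (t^-1 * (N'%:R / d%:R)) h => a b c; lra.
by rewrite !lerB // lecR.
Qed.

End Assembly.

(** * Rates *)

Local Open Scope classical_set_scope.

Section Limits.
Variable R : realType.

Lemma limn_esup_le_shift (u v : (\bar R)^nat) (c : R) : 0 <= c ->
  (forall n, (0 < n)%N -> (u n <= v n + (c / n%:R)%:E)%E) ->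
  (limn_esup u <= limn_esup v)%E.
Proof.
move=> c0 uv; apply/lee_addgt0Pr => e e0.
rewrite -leeBlDr //; apply: le_ereal_inf_tmp => _ [V oV <-].
rewrite leeBlDr //.
(* From this index on, c / n is at most e. *)
pose m := (Num.truncn (c / e)).+1.
pose W := V `&` [set n | (m <= n)%N].
have oW : (\oo : set_system nat) W.
  by apply: filterI => //; exists m.
apply: (@le_trans _ _ (ereal_sup (u @` W))).
  by apply: ereal_inf_lbound; exists W.
apply: ge_ereal_sup => _ [n [Vn mn] <-].
have n0 : (0 < n)%N by apply: leq_trans mn.
apply: (le_trans (uv _ n0)); apply: leeD.
  by apply: ereal_sup_ubound; exists n.
rewrite lee_fin ler_pdivrMr ?ltr0n // -ler_pdivrMl //.
rewrite mulrC; apply: ltW; apply: (lt_le_trans (truncnS_gt _)).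
by rewrite ler_nat.
Qed.

Lemma limn_esup_mono (u v : (\bar R)^nat) :
  (forall n, (u n <= v n)%E) -> (limn_esup u <= limn_esup v)%E.
Proof.
move=> uv; apply: (@limn_esup_le_shift _ _ 0) => // n _.
by rewrite mul0r adde0.
Qed.

(** Near 0 the function lies between its infimum along the diagonal and its value on the diagonal at
    the largest of the three arguments; both bounds tend to that infimum. *)
Lemma cvg_monotone_prod3 (f : R * R * R -> \bar R) :
  (forall s t, 0 < s.1.1 -> 0 < s.1.2 -> 0 < s.2 ->
     s.1.1 <= t.1.1 -> s.1.2 <= t.1.2 -> s.2 <= t.2 -> (f s <= f t)%E) ->
  cvg (f @ filter_prod (filter_prod (0 : R)^'+ (0 : R)^'+) (0 : R)^'+).
Proof.
move=> mf.
pose phi x := f (x, x, x).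
pose mx (t : R * R * R) := Num.max (Num.max t.1.1 t.1.2) t.2.
set F := filter_prod _ _.
have near3 (e : R) : 0 < e -> F [set t | [/\ 0 < t.1.1 < e, 0 < t.1.2 < e & 0 < t.2 < e]].
  move=> e0.
  have h : (0 : R)^'+ [set x | 0 < x < e].
    near=> x; rewrite /=; apply/andP; split; near: x; first exact: nbhs_right_gt.
    exact: nbhs_right_lt.
  exists ([set x | 0 < x.1 < e /\ 0 < x.2 < e], [set x | 0 < x < e]) => /=.
    by split=> //; exists ([set x | 0 < x < e], [set x | 0 < x < e]) => //=.
  by move=> t /= [[]].
have mono : {in Interval (BRight (0 : R)) (BLeft 1) &, nondecreasing_fun phi}.
  by move=> x y; rewrite !in_itv /= => /andP[x0 _] /andP[y0 _] xy; apply: mf.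
have phi_cvg := nondecreasing_at_right_cvge (BLeft (1 : R))
  (ltr01 : (BRight (0 : R) < BLeft 1)%O) mono.
set l := ereal_inf _ in phi_cvg.
have mx_cvg : mx @ F --> (0 : R)^'+.
  move=> A [e /= e0 hA].
  apply: filterS (near3 e e0) => t [/andP[a1 a2] /andP[b1 b2] /andP[c1 c2]].
  rewrite /=; have m0 : 0 < mx t by rewrite /mx !lt_max a1.
  apply: hA => //=; rewrite sub0r normrN gtr0_norm //.
  by rewrite /mx !gt_max a2 b2.
apply/cvg_ex; exists l.
apply: (@squeeze_cvge _ _ _ _ (cst l) f (phi \o mx)); last 2 first.
- exact: cvg_cst.
- exact: cvg_comp mx_cvg phi_cvg.
apply: filterS (near3 1 ltr01) => t [/andP[a1 a2] /andP[b1 b2] /andP[c1 c2]].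
apply/andP; split.
  pose mn := Num.min (Num.min t.1.1 t.1.2) t.2.
  have mn0 : 0 < mn by rewrite /mn !lt_min a1 b1.
  apply: (@le_trans _ _ (phi mn)).
    apply: ereal_inf_lbound; exists mn => //=; rewrite in_itv /= mn0.
    by rewrite /mn !gt_min a2.
  by apply: mf => //=; rewrite /mn !ge_min lexx ?orbT.
by apply: mf => //=; rewrite /mx !le_max lexx ?orbT.
Unshelve. all: by end_near. Qed.

(** The constants depend on the target error alone, not on n or on the protocol; this uniformity is
    what lets the loss c / n vanish in the limit. *)
Lemma key_rate_le_distill_rate (A B K K' : finType) (rho : op R (A ** K))
    (rho' : op R (K' ** B)) (eps0 : R) : density rho -> density rho' -> 0 < eps0 ->
  exists eta c : R, [/\ 0 < eta, 0 <= c &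
    forall eps e e' n r, eps <= eta -> e <= eta -> e' <= eta -> (0 < n)%N ->
      key_swap_rates rho rho' eps e e' n r ->
      exists2 r', distill_rates (charlie_vs_ab rho rho') eps0 n r'
        & r <= r' + c / n%:R].
Proof.
move=> dr dr' e0.
(* With F the error of [key_swap_distills], the constants ensure F <= phi and
   (2 F + F / u + u) / 2 <= eps0. *)
pose u := eps0 / 2.
have u0 : 0 < u by rewrite divr_gt0.
pose phi := (eps0 / 2) / (1 + u^-1 / 2).
have u1 : 0 < 1 + u^-1 / 2 by rewrite addr_gt0 // divr_gt0 // invr_gt0.
have phi0 : 0 < phi by rewrite !divr_gt0.
pose t := phi / 8.
have t0 : 0 < t by rewrite divr_gt0.
pose delta := t * (phi / 4).
have delta0 : 0 < delta by rewrite mulr_gt0 // divr_gt0.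
(* Each input error enters as a trace norm of at most 2 eta, which contributes 8 eta + 2 eta / t to
   F. This, 2 t and the term with N' / d are each at most phi / 4. *)
pose eta := (phi / 4) / (8 + 2 * t^-1).
have t10 : 0 < t^-1 by rewrite invr_gt0.
have t8 : 0 < 8 + 2 * t^-1 by rewrite addr_gt0 // mulr_gt0.
have eta0 : 0 < eta by rewrite !divr_gt0.
have ln20 : 0 < ln 2 :> R by rewrite ln_gt0 // ltr1n.
(* The loss is the base 2 logarithm of the ratio delta between message number and key dimension. *)
exists eta, (`|ln delta| / ln 2); split=> //.
  by rewrite divr_ge0 // ltW.
move=> eps e e' n r heps he he' n0.
case=> s [s' [d1 [d2 [d [SA [SC [SC' [SB [TA [TB [I [g1 [g2 [g [G [G' [M [L]]]]]]]]]]]]]]]]]].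
case=> [[k1 k2 k] [i1 i2 pg] [oG oG' pM lL] [h1 h2 h3]].
have pos m x : keydim m (x : R) -> (0 < m)%N.
  by rewrite /keydim => km; rewrite -(ltr0n R) km powR_gt0.
have tw (X : finType) (a b : op R X) x : trace_close x a b -> x <= eta ->
    trnorm (a - b) <= 2 * eta.
  rewrite /trace_close => hx xe; rewrite -ler_pdivrMl //.
  exact: le_trans hx xe.
(* N' <= delta d controls the error, while the number of messages N' + 1 exceeds delta d, which
   controls the rate. N' = 0 is allowed. *)
pose N' := Num.truncn (delta * d%:R).
have [L' [oL' hL']] := key_swap_distills N' dr dr' (pos _ _ k1) (pos _ _ k2) (pos _ _ k)
  i1 i2 pg oG oG' pM lL (tw _ _ _ _ h1 he) (tw _ _ _ _ h2 he') (tw _ _ _ _ h3 heps) t0 u0.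
have d0 : 0 < d%:R :> R by rewrite ltr0n; apply: pos k.
have nn0 : n%:R != 0 :> R by rewrite pnatr_eq0 -lt0n.
have l0 : ln 2 != 0 :> R by rewrite gt_eqF.
exists (ln N'.+1%:R / ln 2 / n%:R).
  exists N'.+1, L'; split=> //.
    rewrite /keydim [n%:R * _]mulrC mulfVK // /powR pnatr_eq0 /=.
    by rewrite mulfVK // lnK // posrE ltr0n.
  rewrite /trace_close; set x := trnorm _ in hL' *.
  set F := (X in 2 * X + _ + _) in hL'.
  have F1 : F <= phi.
    have q : t^-1 * (N'%:R / d%:R) <= phi / 4.
      rewrite ler_pdivrMl // ler_pdivrMr // -/delta.
      by rewrite truncn_le mulr_ge0 // ltW.
    have q2 : eta * (8 + 2 * t^-1) = phi / 4.
      by rewrite /eta mulfVK // gt_eqF.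
    have q3 : 2 * t = phi / 4 by rewrite /t; field.
    have q4 : t^-1 * (2 * eta) = eta * (2 * t^-1) by ring.
    rewrite /F q4; move: q q2; rewrite mulrDr.
    move: (eta * (2 * t^-1)) (t^-1 * _) => y z; lra.
  have q5 : phi + u^-1 * phi / 2 = eps0 / 2.
    by rewrite -[RHS](mulfVK (lt0r_neq0 u1)) -/phi; ring.
  have q6 : u^-1 * F <= u^-1 * phi by rewrite ler_pM2l // invr_gt0.
  have q7 : u = eps0 / 2 by [].
  move: q5 q6 hL'; move: (u^-1 * phi) (u^-1 * F) => y z; lra.
have kd : n%:R * r * ln 2 = ln d%:R by rewrite k ln_powR.
have lnN : ln delta + ln d%:R <= ln N'.+1%:R.
  have dd0 : 0 < delta * d%:R by apply: mulr_gt0.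
  rewrite -lnM ?posrE // ler_ln ?posrE ?ltr0n //.
  by apply: ltW; apply: truncnS_gt.
have dl : - ln delta <= `|ln delta| by rewrite -normrN ler_norm.
rewrite -mulrDl -mulrDl ler_pdivlMr ?ltr0n // ler_pdivlMr //.
rewrite [r * _]mulrC kd; lra.
Qed.

Lemma trace_close_le X (a b : op R X) (e e' : R) :
  e <= e' -> trace_close e a b -> trace_close e' a b.
Proof. by move=> ee h; apply: le_trans h ee. Qed.

Lemma key_swap_rates_mono (A B K K' : finType) (rho : op R (A ** K))
    (rho' : op R (K' ** B)) (a b c a' b' c' : R) n :
  a <= a' -> b <= b' -> c <= c' ->
  key_swap_rates rho rho' a b c n `<=` key_swap_rates rho rho' a' b' c' n.
Proof.
move=> aa bb cc r.
case=> s [s' [d1 [d2 [d [SA [SC [SC' [SB [TA [TB [I [g1 [g2 [g [G [G' [M [L]]]]]]]]]]]]]]]]]].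
case=> [h1 h2 h3 [t1 t2 t3]].
exists s, s', d1, d2, d, SA, SC, SC', SB, TA, TB, I, g1, g2, g, G, G', M, L.
by split=> //; split; [apply: trace_close_le t1 | apply: trace_close_le t2
  | apply: trace_close_le t3].
Qed.

Lemma distill_rates_mono (X Y : finType) (tau : op R (X ** Y)) (a a' : R) n :
  a <= a' -> distill_rates tau a n `<=` distill_rates tau a' n.
Proof.
move=> aa r [d [L [h1 h2 h3]]]; exists d, L; split=> //.
exact: trace_close_le h3.
Qed.

End Limits.

Theorem theorem29 (R : realType) (A B C C' : finType)
    (rho : op R (A ** C)) (rho' : op R (C' ** B)) :
  density rho -> density rho' ->
  (key_swap_rate rho rho' <= oneway_distillable (charlie_vs_ab rho rho'))%E.
Proof.
move=> dr dr'; rewrite /key_swap_rate /oneway_distillable.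
set f := (X in X @ _); set g := (X in (_ <= lim (X @ _))%E).
have sup_sub (S S' : set R) : S `<=` S' ->
    (ereal_sup [set x%:E | x in S] <= ereal_sup [set x%:E | x in S'])%E.
  by move=> SS; apply: ereal_sup_le => _ [x Sx <-]; exists x => //; apply: SS.
(* Comparing values of [lim] requires both limits to exist; monotonicity in the errors provides
   this. *)
have cf : cvg (f @ filter_prod (filter_prod (0 : R)^'+ (0 : R)^'+) (0 : R)^'+).
  apply: cvg_monotone_prod3 => s t _ _ _ h1 h2 h3; apply: limn_esup_mono => n.
  by apply: sup_sub; apply: key_swap_rates_mono.
have cg : cvg (g x @[x --> (0 : R)^'+]).
  apply: nondecreasing_at_right_is_cvge; near=> x => y z _ _ yz.
  by apply: limn_esup_mono => n; apply: sup_sub; apply: distill_rates_mono.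
apply: (lime_ge cg); near=> e0.
have e00 : 0 < e0 by near: e0; exact: nbhs_right_gt.
(* For a fixed distillation error, the comparison holds for all three key errors up to eta, hence
   throughout a neighbourhood in the product filter. *)
have [eta [c [eta0 c0 H]]] := key_rate_le_distill_rate dr dr' e00.
apply: (lime_le cf).
have small : (0 : R)^'+ [set x | x <= eta].
  by apply: nbhs_right_le.
exists ([set t | t.1 <= eta /\ t.2 <= eta], [set x | x <= eta]) => /=.
  by split=> //; exists ([set x | x <= eta], [set x | x <= eta]).
move=> [[e1 e2] e3] /= [[h1 h2] h3].
apply: (limn_esup_le_shift c0) => n n0.
apply: ge_ereal_sup => _ [r hr <-].
have [r' hr' le] := H _ _ _ _ _ h1 h2 h3 n0 hr.
apply: (@le_trans _ _ (r' + c / n%:R)%:E); first by rewrite lee_fin.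
rewrite EFinD; apply: leeD => //.
by apply: ereal_sup_ubound; exists r'.
Unshelve. all: by end_near. Qed.
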